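(* Let $\Bbbk$ be an algebraically closed field of characteristic zero, let $n\ge 1$ be an integer and let $\alpha,\beta\in\Bbbk$. Let $\mathcal D$ be one of the algebras $\mathcal H_n(\alpha,\beta)$ (any $n\geq 1$), $\mathcal B_n(\alpha,\beta)$ (with $n\ge 2$), or $\mathcal C_n(\alpha,\beta)$ (with $n\ge 2$). The following are equivalent: (1) $\beta\neq 0$; (2) $\mathcal D$ is a piecewise domain (with respect to the idempotents $e_0,\dots,e_{n-1}$); (3) $\mathcal D$ is right (or left) noetherian. Moreover, if any of these conditions holds, then $\mathcal D$ is twisted graded Calabi--Yau of dimension three.
   Context: Path algebras: paths are composed left to right, i.e. for paths $p,q$ the product $pq$ is concatenation if the target of $p$ equals the source of $q$, and $0$ otherwise; $e_i$ is the trivial path at vertex $i$; path algebras are graded by path length. All vertex and arrow indices below are taken modulo $n$; vertex set is $\{0,\dots,n-1\}$. $\mathcal H_n(\alpha,\beta)$ (type A, here with constant parameters): quiver $\overline Q$ with arrows $u_i:i\to i+1$ and $d_i:i+1\to i$; $\mathcal H_n(\alpha,\beta)$ is $\Bbbk\overline Q$ modulo, for all $i$, $d_{i-1}u_{i-1}u_i=\alpha u_id_iu_i+\beta u_iu_{i+1}d_{i+1}$ and $d_id_{i-1}u_{i-1}=\alpha d_iu_id_i+\beta u_{i+1}d_{i+1}d_i$. $\mathcal B_n(\alpha,\beta)$ (type B): quiver $\widetilde Q$ with arrows $a_i:i\to i+1$ and loops $b_i:i\to i$; $\mathcal B_n(\alpha,\beta)$ is $\Bbbk\widetilde Q$ modulo,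 for all $i$, $b_ia_ia_{i+1}=\alpha a_ib_{i+1}a_{i+1}+\beta a_ia_{i+1}b_{i+2}$ and $b_i^2a_i=\alpha b_ia_ib_{i+1}+\beta a_ib_{i+1}^2$. $\mathcal C_n(\alpha,\beta)$ (type C): quiver $\widehat Q$ with arrows $a_i,b_i:i\to i+1$; $\mathcal C_n(\alpha,\beta)$ is $\Bbbk\widehat Q$ modulo, for all $i$, $b_ia_{i+1}a_{i+2}=\alpha a_ib_{i+1}a_{i+2}+\beta a_ia_{i+1}b_{i+2}$ and $b_ib_{i+1}a_{i+2}=\alpha b_ia_{i+1}b_{i+2}+\beta a_ib_{i+1}b_{i+2}$. Piecewise domain: a ring $R$ with a complete set of orthogonal idempotents $e_0,\dots,e_{n-1}$ is a piecewise domain if for all $i,j,k$ and all $a\in e_iRe_j$, $b\in e_jRe_k$, $ab=0$ implies $a=0$ or $b=0$. Twisted Calabi--Yau: with $A^e=A\otimes_\Bbbk A^{\mathrm{op}}$, an algebra $A$ is homologically smooth if $A$ has a finite length resolution by finitely generated projective $A^e$-modules; it is twisted Calabi--Yau of dimension $d$ if moreover there is an invertible $(A,A)$-bimodule $U$ with $\mathrm{Ext}^i_{A^e}(A,A^e)\cong U$ for $i=d$ and $0$ for $i\ne d$, as right $A^e$-modules. ''Twisted graded Calabi--Yau'' is the graded version of this; for a graded algebra it is equivalent to being twisted Calabi--Yau. *)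

(* Defs.v *)
From HB Require Import structures.
From mathcomp Require Import all_boot all_order all_algebra.
From mathcomp Require Import boolp classical_sets functions.
From mathcomp Require Import finmap monalg.

Set Implicit Arguments.
Unset Strict Implicit.
Unset Printing Implicit Defensive.

Import GRing.Theory.
Local Open Scope classical_set_scope.
Local Open Scope ring_scope.
Local Open Scope quotient_scope.

Section Quotients.
Context (R : pzRingType) (V : lmodType R).
Implicit Type S : set V.

Definition is_submodule (P : set V) : Prop :=
  P 0 /\ forall (c : R) (u v : V), P u -> P v -> P (c *: u + v).

(* Smallest submodule containing S. *)
Definition lspan S : {pred V} :=
  [pred x | `[< forall P : set V, is_submodule P -> S `<=` P -> P x >]].

Fact lspan_submod S : submod_closed (lspan S).
Proof.
split; first by apply/asboolP => P [].
move=> c u v /asboolP hu /asboolP hv; apply/asboolP => P hP SP.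
by apply: hP.2; [exact: hu|exact: hv].
Qed.
HB.instance Definition _ S :=
  GRing.isSubmodClosed.Build R V (lspan S) (lspan_submod S).

(* Quotient of V by the submodule spanned by S. *)
Definition lquot S : Type := {ideal_quot (lspan S)}.
HB.instance Definition _ S := GRing.Zmodule.on (lquot S).

Definition lquot_pi S (x : V) : lquot S := \pi_({ideal_quot (lspan S)}) x.
Definition lquot_repr S (q : lquot S) : V := repr (q : {ideal_quot (lspan S)}).

Lemma lquot_reprK S : cancel (@lquot_repr S) (lquot_pi S).
Proof. by move=> q; exact: reprK. Qed.

Lemma lquot_piP S x y : lquot_pi S x = lquot_pi S y <-> x - y \in lspan S.
Proof.
split=> h.
  by rewrite Quotient.idealrBE; apply/eqP.
by apply/eqP; rewrite -[_ == _]Quotient.idealrBE.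
Qed.

Lemma lquot_piD S : {morph lquot_pi S : x y / x + y}.
Proof. by move=> x y; rewrite /lquot_pi; exact: raddfD. Qed.

Definition lquot_scale S (c : R) (q : lquot S) : lquot S :=
  lquot_pi S (c *: lquot_repr q).

Lemma lquot_piZ S c x : lquot_pi S (c *: x) = lquot_scale c (lquot_pi S x).
Proof.
apply/lquot_piP; rewrite -scalerBr rpredZ //.
by apply/lquot_piP; rewrite lquot_reprK.
Qed.

Lemma lquot_ind S (P : lquot S -> Prop) :
  (forall x, P (lquot_pi S x)) -> forall q, P q.
Proof. by move=> h q; rewrite -[q]lquot_reprK. Qed.

Fact lquot_scaleA S a b (v : lquot S) :
  lquot_scale a (lquot_scale b v) = lquot_scale (a * b) v.
Proof. by elim/lquot_ind: v => x; rewrite -!lquot_piZ scalerA. Qed.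
Fact lquot_scale1 S : left_id 1 (@lquot_scale S).
Proof. by elim/lquot_ind=> x; rewrite -!lquot_piZ scale1r. Qed.
Fact lquot_scaleDr S : right_distributive (@lquot_scale S) +%R.
Proof.
move=> a; elim/lquot_ind=> x; elim/lquot_ind=> y.
by rewrite -lquot_piD -!lquot_piZ -lquot_piD scalerDr.
Qed.
Fact lquot_scaleDl S (v : lquot S) :
  {morph (@lquot_scale S)^~ v : a b / a + b}.
Proof.
by move=> a b; elim/lquot_ind: v => x; rewrite -!lquot_piZ -lquot_piD scalerDl.
Qed.
HB.instance Definition _ S := GRing.Zmodule_isLmodule.Build R (lquot S)
  (@lquot_scaleA S) (@lquot_scale1 S) (@lquot_scaleDr S) (@lquot_scaleDl S).

Fact lquot_pi_linear S : linear (lquot_pi S).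
Proof. by move=> c x y; rewrite lquot_piD lquot_piZ. Qed.
HB.instance Definition _ S :=
  GRing.isLinear.Build R V (lquot S) _ (lquot_pi S) (lquot_pi_linear S).

Lemma lspan_gen S x : S x -> x \in lspan S.
Proof. by move=> Sx; apply/asboolP => P _; exact. Qed.

Lemma lspan_is_submodule S : is_submodule (fun x => x \in lspan S).
Proof. exact: lspan_submod. Qed.

Lemma lspan_sub S (P : set V) :
  is_submodule P -> S `<=` P -> forall x, x \in lspan S -> P x.
Proof. by move=> hP SP x /asboolP; exact. Qed.

Section Lift.
Context (W : lmodType R) (S : set V) (f : {linear V -> W}).
Hypothesis fS : forall x, S x -> f x = 0.

Definition lquot_lift (q : lquot S) : W := f (lquot_repr q).

Lemma lquot_liftE x : lquot_lift (lquot_pi S x) = f x.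
Proof.
apply/eqP; rewrite -subr_eq0 -raddfB; apply/eqP.
have : lquot_repr (lquot_pi S x) - x \in lspan S.
  by apply/lquot_piP; rewrite lquot_reprK.
apply: (@lspan_sub S (fun y => f y = 0)) => //.
by split; [exact: raddf0|move=> c u v fu fv; rewrite linearP fu fv scaler0 addr0].
Qed.

End Lift.
End Quotients.

Section FreeLift.
Context (k : nzRingType) (K : choiceType) (V : lmodType k).

Definition malg_lift (f : K -> V) (g : {malg k[K]}) : V :=
  \sum_(x <- msupp g) g@_x *: f x.

Lemma malg_liftw f (g : {malg k[K]}) (d : {fset K}) :
  (msupp g `<=` d)%fset -> malg_lift f g = \sum_(x <- d) g@_x *: f x.
Proof.
move=> gd; rewrite [RHS](bigID (fun x => x \in msupp g)) /= [X in _ + X]big1.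
  rewrite addr0 -big_filter /malg_lift; apply: perm_big; apply: uniq_perm => //.
    by rewrite filter_uniq.
  move=> x; rewrite mem_filter; case: (boolP (x \in msupp g)) => //= xg.
  by rewrite (fsubsetP gd).
by move=> x xg; rewrite mcoeff_outdom // scale0r.
Qed.

Fact malg_lift_linear f : linear (malg_lift f).
Proof.
move=> c g h; pose d := (msupp g `|` msupp h)%fset.
rewrite !(@malg_liftw _ _ d) ?fsubsetUl ?fsubsetUr //; last first.
  apply: (fsubset_trans (msuppD_le _ _)); apply: fsetUSS => //.
  exact: msuppZ_le.
rewrite scaler_sumr -big_split /=; apply: eq_bigr => x _.
by rewrite mcoeffD mcoeffZ scalerDl scalerA.
Qed.
HB.instance Definition _ f :=
  GRing.isLinear.Build k {malg k[K]} V _ (malg_lift f) (malg_lift_linear f).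

Lemma malg_liftZ f c (g : {malg k[K]}) :
  malg_lift f (c *: g) = c *: malg_lift f g.
Proof. exact: linearZ_LR. Qed.

Lemma malg_liftU f x : malg_lift f << x >> = f x.
Proof.
by rewrite (@malg_liftw _ _ [fset x]%fset) ?msuppU_le // big_seq_fset1 mcoeffUU
  scale1r.
Qed.

Lemma malg_ind (P : {malg k[K]} -> Prop) :
  P 0 -> (forall c x g, P g -> P (c *: << x >> + g)) -> forall g, P g.
Proof.
move=> P0 PS g; rewrite [g]monalgE; elim: (X in \sum_(i <- X) _) => [|x s ih].
  by rewrite big_nil.
rewrite big_cons; suff -> : << g@_x *g x >> = g@_x *: << x >> by exact: PS.
by apply/malgP => y; rewrite mcoeffZ !mcoeffU mulr_natr.
Qed.

End FreeLift.

Record quiver := Quiver {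
  vertex : finType;
  arrow : choiceType;
  asrc : arrow -> vertex;
  atgt : arrow -> vertex
}.

Section Paths.
Context (k : fieldType) (Q : quiver).

Fixpoint is_walk (v : vertex Q) (s : seq (arrow Q)) : bool :=
  if s is a :: s' then (asrc a == v) && is_walk (atgt a) s' else true.

Definition walk_end (v : vertex Q) (s : seq (arrow Q)) : vertex Q :=
  last v (map (@atgt Q) s).

Record qpath := QPath {
  qpath_val :> vertex Q * seq (arrow Q);
  qpathP : is_walk qpath_val.1 qpath_val.2
}.
HB.instance Definition _ := [isSub for qpath_val].
HB.instance Definition _ := [Choice of qpath by <:].

Definition psrc (p : qpath) : vertex Q := p.1.
Definition ptgt (p : qpath) : vertex Q := walk_end p.1 p.2.
Definition plen (p : qpath) : nat := size p.2.

Definition ptriv (v : vertex Q) : qpath := @QPath (v, [::]) isT.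

Fact parrow_walk (a : arrow Q) : is_walk (asrc a) [:: a].
Proof. by rewrite /= eqxx. Qed.
Definition parrow (a : arrow Q) : qpath := @QPath (asrc a, [:: a]) (parrow_walk a).

(* Only meaningful if the target of p is the source of q; the value p that
   [insubd] returns otherwise is discarded by [pmul]. *)
Definition pcat (p q : qpath) : qpath := insubd p (psrc p, p.2 ++ q.2).

Lemma is_walk_cat v s t :
  is_walk v (s ++ t) = is_walk v s && is_walk (walk_end v s) t.
Proof. by elim: s v => //= a s ih v; rewrite ih andbA. Qed.

Lemma pcatE p q : ptgt p = psrc q -> val (pcat p q) = (psrc p, p.2 ++ q.2).
Proof.
move=> pq; rewrite val_insubd /= is_walk_cat (qpathP p) /=.
by rewrite -/(ptgt p) pq (qpathP q).
Qed.

Lemma psrc_cat p q : ptgt p = psrc q -> psrc (pcat p q) = psrc p.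
Proof. by move=> /pcatE h; rewrite /psrc h. Qed.

Lemma ptgt_cat p q : ptgt p = psrc q -> ptgt (pcat p q) = ptgt q.
Proof.
move=> h; rewrite {1}/ptgt pcatE //= /walk_end map_cat last_cat.
by rewrite -[X in last X _]/(ptgt p) h.
Qed.

Lemma pcatA p q r : ptgt p = psrc q -> ptgt q = psrc r ->
  pcat (pcat p q) r = pcat p (pcat q r).
Proof.
move=> pq qr; apply: val_inj.
by rewrite !pcatE ?ptgt_cat ?psrc_cat //= catA.
Qed.

Definition path_algebra : Type := {malg k[qpath]}.
HB.instance Definition _ := GRing.Lmodule.on path_algebra.

End Paths.

HB.lock Definition pelt (k : fieldType) (Q : quiver) (p : qpath Q) :
  path_algebra k Q := << p >>.
Arguments pelt {k Q} p.

Definition pmul (k : fieldType) (Q : quiver) (p q : qpath Q) :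
    path_algebra k Q :=
  if ptgt p == psrc q then pelt (pcat p q) else 0.
Arguments pmul {k Q} p q.

HB.lock Definition pa_mul (k : fieldType) (Q : quiver) (x y : path_algebra k Q) :
    path_algebra k Q :=
  malg_lift (fun p => malg_lift (fun q => pmul p q) y) x.
Arguments pa_mul {k Q} x y.

Section PathAlgebra.
Context (k : fieldType) (Q : quiver).
Local Notation path_algebra := (path_algebra k Q).
Implicit Types x y z : path_algebra.

Definition pa_one : path_algebra := \sum_(v : vertex Q) pelt (ptriv v).

Lemma pa_mulPr c x y z : pa_mul x (c *: y + z) = c *: pa_mul x y + pa_mul x z.
Proof.
rewrite !pa_mul.unlock /malg_lift scaler_sumr -big_split /=.
apply: eq_bigr => p _; rewrite -!/(malg_lift _ _) linearP scalerDr !scalerA.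
by rewrite (mulrC c).
Qed.

Lemma pa_mulPl c x y z : pa_mul (c *: x + z) y = c *: pa_mul x y + pa_mul z y.
Proof. by rewrite !pa_mul.unlock linearP. Qed.

Lemma pa_mulU (p q : qpath Q) :
  pa_mul (pelt p) (pelt q) = pmul p q :> path_algebra.
Proof. by rewrite pa_mul.unlock pelt.unlock !malg_liftU. Qed.

Lemma pa_mul0l y : pa_mul 0 y = 0.
Proof. by have := pa_mulPl (-1) 0 y 0; rewrite scaler0 addr0 scaleN1r addNr. Qed.
Lemma pa_mul0r y : pa_mul y 0 = 0.
Proof. by have := pa_mulPr (-1) y 0 0; rewrite scaler0 addr0 scaleN1r addNr. Qed.

Lemma pa_mulZl c x y : pa_mul (c *: x) y = c *: pa_mul x y.
Proof. by rewrite -[c *: x]addr0 pa_mulPl pa_mul0l addr0. Qed.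
Lemma pa_mulZr c x y : pa_mul x (c *: y) = c *: pa_mul x y.
Proof. by rewrite -[c *: y]addr0 pa_mulPr pa_mul0r addr0. Qed.

Lemma pa_eq_lin (f g : path_algebra -> path_algebra) :
  (forall c x y, f (c *: x + y) = c *: f x + f y) ->
  (forall c x y, g (c *: x + y) = c *: g x + g y) ->
  (forall p : qpath Q, f (pelt p) = g (pelt p)) -> forall x, f x = g x.
Proof.
have f0 h : (forall c x y, h (c *: x + y) = c *: h x + h y :> path_algebra) ->
    h 0 = 0 :> path_algebra.
  by move=> /(_ (-1) 0 0); rewrite scaler0 addr0 scaleN1r addNr.
move=> fl gl fg; elim/malg_ind => [|c p x ih]; first by rewrite !f0.
by rewrite fl gl ih -[<< p >>](congr1 (fun f => f k Q p) pelt.unlock) fg.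
Qed.

Fact pa_mulA : associative (@pa_mul k Q).
Proof.
move=> x y z.
apply: (@pa_eq_lin (fun x => pa_mul x (pa_mul y z))
                   (fun x => pa_mul (pa_mul x y) z)) x.
- by move=> c x1 x2; apply: pa_mulPl.
- by move=> c x1 x2; rewrite (pa_mulPl c x1 y) pa_mulPl.
move=> p.
apply: (@pa_eq_lin (fun y => pa_mul (pelt p) (pa_mul y z))
                   (fun y => pa_mul (pa_mul (pelt p) y) z)) y.
- by move=> c x1 x2; rewrite (pa_mulPl c x1 z) pa_mulPr.
- by move=> c x1 x2; rewrite (pa_mulPr c (pelt p) x1) pa_mulPl.
move=> q.
apply: (@pa_eq_lin (fun z => pa_mul (pelt p) (pa_mul (pelt q) z))
                   (fun z => pa_mul (pa_mul (pelt p) (pelt q)) z)) z.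
- by move=> c x1 x2; rewrite (pa_mulPr c (pelt q) x1) pa_mulPr.
- by move=> c x1 x2; rewrite pa_mulPr.
move=> r; rewrite (pa_mulU q r) (pa_mulU p q) /pmul.
case: (eqVneq (ptgt p) (psrc q)) => pq; case: (eqVneq (ptgt q) (psrc r)) => qr;
  rewrite ?pa_mul0l ?pa_mul0r ?pa_mulU // /pmul.
- by rewrite ptgt_cat // psrc_cat // pq qr !eqxx pcatA.
- by rewrite ptgt_cat // (negPf qr).
- by rewrite psrc_cat // (negPf pq).
Qed.

Lemma pa_mul_suml (I : Type) (s : seq I) F y :
  pa_mul (\sum_(i <- s) F i) y = \sum_(i <- s) pa_mul (F i) y.
Proof.
elim: s => [|i s ih]; first by rewrite !big_nil pa_mul0l.
by rewrite !big_cons -ih -[F i in LHS]scale1r pa_mulPl scale1r.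
Qed.
Lemma pa_mul_sumr (I : Type) (s : seq I) F y :
  pa_mul y (\sum_(i <- s) F i) = \sum_(i <- s) pa_mul y (F i).
Proof.
elim: s => [|i s ih]; first by rewrite !big_nil pa_mul0r.
by rewrite !big_cons -ih -[F i in LHS]scale1r pa_mulPr scale1r.
Qed.

Fact pa_mul1l : left_id pa_one (@pa_mul k Q).
Proof.
apply: (@pa_eq_lin (pa_mul pa_one) id) => // [c x y|p]; first exact: pa_mulPr.
rewrite pa_mul_suml (bigD1 (psrc p)) //= big1 => [|v vp]; rewrite pa_mulU /pmul.
  rewrite addr0 eqxx; congr pelt; apply: val_inj.
  by rewrite pcatE //= /psrc; case: (val p).
by rewrite /ptgt /= /walk_end /= (negPf vp).
Qed.
Fact pa_mul1r : right_id pa_one (@pa_mul k Q).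
Proof.
apply: (@pa_eq_lin (pa_mul^~ pa_one) id) => // [c x y|p]; first exact: pa_mulPl.
rewrite pa_mul_sumr (bigD1 (ptgt p)) //= big1 => [|v vp]; rewrite pa_mulU /pmul.
  rewrite addr0 eqxx; congr pelt; apply: val_inj.
  by rewrite pcatE //= cats0 /psrc; case: (val p).
by rewrite eq_sym (negPf vp).
Qed.
Fact pa_mulDl : left_distributive (@pa_mul k Q) +%R.
Proof.
by move=> x y z; have := pa_mulPl 1 x z y; rewrite !scale1r.
Qed.
Fact pa_mulDr : right_distributive (@pa_mul k Q) +%R.
Proof.
by move=> x y z; have := pa_mulPr 1 x y z; rewrite !scale1r.
Qed.
HB.instance Definition _ := GRing.Zmodule_isPzRing.Build path_algebra
  pa_mulA pa_mul1l pa_mul1r pa_mulDl pa_mulDr.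

Lemma peltM (p q : qpath Q) : pelt p * pelt q = pmul p q :> path_algebra.
Proof. exact: pa_mulU. Qed.

Lemma pa_scaleAl c x y : c *: (x * y) = (c *: x) * y.
Proof. exact: esym (pa_mulZl c x y). Qed.
Lemma pa_scaleAr c x y : c *: (x * y) = x * (c *: y).
Proof. exact: esym (pa_mulZr c x y). Qed.

Definition pa_idem (v : vertex Q) : path_algebra := pelt (ptriv v).
Definition pa_arrow (a : arrow Q) : path_algebra := pelt (parrow a).

Definition pa_homog (d : int) : set path_algebra :=
  [set x | forall p, p \in msupp x -> (plen p)%:Z = d].

End PathAlgebra.

(* [bqa rel] is kQ / (rel). *)
Section BoundQuiverAlgebra.
Context (k : fieldType) (Q : quiver) (rel : set (path_algebra k Q)).
Local Notation kQ := (path_algebra k Q).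

Definition ideal_gens : set kQ :=
  [set z | exists x r y : kQ, rel r /\ z = x * r * y].

Definition bqa : Type := lquot ideal_gens.
HB.instance Definition _ := GRing.Lmodule.on bqa.

Definition bqa_pi (x : kQ) : bqa := lquot_pi ideal_gens x.
Definition bqa_mul (x y : bqa) : bqa := bqa_pi (lquot_repr x * lquot_repr y).

Lemma idealMl x y : y \in lspan ideal_gens -> x * y \in lspan ideal_gens.
Proof.
move: y; apply: lspan_sub => [|z [a [r [b [Sr ->]]]]]; last first.
  by apply: lspan_gen; exists (x * a), r, b; rewrite !mulrA.
split=> [|c u v hu hv]; first by rewrite mulr0; exact: (lspan_is_submodule ideal_gens).1.
rewrite mulrDr -(pa_scaleAr c x u).
exact: ((lspan_is_submodule ideal_gens).2 c (x * u) (x * v) hu hv).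
Qed.
Lemma idealMr x y : y \in lspan ideal_gens -> y * x \in lspan ideal_gens.
Proof.
move: y; apply: lspan_sub => [|z [a [r [b [Sr ->]]]]]; last first.
  by apply: lspan_gen; exists a, r, (b * x); rewrite !mulrA.
split=> [|c u v hu hv]; first by rewrite mul0r; exact: (lspan_is_submodule ideal_gens).1.
rewrite mulrDl -(pa_scaleAl c u x).
exact: ((lspan_is_submodule ideal_gens).2 c (u * x) (v * x) hu hv).
Qed.

Lemma bqa_pi_mul x y : bqa_pi (x * y) = bqa_mul (bqa_pi x) (bqa_pi y).
Proof.
apply/lquot_piP; set x' := lquot_repr _; set y' := lquot_repr _.
have -> : x * y - x' * y' = (x - x') * y + x' * (y - y').
  by rewrite mulrBl mulrBr addrA subrK.
rewrite -[(x - x') * y]scale1r; apply: (lspan_is_submodule ideal_gens).2.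
  by apply: idealMr; apply/lquot_piP; rewrite lquot_reprK.
by apply: idealMl; apply/lquot_piP; rewrite lquot_reprK.
Qed.
Lemma bqa_piD x y : bqa_pi (x + y) = bqa_pi x + bqa_pi y.
Proof. exact: lquot_piD. Qed.
Lemma bqa_piZ c x : bqa_pi (c *: x) = c *: bqa_pi x.
Proof. exact: lquot_piZ. Qed.
Lemma bqa_ind (P : bqa -> Prop) : (forall x, P (bqa_pi x)) -> forall q, P q.
Proof. exact: lquot_ind. Qed.

Fact bqa_mulA : associative bqa_mul.
Proof.
elim/bqa_ind=> x; elim/bqa_ind=> y; elim/bqa_ind=> z.
by rewrite -!bqa_pi_mul mulrA.
Qed.
Fact bqa_mul1l : left_id (bqa_pi 1) bqa_mul.
Proof. by elim/bqa_ind=> x; rewrite -bqa_pi_mul mul1r. Qed.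
Fact bqa_mul1r : right_id (bqa_pi 1) bqa_mul.
Proof. by elim/bqa_ind=> x; rewrite -bqa_pi_mul mulr1. Qed.
Fact bqa_mulDl : left_distributive bqa_mul +%R.
Proof.
elim/bqa_ind=> x; elim/bqa_ind=> y; elim/bqa_ind=> z.
by rewrite -bqa_piD -!bqa_pi_mul -bqa_piD mulrDl.
Qed.
Fact bqa_mulDr : right_distributive bqa_mul +%R.
Proof.
elim/bqa_ind=> x; elim/bqa_ind=> y; elim/bqa_ind=> z.
by rewrite -bqa_piD -!bqa_pi_mul -bqa_piD mulrDr.
Qed.
HB.instance Definition _ := GRing.Zmodule_isPzRing.Build bqa
  bqa_mulA bqa_mul1l bqa_mul1r bqa_mulDl bqa_mulDr.

Lemma bqa_piM x y : bqa_pi (x * y) = bqa_pi x * bqa_pi y.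
Proof. exact: bqa_pi_mul. Qed.

Definition bqa_in (c : k) : bqa := c *: (1 : bqa).

Lemma bqa_inE c : bqa_in c = bqa_pi (c *: (1 : kQ)).
Proof. by rewrite bqa_piZ. Qed.

Fact bqa_in_zmod : zmod_morphism bqa_in.
Proof. by move=> c d; rewrite /bqa_in scalerBl. Qed.
Fact bqa_in_monoid : monoid_morphism bqa_in.
Proof.
split=> [|c d]; first by rewrite /bqa_in scale1r.
by rewrite !bqa_inE -[RHS]bqa_pi_mul -pa_scaleAl mul1r scalerA.
Qed.
HB.instance Definition _ := GRing.isZmodMorphism.Build k bqa bqa_in bqa_in_zmod.
HB.instance Definition _ :=
  GRing.isMonoidMorphism.Build k bqa bqa_in bqa_in_monoid.

Lemma bqa_in_central (c : k) (x : bqa) : bqa_in c * x = x * bqa_in c.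
Proof.
elim/bqa_ind: x => x; rewrite bqa_inE -[LHS]bqa_pi_mul -[RHS]bqa_pi_mul.
by rewrite -pa_scaleAl -pa_scaleAr mul1r mulr1.
Qed.

Definition bqa_idem (v : vertex Q) : bqa := bqa_pi (pa_idem k v).

(* Path length grading; the relations need not be homogeneous here. *)
Definition bqa_homog (d : int) : set bqa := bqa_pi @` pa_homog d.

End BoundQuiverAlgebra.

(* The library's [algType] excludes the zero ring, hence this record. *)
Record kalgebra (k : fieldType) := KAlgebra {
  kring :> pzRingType;
  kin : {rmorphism k -> kring};
  kin_central : forall (c : k) (x : kring), kin c * x = x * kin c
}.

Canonical bqa_kalgebra (k : fieldType) (Q : quiver)
    (rel : set (path_algebra k Q)) : kalgebra k :=
  KAlgebra (@bqa_in_central k Q rel).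

(* [env A] is the enveloping algebra A (x)_k A^op: the tensor product is the
   quotient of the free k-module on A x A by the bilinearity relations, and
   (a (x) b) (c (x) d) = ac (x) db, see [tensM]. *)
Section EnvelopingDef.
Context (k : fieldType) (A : kalgebra k).
Local Notation FA := {malg k[(A * A)%type]}.
Local Notation sym a b := (<< (a, b) >> : FA).

Inductive env_rel : set FA :=
| EnvDl (a a' b : A) : env_rel (sym (a + a') b - (sym a b + sym a' b))
| EnvDr (a b b' : A) : env_rel (sym a (b + b') - (sym a b + sym a b'))
| EnvZl (c : k) (a b : A) : env_rel (sym (kin A c * a) b - c *: sym a b)
| EnvZr (c : k) (a b : A) : env_rel (sym a (kin A c * b) - c *: sym a b).

Definition env : Type := lquot env_rel.
HB.instance Definition _ := GRing.Lmodule.on env.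

End EnvelopingDef.

HB.lock Definition tens (k : fieldType) (A : kalgebra k) (a b : A) : env A :=
  lquot_pi (@env_rel k A) << (a, b) >>.
Arguments tens {k A} a b.

HB.lock Definition env_lift (k : fieldType) (A : kalgebra k) (W : lmodType k)
    (phi : A -> A -> W) (t : env A) : W :=
  malg_lift (fun ab => phi ab.1 ab.2) (lquot_repr t).
Arguments env_lift {k A W} phi t.

Section Enveloping.
Context (k : fieldType) (A : kalgebra k).
Implicit Types (a b : A) (s t : env A).
Local Notation env := (env A).
Local Notation env_rel := (@env_rel k A).

Fact env_tensE a b : tens a b = lquot_pi env_rel << (a, b) >>.
Proof. by rewrite tens.unlock. Qed.

Lemma tensDl a a' b : tens (a + a') b = tens a b + tens a' b.
Proof.
by rewrite !env_tensE -[RHS]lquot_piD; apply/lquot_piP/lspan_gen; apply: EnvDl.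
Qed.
Lemma tensDr a b b' : tens a (b + b') = tens a b + tens a b'.
Proof.
by rewrite !env_tensE -[RHS]lquot_piD; apply/lquot_piP/lspan_gen; apply: EnvDr.
Qed.
Lemma tensZl c a b : tens (kin A c * a) b = c *: tens a b.
Proof.
by rewrite !env_tensE -[RHS]lquot_piZ; apply/lquot_piP/lspan_gen; apply: EnvZl.
Qed.
Lemma tensZr c a b : tens a (kin A c * b) = c *: tens a b.
Proof.
by rewrite !env_tensE -[RHS]lquot_piZ; apply/lquot_piP/lspan_gen; apply: EnvZr.
Qed.

Lemma env_ind (P : env -> Prop) :
  (forall a b, P (tens a b)) -> (forall s t, P s -> P t -> P (s + t)) ->
  forall t, P t.
Proof.
move=> Pt PD; elim/lquot_ind; elim/malg_ind => [|c [a b] g ih].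
  have -> : lquot_pi env_rel 0 = tens (kin A 0 * 0) 0.
    by rewrite tensZl scale0r; exact: raddf0.
  exact: Pt.
rewrite lquot_piD; apply: PD => //.
by rewrite lquot_piZ -env_tensE -[lquot_scale _ _]/(c *: tens a b) -tensZl; apply: Pt.
Qed.

Section Lift.
Context (W : lmodType k) (phi : A -> A -> W).

Definition bilinear2 : Prop :=
  [/\ forall a a' b, phi (a + a') b = phi a b + phi a' b,
      forall a b b', phi a (b + b') = phi a b + phi a b',
      forall c a b, phi (kin A c * a) b = c *: phi a b &
      forall c a b, phi a (kin A c * b) = c *: phi a b].

Hypothesis phiB : bilinear2.

Lemma env_lift_rel x : env_rel x -> malg_lift (fun ab => phi ab.1 ab.2) x = 0.
Proof.
case: phiB => Dl Dr Zl Zr; case=> [a a' b|a b b'|c a b|c a b].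
- by rewrite raddfB raddfD /= !malg_liftU /= Dl subrr.
- by rewrite raddfB raddfD /= !malg_liftU /= Dr subrr.
- by rewrite raddfB /= malg_liftZ !malg_liftU /= Zl subrr.
- by rewrite raddfB /= malg_liftZ !malg_liftU /= Zr subrr.
Qed.

Lemma env_lift_tens a b : env_lift phi (tens a b) = phi a b.
Proof. by rewrite env_tensE env_lift.unlock [LHS](lquot_liftE env_lift_rel) /= malg_liftU. Qed.

Lemma env_liftD s t : env_lift phi (s + t) = env_lift phi s + env_lift phi t.
Proof.
elim/lquot_ind: s => s; elim/lquot_ind: t => t.
rewrite -lquot_piD !env_lift.unlock.
by rewrite 3![malg_lift _ _](lquot_liftE env_lift_rel) raddfD.
Qed.

Lemma env_liftZ c s : env_lift phi (c *: s) = c *: env_lift phi s.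
Proof.
elim/lquot_ind: s => s.
rewrite -[c *: _]lquot_piZ !env_lift.unlock.
by rewrite 2![malg_lift _ _](lquot_liftE env_lift_rel) linearZ.
Qed.

End Lift.

Definition env_mul1 a b (t : env) : env :=
  env_lift (fun c d => tens (a * c) (d * b)) t.
Definition env_mul (s t : env) : env := env_lift (fun a b => env_mul1 a b t) s.
Definition env_one : env := tens 1 1.

Lemma kinAC (c : k) a b : a * (kin A c * b) = kin A c * (a * b).
Proof. by rewrite mulrA -kin_central mulrA. Qed.

Fact env_mul1_bil a b : bilinear2 (fun c d => tens (a * c) (d * b)).
Proof.
split=> *; rewrite ?mulrDl ?mulrDr ?tensDl ?tensDr //.
  by rewrite kinAC tensZl.
by rewrite -mulrA tensZr.
Qed.

Lemma env_mul1D a b s t : env_mul1 a b (s + t) = env_mul1 a b s + env_mul1 a b t.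
Proof. exact/env_liftD/env_mul1_bil. Qed.

Lemma env_mul1T a b c d : env_mul1 a b (tens c d) = tens (a * c) (d * b).
Proof. exact/env_lift_tens/env_mul1_bil. Qed.

Fact env_mul_bil t : bilinear2 (fun a b => env_mul1 a b t).
Proof.
split=> [a a' b|a b b'|c a b|c a b]; elim/env_ind: t => [x y|s t ihs iht].
- by rewrite !env_mul1T mulrDl tensDl.
- by rewrite !env_mul1D ihs iht addrACA.
- by rewrite !env_mul1T mulrDr tensDr.
- by rewrite !env_mul1D ihs iht addrACA.
- by rewrite !env_mul1T -mulrA tensZl.
- by rewrite !env_mul1D ihs iht scalerDr.
- by rewrite !env_mul1T kinAC tensZr.
- by rewrite !env_mul1D ihs iht scalerDr.
Qed.

Lemma env_mulT a b c d :
  env_mul (tens a b) (tens c d) = tens (a * c) (d * b).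
Proof. by rewrite /env_mul env_lift_tens ?env_mul1T //; exact: env_mul_bil. Qed.

Fact env_mulDl : left_distributive env_mul +%R.
Proof. by move=> s s' t; apply/env_liftD/env_mul_bil. Qed.
Fact env_mulDr : right_distributive env_mul +%R.
Proof.
move=> s t t'; elim/env_ind: s => [a b|s s' ih ih']; last first.
  by rewrite !env_mulDl ih ih' addrACA.
by rewrite /env_mul !env_lift_tens ?env_mul1D //; exact: env_mul_bil.
Qed.
Fact env_mulA : associative env_mul.
Proof.
move=> s t u.
elim/env_ind: s => [a b|s s' ih ih']; last by rewrite !env_mulDl ih ih'.
elim/env_ind: t => [c d|t t' ih ih'].
  elim/env_ind: u => [e f|u u' ih ih']; last by rewrite !env_mulDr ih ih'.
  by rewrite !env_mulT !mulrA.
by rewrite env_mulDl !env_mulDr env_mulDl ih ih'.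
Qed.
Fact env_mul1l : left_id env_one env_mul.
Proof.
elim/env_ind=> [a b|s t ih ih']; last by rewrite env_mulDr ih ih'.
by rewrite env_mulT mul1r mulr1.
Qed.
Fact env_mul1r : right_id env_one env_mul.
Proof.
elim/env_ind=> [a b|s t ih ih']; last by rewrite env_mulDl ih ih'.
by rewrite env_mulT mul1r mulr1.
Qed.
HB.instance Definition _ := GRing.Zmodule_isPzRing.Build env
  env_mulA env_mul1l env_mul1r env_mulDl env_mulDr.

Lemma tens11 : tens 1 1 = 1 :> env.
Proof. by []. Qed.

Lemma tensM a b c d : tens a b * tens c d = tens (a * c) (d * b).
Proof. exact: env_mulT. Qed.

Definition kmod : Type := kring A.
HB.instance Definition _ := GRing.Zmodule.on kmod.
Definition kscale (c : k) (x : kmod) : kmod := kin A c * (x : A).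
Fact kscaleA c d x : kscale c (kscale d x) = kscale (c * d) x.
Proof. by rewrite /kscale mulrA rmorphM. Qed.
Fact kscale1 : left_id 1 kscale.
Proof. by move=> x; rewrite /kscale rmorph1 mul1r. Qed.
Fact kscaleDr : right_distributive kscale +%R.
Proof. by move=> c x y; rewrite /kscale mulrDr. Qed.
Fact kscaleDl x : {morph kscale^~ x : c d / c + d}.
Proof. by move=> c d; rewrite /kscale rmorphD mulrDl. Qed.
HB.instance Definition _ := GRing.Zmodule_isLmodule.Build k kmod
  kscaleA kscale1 kscaleDr kscaleDl.

(* A as a left module over [env A]: (a (x) b) x = a x b, see [reg_actT]. *)
Definition regbim : Type := kring A.
HB.instance Definition _ := GRing.Zmodule.on regbim.

Definition reg_act (t : env) (x : regbim) : regbim :=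
  env_lift (fun a b => (a * x * b : A) : kmod) t.

Fact reg_act_bil (x : A) : bilinear2 (fun a b => (a * x * b : A) : kmod).
Proof.
split=> [a a' b|a b b'|c a b|c a b].
- by rewrite !mulrDl.
- by rewrite mulrDr.
- by rewrite -!mulrA.
- by rewrite kinAC.
Qed.

Lemma reg_actT a b (x : A) : reg_act (tens a b) x = a * x * b.
Proof. by rewrite /reg_act env_lift_tens //; exact: reg_act_bil. Qed.
Fact reg_actDl x : {morph reg_act^~ x : s t / s + t}.
Proof. by move=> s t; exact: (env_liftD (reg_act_bil x) s t). Qed.
Fact reg_actDr : right_distributive reg_act +%R.
Proof.
move=> t x y; elim/env_ind: t => [a b|s t ihs iht]; last first.
  by rewrite !reg_actDl ihs iht addrACA.
by rewrite !reg_actT mulrDr mulrDl.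
Qed.
Fact reg_actA s t x : reg_act s (reg_act t x) = reg_act (s * t) x.
Proof.
elim/env_ind: s => [a b|s s' ih ih']; last first.
  by rewrite mulrDl !reg_actDl ih ih'.
elim/env_ind: t => [c d|t t' ih ih'].
  by rewrite tensM !reg_actT !mulrA.
by rewrite mulrDr !reg_actDl reg_actDr ih ih'.
Qed.
Fact reg_act1 : left_id 1 reg_act.
Proof. by move=> x; rewrite -tens11 reg_actT mul1r mulr1. Qed.
HB.instance Definition _ := GRing.Zmodule_isLmodule.Build env regbim
  reg_actA reg_act1 reg_actDr reg_actDl.

End Enveloping.

Definition left_ideal (R : pzRingType) (I : set R) : Prop :=
  [/\ I 0, forall x y, I x -> I y -> I (x + y) & forall r x, I x -> I (r * x)].

Definition right_ideal (R : pzRingType) (I : set R) : Prop :=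
  [/\ I 0, forall x y, I x -> I y -> I (x + y) & forall r x, I x -> I (x * r)].

Definition acc (T : Type) (P : set T -> Prop) : Prop :=
  forall I : nat -> set T, (forall i, P (I i)) ->
  (forall i, I i `<=` I i.+1) ->
  exists N, forall i, (N <= i)%N -> I i = I N.

Definition left_noetherian (R : pzRingType) : Prop := acc (@left_ideal R).
Definition right_noetherian (R : pzRingType) : Prop := acc (@right_ideal R).

Definition complete_orthogonal_idempotents (R : pzRingType) (I : finType)
    (e : I -> R) : Prop :=
  (forall i j, e i * e j = if i == j then e i else 0) /\ \sum_i e i = 1.

Definition peirce (R : pzRingType) (I : finType) (e : I -> R) (i j : I) : set R :=
  [set x | exists r, x = e i * r * e j].

Definition piecewise_domain (R : pzRingType) (I : finType) (e : I -> R) : Prop :=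
  complete_orthogonal_idempotents e /\
  forall (i j l : I) (a b : R), peirce e i j a -> peirce e j l b ->
    a * b = 0 -> a = 0 \/ b = 0.

Definition is_grading (V : zmodType) (G : int -> set V) : Prop :=
  [/\ forall i, G i 0 /\ (forall x y, G i x -> G i y -> G i (x - y)),
      forall x, exists (s : seq int) (c : int -> V),
        (forall i, G i (c i)) /\ x = \sum_(i <- s) c i &
      forall (s : seq int) (c : int -> V), uniq s -> (forall i, G i (c i)) ->
        \sum_(i <- s) c i = 0 -> forall i, i \in s -> c i = 0].

Definition graded_algebra (k : fieldType) (A : kalgebra k)
    (GA : int -> set A) : Prop :=
  [/\ is_grading GA, forall c : k, GA 0 (kin A c) &
      forall i j a b, GA i a -> GA j b -> GA (i + j) (a * b)].

Section GradedModules.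
Context (R : pzRingType) (GR : int -> set R).

Record grmod := GrMod {
  gr_sort :> lmodType R;
  gr : int -> set gr_sort;
  gr_grading : is_grading gr;
  gr_scale : forall i j (r : R) (x : gr_sort),
    GR i r -> gr j x -> gr (i + j) (r *: x)
}.

Definition projective (P : lmodType R) : Prop :=
  forall (M N : lmodType R) (g : {linear M -> N}) (f : {linear P -> N}),
    (forall y, exists x, g x = y) ->
    exists h : {linear P -> M}, forall x, g (h x) = f x.

Definition fin_gen (P : lmodType R) : Prop :=
  exists s : seq P, forall x, x \in lspan [set y | y \in s].

(* Finite resolutions of M by finitely generated graded projective modules,
   with differentials and augmentation of degree 0. *)
Record fin_proj_resolution (M : lmodType R) (GM : int -> set M) := {
  res :> nat -> grmod;
  res_d : forall i, {linear res i.+1 -> res i};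
  res_aug : {linear res 0%N -> M};
  res_projective : forall i, projective (res i);
  res_fin_gen : forall i, fin_gen (res i);
  res_finite : exists N, forall i, (N < i)%N -> forall x : res i, x = 0;
  res_d_degree : forall i m x, gr m x -> gr m (res_d i x);
  res_aug_degree : forall m x, gr m x -> GM m (res_aug x);
  res_aug_surj : forall y, exists x, res_aug x = y;
  res_exact0 : forall x, res_aug x = 0 <-> exists y, x = res_d 0 y;
  res_exact : forall i x, res_d i x = 0 <-> exists y, x = res_d i.+1 y
}.

End GradedModules.

(* Cohomology of the complex Hom_R(P, R) of right R-modules. *)
Section Cohomology.
Context (R : pzRingType) (P : nat -> lmodType R)
        (d : forall i, {linear P i.+1 -> P i}).

(* R as a right module over itself, i.e. a left module over R^c. *)
Local Notation Rr := ((R^c)^o).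

Definition is_cocycle i : {pred (P i -> Rr)} :=
  [pred f | `[< (forall c x y, f (c *: x + y) = (c : R) * f x + f y :> R) /\
                (forall x, f (d i x) = 0) >]].

Fact is_cocycle_submod i : submod_closed (@is_cocycle i).
Proof.
split; first by apply/asboolP; split=> // c x y; rewrite mulr0 addr0.
move=> r f g /asboolP[lf f0] /asboolP[lg g0]; apply/asboolP; split=> [c x y|x].
  rewrite -![(r *: f + g) _]/((f _ : R) * (r : R) + (g _ : R)) lf lg.
  by rewrite mulrDl mulrDr addrACA mulrA.
by rewrite -[LHS]/((f _ : R) * (r : R) + (g _ : R)) f0 g0 mul0r addr0.
Qed.
HB.instance Definition _ i :=
  GRing.isSubmodClosed.Build _ _ (@is_cocycle i) (is_cocycle_submod i).

Record cocycle i := Cocycle {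
  cocycle_fun :> P i -> Rr;
  cocycleP : cocycle_fun \in @is_cocycle i
}.
HB.instance Definition _ i := [isSub for @cocycle_fun i].
HB.instance Definition _ i := [Choice of cocycle i by <:].
HB.instance Definition _ i := [SubChoice_isSubLmodule of cocycle i by <:].

Definition coboundary i : set (cocycle i) :=
  match i with
  | 0 => fun z => z = 0
  | j.+1 => fun z => exists g : {linear P j -> R^o}, forall x, z x = g (d j x)
  end.

Definition cohom i : lmodType R^c := lquot (@coboundary i).

End Cohomology.

(* An (A, A)-bimodule (with k acting centrally) is a left module over [env A],
   with a u b = (a (x) b) u. *)

Section CalabiYau.
Context (k : fieldType) (A : kalgebra k).

Definition lact (M : lmodType (env A)) (a : A) (u : M) : M := tens a 1 *: u.
Definition ract (M : lmodType (env A)) (u : M) (a : A) : M := tens 1 a *: u.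

Definition balanced (U V : lmodType (env A)) (W : zmodType)
    (f : U -> V -> W) : Prop :=
  [/\ forall u u' v, f (u + u') v = f u v + f u' v,
      forall u v v', f u (v + v') = f u v + f u v' &
      forall u (a : A) v, f (ract u a) v = f u (lact a v)].

(* T, together with tau, is the tensor product over A of U and V. *)
Definition is_tensor_product (U V T : lmodType (env A))
    (tau : U -> V -> T) : Prop :=
  [/\ balanced tau,
      forall (a : A) u v, tau (lact a u) v = lact a (tau u v),
      forall u v (a : A), tau u (ract v a) = ract (tau u v) a &
      forall (W : zmodType) (f : U -> V -> W), balanced f ->
        exists! h : T -> W, {morph h : x y / x + y} /\
          forall u v, h (tau u v) = f u v].

Context (GA : int -> set A).

Definition env_gr (m : int) : set (env A) :=
  fun t => t \in lspan (fun s : env A => exists i j a b,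
    [/\ GA i a, GA j b, i + j = m & s = tens a b]).

Definition graded_invertible (U : grmod env_gr) : Prop :=
  exists (V : grmod env_gr) (tau : U -> V -> regbim A)
         (tau' : V -> U -> regbim A),
    [/\ is_tensor_product tau, is_tensor_product tau',
        forall i j (u : U) (v : V), gr i u -> gr j v -> GA (i + j) (tau u v) &
        forall i j (u : U) (v : V), gr i u -> gr j v -> GA (j + i) (tau' v u)].

Definition fin_bim_resolution : Type :=
  @fin_proj_resolution (env A) env_gr (regbim A) GA.

(* Ext^i_{A^e}(A, A^e), as a right A^e-module, with its grading: the class of a
   cocycle f : P_i -> A^e has degree m if f is homogeneous of degree m.  It does
   not depend on the choice of P. *)
Definition ext (P : fin_bim_resolution) (i : nat) :
  lmodType (env A)^c := cohom (@res_d _ _ (regbim A) _ P) i.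

Definition ext_gr (P : fin_bim_resolution) (i : nat) (m : int) :
    set (ext P i) :=
  fun x => exists f, x = lquot_pi _ f /\
    forall j (y : P i), gr j y -> env_gr (j + m) (cocycle_fun f y).

(* A bimodule U is the right [env A]-module with u (a (x) b) = b u a. *)
Definition graded_right_iso (P : fin_bim_resolution) (i : nat)
    (U : grmod env_gr) : Prop :=
  exists phi : ext P i -> U,
    [/\ bijective phi, {morph phi : x y / x + y},
        forall (a b : A) x, phi ((tens a b : (env A)^c) *: x) =
          tens b a *: phi x &
        forall m x, ext_gr m x -> gr m (phi x)].

Definition twisted_graded_CY (d : nat) : Prop :=
  graded_algebra GA /\
  exists (P : fin_bim_resolution) (U : grmod env_gr),
    [/\ graded_invertible U, graded_right_iso P d U &
        forall i, i <> d -> forall x : ext P i, x = 0].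

End CalabiYau.

(* The algebras H_n, B_n and C_n are of type A, B and C respectively. *)
Inductive quiver_type := TypeA | TypeB | TypeC.

Section DownUp.
Context (k : fieldType) (n : nat).

(* [inl i] is u_i : i -> i+1 and [inr i] is d_i : i+1 -> i. *)
Definition quiverA : quiver := {|
  vertex := 'I_n;
  arrow := ('I_n + 'I_n)%type;
  asrc := fun x => match x with inl i => i | inr i => ordS i end;
  atgt := fun x => match x with inl i => ordS i | inr i => i end
|}.

(* [inl i] is a_i : i -> i+1 and [inr i] is b_i : i -> i. *)
Definition quiverB : quiver := {|
  vertex := 'I_n;
  arrow := ('I_n + 'I_n)%type;
  asrc := fun x => match x with inl i | inr i => i end;
  atgt := fun x => match x with inl i => ordS i | inr i => i end
|}.

(* [inl i] is a_i and [inr i] is b_i, both i -> i+1. *)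
Definition quiverC : quiver := {|
  vertex := 'I_n;
  arrow := ('I_n + 'I_n)%type;
  asrc := fun x => match x with inl i | inr i => i end;
  atgt := fun x => match x with inl i | inr i => ordS i end
|}.

Context (alpha beta : k).

Definition relA : set (path_algebra k quiverA) :=
  let u i := pa_arrow k (inl i : arrow quiverA) in
  let d i := pa_arrow k (inr i : arrow quiverA) in
  fun r => exists i : 'I_n,
    let h := ord_pred i in let j := ordS i in
    r = d h * u h * u i
        - (alpha *: (u i * d i * u i) + beta *: (u i * u j * d j)) \/
    r = d i * d h * u h
        - (alpha *: (d i * u i * d i) + beta *: (u j * d j * d i)).

Definition relB : set (path_algebra k quiverB) :=
  let a i := pa_arrow k (inl i : arrow quiverB) in
  let b i := pa_arrow k (inr i : arrow quiverB) in
  fun r => exists i : 'I_n,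
    let j := ordS i in let l := ordS j in
    r = b i * a i * a j
        - (alpha *: (a i * b j * a j) + beta *: (a i * a j * b l)) \/
    r = b i * b i * a i
        - (alpha *: (b i * a i * b j) + beta *: (a i * b j * b j)).

Definition relC : set (path_algebra k quiverC) :=
  let a i := pa_arrow k (inl i : arrow quiverC) in
  let b i := pa_arrow k (inr i : arrow quiverC) in
  fun r => exists i : 'I_n,
    let j := ordS i in let l := ordS j in
    r = b i * a j * a l
        - (alpha *: (a i * b j * a l) + beta *: (a i * a j * b l)) \/
    r = b i * b j * a l
        - (alpha *: (b i * a j * b l) + beta *: (a i * b j * b l)).

Definition du_quiver (T : quiver_type) : quiver :=
  match T with TypeA => quiverA | TypeB => quiverB | TypeC => quiverC end.

Definition du_rel (T : quiver_type) : set (path_algebra k (du_quiver T)) :=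
  match T with TypeA => relA | TypeB => relB | TypeC => relC end.

Definition du_algebra (T : quiver_type) : kalgebra k := bqa_kalgebra (@du_rel T).

Definition du_idem (T : quiver_type) (v : vertex (du_quiver T)) : du_algebra T :=
  bqa_idem (@du_rel T) v.

Definition du_grading (T : quiver_type) : int -> set (du_algebra T) :=
  @bqa_homog k _ (@du_rel T).

End DownUp.

Arguments du_idem {k} n alpha beta T v.
Arguments du_grading {k} n alpha beta T _ _.

(* Main.v *)
(* Write alpha = lam + mu and beta = - lam mu, and let u and d be the sums of the
   arrows of the two kinds. Each of the three algebras is a down-up algebra
   extended by orthogonal idempotents e_v, which u and d permute; they differ only
   in the permutation attached to d. With z = d u - lam u d one has
   z u = mu u z and d z = mu z d, and the monomials e_v u^i z^j d^l form a basis: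
   they span, and the path algebra acts on the free module on them in such a way
   that the relations act by 0.

   If beta <> 0, then leading terms for the lexicographic order on (i, j, l)
   multiply without cancellation, which gives a piecewise domain, and Dickson's
   lemma gives the noetherian property. If beta = 0 we may take mu = 0; then
   z u = 0, and the spans of the monomials with j > 0 and i < N form an ascending
   chain of right ideals. The left-handed statements follow by passing to the
   opposite algebra, with u and d exchanged.

   The minimal bimodule resolution has length three, with components generated by
   the vertices, the arrows, the relations and the overlap ddu.u = d.duu. It is
   exact because its left leading parts are contracted by a homotopy and the
   filtration of the left tensor factor is bounded below. If beta <> 0, it is
   carried to its own dual by an antiautomorphism of the enveloping algebra, so
   that Ext is concentrated in degree three, where it is the algebra itself with
   one side twisted by an automorphism. *)
From HB Require Import structures.
Require Import Defs.
From mathcomp Require Import all_boot all_order all_algebra.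
From mathcomp Require Import boolp classical_sets functions.
From mathcomp Require Import perm finmap monalg ring zify.
Set Implicit Arguments.
Unset Strict Implicit.
Unset Printing Implicit Defensive.
Import GRing.Theory.
Local Open Scope ring_scope.

(** * Normalisation in noncommutative algebras *)

Section NcRing.
Context (k : fieldType) (A : kalgebra k).

(** The order of the two roots matters. Right multiplication of a normal monomial by [u] has at most
    two terms, and the larger one carries the coefficient [lam ^+ l * mu ^+ j]. If both roots are
    nonzero it never vanishes; if [mu = 0] it vanishes as soon as [j > 0], and both [z * u] and
    [d * z] are zero. The homotopy strips the last letter of a normal monomial. A last letter [z] is
    read as [d * u - lam u * d], which gives one component for each of [d] and [u]; moving the new
    [u] to the left of the remaining [z ^+ j] produces the constant [- lam * mu ^+ j]. This
    contracts only the complex seen by the left factors. The neglected terms have shorter left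
    factors, so subtracting the boundary that the homotopy proposes leaves a cycle of smaller
    length, and the induction ends at 0. The matrices of the complex are studied on arbitrary rows
    over the enveloping algebra. The idempotents that cut out the projective components commute with
    them, so they can be imposed afterwards; they are essential only at the augmentation, where the
    idempotents of the algebra must be identified on both sides. *)

Inductive nc_expr :=
  | NC0 | NC1 | NCscal of k | NCvar of nat
  | NCadd of nc_expr & nc_expr | NCopp of nc_expr | NCmul of nc_expr & nc_expr.

Fixpoint nc_eval (env : seq A) (t : nc_expr) : A :=
  match t with
  | NC0 => 0 | NC1 => 1 | NCscal c => kin A c | NCvar i => nth 0 env i
  | NCadd s t => nc_eval env s + nc_eval env t
  | NCopp t => - nc_eval env t
  | NCmul s t => nc_eval env s * nc_eval env t
  end.

(** The syntactic operations are separate fixpoints so that the tactic can evaluate them by a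
    selective [cbv], leaving the scalars of [k] as symbolic expressions for [ring]. *)
Fixpoint nc_app T (s t : seq T) := if s is x :: s' then x :: nc_app s' t else t.

Fixpoint nc_opp (p : seq (k * seq nat)) :=
  if p is (c, w) :: p' then (- c, w) :: nc_opp p' else [::].

Fixpoint nc_mul1 (c : k) (w : seq nat) (p : seq (k * seq nat)) :=
  if p is (c', w') :: p' then (c * c', nc_app w w') :: nc_mul1 c w p' else [::].

Fixpoint nc_mul (p q : seq (k * seq nat)) :=
  if p is (c, w) :: p' then nc_app (nc_mul1 c w q) (nc_mul p' q) else [::].

Fixpoint nc_norm (t : nc_expr) : seq (k * seq nat) :=
  match t with
  | NC0 => [::] | NC1 => [:: (1, [::])] | NCscal c => [:: (c, [::])]
  | NCvar i => [:: (1, [:: i])]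
  | NCadd s t => nc_app (nc_norm s) (nc_norm t)
  | NCopp t => nc_opp (nc_norm t)
  | NCmul s t => nc_mul (nc_norm s) (nc_norm t)
  end.

Definition nc_peval (env : seq A) (p : seq (k * seq nat)) : A :=
  \sum_(cw <- p) kin A cw.1 * \prod_(i <- cw.2) nth 0 env i.

Lemma nc_appE T (s t : seq T) : nc_app s t = s ++ t.
Proof. by elim: s => //= x s ->. Qed.

Lemma nc_peval_cat env p q :
  nc_peval env (p ++ q) = nc_peval env p + nc_peval env q.
Proof. exact: big_cat. Qed.

Lemma nc_norm_eval env t : nc_eval env t = nc_peval env (nc_norm t).
Proof.
elim: t => /= [||c|i|s -> t ->|t ->|s -> t ->].
- by rewrite /nc_peval big_nil.
- by rewrite /nc_peval big_seq1 big_nil rmorph1 mulr1.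
- by rewrite /nc_peval big_seq1 big_nil mulr1.
- by rewrite /nc_peval big_seq1 big_seq1 rmorph1 mul1r.
- by rewrite nc_appE nc_peval_cat.
- elim: (nc_norm t) => [|[c w] p ih] /=; first by rewrite /nc_peval !big_nil oppr0.
  by move: ih; rewrite /nc_peval !big_cons /= opprD rmorphN mulNr => ->.
- elim: (nc_norm s) => [|[c w] p ih] /=.
    by rewrite /nc_peval !big_nil mul0r.
  rewrite nc_appE nc_peval_cat -ih {1}/nc_peval big_cons mulrDl; congr (_ + _).
  elim: (nc_norm t) => [|[c' w'] q ih'] /=.
    by rewrite /nc_peval !big_nil mulr0.
  move: ih'; rewrite /nc_peval !big_cons /= mulrDr => ->; congr (_ + _).
  rewrite nc_appE big_cat rmorphM /= -!mulrA; congr (_ * _).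
  by rewrite !mulrA kin_central.
Qed.

Fixpoint nc_eqw (v w : seq nat) : bool :=
  match v, w with
  | [::], [::] => true
  | i :: v, j :: w => if eqn i j then nc_eqw v w else false
  | _, _ => false
  end.

Lemma nc_eqwE v w : nc_eqw v w = (v == w).
Proof.
elim: v w => [|i v ih] [|j w] //=.
by rewrite eqseq_cons ih eqnE; case: eqP.
Qed.

Fixpoint nc_coef (w : seq nat) (p : seq (k * seq nat)) : k :=
  if p is (c, v) :: p' then
    if nc_eqw v w then c + nc_coef w p' else nc_coef w p'
  else 0.

Fixpoint nc_del (w : seq nat) (p : seq (k * seq nat)) : seq (k * seq nat) :=
  if p is (c, v) :: p' then
    if nc_eqw v w then nc_del w p' else (c, v) :: nc_del w p'
  else [::].

(** One field identity for each word, namely that its coefficients add up to zero. The number [n] is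
    fuel; the length of the list suffices, since each round removes at least the head. *)
Fixpoint nc_vanish (n : nat) (p : seq (k * seq nat)) : Prop :=
  match n, p with
  | n'.+1, (c, w) :: p' => c + nc_coef w p' = 0 /\ nc_vanish n' (nc_del w p')
  | _, [::] => True
  | _, _ => False
  end.

Lemma nc_del_eval env w p : nc_peval env p =
  kin A (nc_coef w p) * \prod_(i <- w) nth 0 env i + nc_peval env (nc_del w p).
Proof.
elim: p => [|[c v] p ih] /=.
  by rewrite /nc_peval !big_nil rmorph0 mul0r addr0.
rewrite nc_eqwE /nc_peval big_cons -/(nc_peval env p) ih; case: eqP => [->|_] /=.
  by rewrite rmorphD mulrDl addrA.
by rewrite big_cons addrCA.
Qed.

Lemma nc_vanishP env n p : nc_vanish n p -> nc_peval env p = 0.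
Proof.
elim: n p => [|n ih] [|[c w] p] //=; try by rewrite /nc_peval big_nil.
case=> cw /ih; rewrite /nc_peval big_cons -/(nc_peval env p).
rewrite (nc_del_eval env w p) /nc_peval => ->.
by rewrite addr0 -mulrDl -rmorphD cw rmorph0 mul0r.
Qed.

Lemma nc_ring_correct env s t :
  (let p := nc_norm (NCadd s (NCopp t)) in nc_vanish (size p) p) ->
  nc_eval env s = nc_eval env t.
Proof.
by move=> /(nc_vanishP env); rewrite -nc_norm_eval => /eqP; rewrite subr_eq0 => /eqP.
Qed.

End NcRing.

Ltac nc_index x env :=
  match env with
  | x :: _ => constr:(0%N)
  | _ :: ?env' => let n := nc_index x env' in constr:(S n)
  end.

Ltac nc_atoms t env :=
  match t with
  | (?x + ?y)%R => let env := nc_atoms x env in nc_atoms y env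
  | (?x * ?y)%R => let env := nc_atoms x env in nc_atoms y env
  | (- ?x)%R => nc_atoms x env
  | (0)%R => env
  | (1)%R => env
  | @GRing.RMorphism.sort _ _ (@kin _ _) _ => env
  | _ => match env with
         | _ => let n := nc_index t env in env
         | _ => constr:(t :: env)
         end
  end.

Ltac nc_reify k t env :=
  match t with
  | (?x + ?y)%R => let a := nc_reify k x env in let b := nc_reify k y env in
      constr:(@NCadd k a b)
  | (?x * ?y)%R => let a := nc_reify k x env in let b := nc_reify k y env in
      constr:(@NCmul k a b)
  | (- ?x)%R => let a := nc_reify k x env in constr:(@NCopp k a)
  | (0)%R => constr:(@NC0 k)
  | (1)%R => constr:(@NC1 k)
  | @GRing.RMorphism.sort _ _ (@kin _ _) ?c => constr:(@NCscal k c)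
  | _ => let n := nc_index t env in constr:(@NCvar k n)
  end.

(* Decides equalities that hold in every algebra over a field, with
   noncommuting atoms and scalars [kin A c]. *)
Ltac nc_ring A :=
  lazymatch type of A with
  | kalgebra ?k =>
    lazymatch goal with
    | |- ?s = ?t =>
      let env := nc_atoms s (@nil (GRing.PzRing.sort (kring A))) in
      let env := nc_atoms t env in
      let a := nc_reify k s env in
      let b := nc_reify k t env in
      change (@nc_eval k A env a = @nc_eval k A env b);
      apply: nc_ring_correct;
      cbv [size nc_norm nc_app nc_opp nc_mul1 nc_mul nc_vanish nc_coef nc_del nc_eqw eqn];
      repeat split; ring
    end
  end.


(** * Down-up algebras with idempotents and their monomial basis *)

Section PbwMonomials.
Context (k : fieldType) (V : finType) (A : kalgebra k).

Definition pbw_index : Type := (V * (nat * nat * nat))%type.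
HB.instance Definition _ := Choice.on pbw_index.

(* This element straightens the product [d * u], and normalises both [u] and
   [d] when [lam] is a root of [x ^+ 2 - alpha * x - beta]. *)
Definition zelt (lam : k) (u d : A) : A := d * u - kin A lam * (u * d).

Definition pbw_mon (lam : k) (e : V -> A) (u d : A) (b : pbw_index) : A :=
  e b.1 * (u ^+ b.2.1.1 * zelt lam u d ^+ b.2.1.2 * d ^+ b.2.2).

End PbwMonomials.

(** In the instances [upt] is the rotation by one, and [downt] is the inverse rotation in type A,
    the identity in type B and the same rotation in type C. The last two fields are the cubic
    relations rewritten through [zelt]; freeness is added only in [ore_algebra]. *)
Record ore_datum (k : fieldType) (V : finType) (lam mu : k) := OreDatum {
  oalg :> kalgebra k;
  vid : V -> oalg;
  up : oalg;
  down : oalg;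
  upt : {perm V};
  downt : {perm V};
  vidM : forall v w, vid v * vid w = if v == w then vid v else 0;
  vid_sum : \sum_v vid v = 1;
  vid_up : forall v, vid v * up = up * vid (upt v);
  vid_down : forall v, vid v * down = down * vid (downt v);
  upt_downt : forall v, upt (downt v) = downt (upt v);
  zed_up : zelt lam up down * up = kin oalg mu * (up * zelt lam up down);
  down_zed : down * zelt lam up down = kin oalg mu * (zelt lam up down * down)
}.
Arguments up {k V lam mu} o.
Arguments down {k V lam mu} o.
Arguments upt {k V lam mu} o.
Arguments downt {k V lam mu} o.

(** That the monomials form a basis is recorded as a linear coordinate map: [ocoord_mon] gives
    independence, [ocoordK] gives spanning. *)
Record ore_algebra (k : fieldType) (V : finType) (lam mu : k) := OreAlgebra {
  odatum :> ore_datum V lam mu;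
  ocoord : odatum -> {malg k[pbw_index V]};
  ocoord_lin : forall c x y, ocoord (kin odatum c * x + y) = c *: ocoord x + ocoord y;
  ocoord_mon : forall b,
    ocoord (pbw_mon lam (@vid _ _ _ _ odatum) (up odatum) (down odatum) b) = << b >>;
  ocoordK : forall x, malg_lift (fun b => pbw_mon lam (@vid _ _ _ _ odatum)
    (up odatum) (down odatum) b : kmod odatum) (ocoord x) = x
}.

(* The coefficient of [z * d ^+ n.-1] in [d ^+ n * u], see [downX_up]. *)
Fixpoint qnum (k : fieldType) (lam mu : k) (n : nat) : k :=
  if n is n'.+1 then lam ^+ n' + mu * qnum lam mu n' else 0.

Section OreDatumTheory.
Context (k : fieldType) (V : finType) (lam mu : k) (A : ore_datum V lam mu).
Local Notation u := (up A).
Local Notation d := (down A).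
Local Notation z := (zelt lam (up A) (down A)).
Local Notation c_ := (qnum lam mu).

Definition mon (b : pbw_index V) : A := locked (pbw_mon lam (@vid _ _ _ _ A) u d b).

(** The vertex at which the monomial ends; [z] has the bidegree of [d * u] and moves by both
    permutations. *)
Definition pbw_tgt (b : pbw_index V) : V :=
  iter (b.2.1.1 + b.2.1.2) (upt A) (iter (b.2.1.2 + b.2.2) (downt A) b.1).

Lemma monE v i j l : mon (v, (i, j, l)) = vid A v * (u ^+ i * z ^+ j * d ^+ l).
Proof. by rewrite /mon -lock. Qed.

Lemma down_up : d * u = kin A lam * (u * d) + z.
Proof. by rewrite /zelt addrC subrK. Qed.

(** Adding one more [d] on the left creates [lam ^+ n] new copies of [z] and multiplies the old ones
    by [mu], whence the recursion of [qnum]. At [n = 0] the truncated exponent [n.-1] is harmless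
    because the coefficient is 0. *)
Lemma downX_up n : d ^+ n * u =
  kin A (lam ^+ n) * (u * d ^+ n) + kin A (c_ n) * (z * d ^+ n.-1).
Proof.
elim: n => [|n ih]; first by rewrite !expr0 /= rmorph0 rmorph1 mul0r addr0 !mul1r mulr1.
rewrite exprS -mulrA ih mulrDr.
have -> : d * (kin A (lam ^+ n) * (u * d ^+ n)) =
    kin A (lam ^+ n) * (d * u) * d ^+ n by nc_ring (oalg A).
have -> : d * (kin A (c_ n) * (z * d ^+ n.-1)) =
    kin A (c_ n) * (d * z * d ^+ n.-1) by nc_ring (oalg A).
rewrite down_up down_zed /=; case: n {ih} => [|n] /=.
  rewrite !expr0 expr1; nc_ring (oalg A).
rewrite !exprS; set D := d ^+ n; set L := lam ^+ n; nc_ring (oalg A).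
Qed.

Lemma zedX_up n : z ^+ n * u = kin A (mu ^+ n) * (u * z ^+ n).
Proof.
elim: n => [|n ih]; first by rewrite !expr0 rmorph1 !mul1r mulr1.
rewrite !exprS -mulrA ih.
have -> : z * (kin A (mu ^+ n) * (u * z ^+ n)) =
    kin A (mu ^+ n) * (z * u) * z ^+ n by nc_ring (oalg A).
rewrite zed_up; nc_ring (oalg A).
Qed.

Lemma downX_zed n : d ^+ n * z = kin A (mu ^+ n) * (z * d ^+ n).
Proof.
elim: n => [|n ih]; first by rewrite !expr0 rmorph1 !mul1r mulr1.
rewrite !exprS -mulrA ih.
have -> : d * (kin A (mu ^+ n) * (z * d ^+ n)) =
    kin A (mu ^+ n) * (d * z) * d ^+ n by nc_ring (oalg A).
rewrite down_zed; nc_ring (oalg A).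
Qed.

Lemma mon_down v i j l : mon (v, (i, j, l)) * d = mon (v, (i, j, l.+1)).
Proof. by rewrite !monE exprSr !mulrA. Qed.

Lemma mon_zed v i j l :
  mon (v, (i, j, l)) * z = kin A (mu ^+ l) * mon (v, (i, j.+1, l)).
Proof.
rewrite !monE -!mulrA downX_zed exprSr; nc_ring (oalg A).
Qed.

(** With [mon_down] this describes the right regular representation in the basis; the same formula
    later defines the action of the path algebra. *)
Lemma mon_up v i j l : mon (v, (i, j, l)) * u =
  kin A (lam ^+ l * mu ^+ j) * mon (v, (i.+1, j, l)) +
  kin A (c_ l) * mon (v, (i, j.+1, l.-1)).
Proof.
rewrite !monE -!mulrA downX_up mulrDr.
have -> : z ^+ j * (kin A (lam ^+ l) * (u * d ^+ l)) =
  kin A (lam ^+ l) * (z ^+ j * u) * d ^+ l by nc_ring (oalg A).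
rewrite zedX_up (exprSr u) (exprSr z); nc_ring (oalg A).
Qed.

Lemma vid_upX v n : vid A v * u ^+ n = u ^+ n * vid A (iter n (upt A) v).
Proof.
elim: n => [|n ih]; first by rewrite mulr1 mul1r.
by rewrite exprSr mulrA ih -mulrA vid_up mulrA.
Qed.

Lemma vid_downX v n : vid A v * d ^+ n = d ^+ n * vid A (iter n (downt A) v).
Proof.
elim: n => [|n ih]; first by rewrite mulr1 mul1r.
by rewrite exprSr mulrA ih -mulrA vid_down mulrA.
Qed.

Lemma vid_zed v : vid A v * z = z * vid A (upt A (downt A v)).
Proof.
have e1 : vid A v * (d * u) = d * u * vid A (upt A (downt A v)).
  by rewrite mulrA vid_down -mulrA vid_up mulrA.
have e2 : vid A v * (u * d) = u * d * vid A (upt A (downt A v)).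
  by rewrite mulrA vid_up -mulrA vid_down mulrA upt_downt.
by rewrite /zelt mulrBr mulrBl e1 kinAC e2 !mulrA.
Qed.

Lemma downt_iter n v : downt A (iter n (upt A) v) = iter n (upt A) (downt A v).
Proof. by elim: n => //= n ih; rewrite -upt_downt ih. Qed.

Lemma iter_upt_downt m n v :
  iter n (downt A) (iter m (upt A) v) = iter m (upt A) (iter n (downt A) v).
Proof. by elim: n => //= n ih; rewrite ih downt_iter. Qed.

Lemma vid_zedX v n :
  vid A v * z ^+ n = z ^+ n * vid A (iter n (upt A) (iter n (downt A) v)).
Proof.
elim: n => [|n ih]; first by rewrite mulr1 mul1r.
rewrite exprSr mulrA ih -mulrA vid_zed mulrA /=.
by rewrite downt_iter.
Qed.

(** Carrying the idempotent to the right end is needed for right multiplication by idempotents and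
    for reading monomials in the opposite algebra. *)
Lemma monP b : mon b = u ^+ b.2.1.1 * z ^+ b.2.1.2 * d ^+ b.2.2 * vid A (pbw_tgt b).
Proof.
case: b => v [[i j] l]; rewrite monE !mulrA vid_upX -!mulrA (mulrA (vid _ _)).
rewrite vid_zedX -!mulrA vid_downX !mulrA /pbw_tgt /=.
by rewrite !iter_upt_downt -!iterD (addnC i) (addnC l).
Qed.

Lemma mon_vid b v : mon b * vid A v = if pbw_tgt b == v then mon b else 0.
Proof. by rewrite monP -mulrA vidM; case: ifP; rewrite ?mulr0. Qed.

Lemma vid_mon v b : vid A v * mon b = if v == b.1 then mon b else 0.
Proof.
case: b => w [[i j] l]; rewrite !monE mulrA vidM /=.
by case: eqP => [->//|_]; rewrite mul0r.
Qed.

End OreDatumTheory.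

Section OreAlgebraTheory.
Context (k : fieldType) (V : finType) (lam mu : k) (A : ore_algebra V lam mu).
Local Notation u := (up A).
Local Notation d := (down A).
Local Notation z := (zelt lam (up A) (down A)).
Local Notation mon := (mon A).

Lemma ocoord_monE b : ocoord (mon b) = << b >>.
Proof. by rewrite /mon -lock; exact: ocoord_mon. Qed.

Lemma ore_ind (P : A -> Prop) :
  P 0 -> (forall c b x, P x -> P (kin A c * mon b + x)) -> forall x, P x.
Proof.
move=> P0 PS x; rewrite -(ocoordK x); elim/malg_ind: (ocoord x) => [|c b g ih].
  by rewrite raddf0.
rewrite linearP /= malg_liftU.
by have := PS c b _ ih; rewrite /mon -lock.
Qed.

Section Lift.
Context (W : lmodType k) (f : pbw_index V -> W).

Definition olift (x : A) : W := malg_lift f (ocoord x).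

Lemma olift_lin c x y : olift (kin A c * x + y) = c *: olift x + olift y.
Proof. by rewrite /olift ocoord_lin linearP. Qed.

Lemma olift0 : olift 0 = 0.
Proof. by have := olift_lin (-1) 0 0; rewrite mulr0 addr0 scaleN1r addNr. Qed.

Lemma oliftD x y : olift (x + y) = olift x + olift y.
Proof. by have := olift_lin 1 x y; rewrite rmorph1 mul1r scale1r. Qed.

Lemma oliftZ c x : olift (kin A c * x) = c *: olift x.
Proof. by have := olift_lin c x 0; rewrite olift0 !addr0. Qed.

Lemma olift_mon b : olift (mon b) = f b.
Proof. by rewrite /olift ocoord_monE malg_liftU. Qed.

End Lift.

(** Reduces stability under right multiplication to the generators; it serves to recognise right
    ideals described by a basis. *)
Lemma ore_rind (P : A -> Prop) :
  P 0 -> (forall c x y, P x -> P y -> P (kin A c * x + y)) ->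
  (forall x v, P x -> P (x * vid A v)) -> (forall x, P x -> P (x * u)) ->
  (forall x, P x -> P (x * d)) -> forall x y, P x -> P (x * y).
Proof.
move=> P0 PD Pe Pu Pd x y Px; have PX : forall t, (forall x, P x -> P (x * t)) ->
    forall n x, P x -> P (x * t ^+ n).
  move=> t Pt; elim=> [|n ih] x' Px'; first by rewrite mulr1.
  by rewrite exprS mulrA; apply/ih/Pt.
have Pz x' : P x' -> P (x' * z).
  move=> Px'; have -> : x' * z = kin A (- lam) * (x' * u * d) + x' * d * u.
    rewrite /zelt; nc_ring (oalg A).
  by apply: PD; [apply/Pd/Pu|apply/Pu/Pd].
elim/ore_ind: y => [|c [v [[i j] l]] y ih]; first by rewrite mulr0.
rewrite mulrDr kinAC; apply: PD => //; rewrite monE !mulrA.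
by apply/(PX _ Pd)/(PX _ Pz)/(PX _ Pu)/Pe.
Qed.

End OreAlgebraTheory.

(** * Enveloping algebras and homotopies *)

Section EnvAlgebra.
Context (k : fieldType) (A : kalgebra k).

Definition env_in (c : k) : env A := locked (tens (kin A c) 1).

Lemma env_inE c : env_in c = tens (kin A c) 1.
Proof. by rewrite /env_in -lock. Qed.

Lemma env_scaleE c (t : env A) : c *: t = env_in c * t.
Proof.
elim/env_ind: t => [a b|s t ihs iht]; last by rewrite scalerDr ihs iht mulrDr.
by rewrite env_inE tensM mulr1 tensZl.
Qed.

Fact env_in_zmod : zmod_morphism env_in.
Proof.
by move=> c c'; rewrite -[LHS]mulr1 -env_scaleE scalerBl !env_scaleE !mulr1.
Qed.
Fact env_in_monoid : monoid_morphism env_in.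
Proof.
by split=> [|c c']; rewrite !env_inE ?rmorph1 // tensM mulr1 rmorphM.
Qed.
HB.instance Definition _ := GRing.isZmodMorphism.Build k (env A) env_in env_in_zmod.
HB.instance Definition _ := GRing.isMonoidMorphism.Build k (env A) env_in env_in_monoid.

Lemma env_in_central (c : k) (t : env A) : env_in c * t = t * env_in c.
Proof.
elim/env_ind: t => [a b|s t ihs iht]; last by rewrite mulrDl mulrDr ihs iht.
by rewrite env_inE !tensM mulr1 mul1r kin_central.
Qed.

(** The enveloping algebra becomes an algebra over [k] itself, so that [nc_ring] also normalises
    identities between entries of the differentials. *)
Canonical env_kalgebra : kalgebra k := KAlgebra env_in_central.

Definition tensl (a : A) : env A := tens a 1.
Definition tensr (a : A) : env A := tens 1 a.

Lemma tens0l (b : A) : tens 0 b = 0.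
Proof. by have := tensDl 0 0 b; rewrite addr0 => /eqP; rewrite addrC -subr_eq subrr eq_sym => /eqP. Qed.
Lemma tens0r (a : A) : tens a 0 = 0.
Proof. by have := tensDr a 0 0; rewrite addr0 => /eqP; rewrite addrC -subr_eq subrr eq_sym => /eqP. Qed.
Lemma tensNl (a b : A) : tens (- a) b = - tens a b.
Proof. by apply/eqP; rewrite -addr_eq0 -tensDl addNr tens0l. Qed.
Lemma tensNr (a b : A) : tens a (- b) = - tens a b.
Proof. by apply/eqP; rewrite -addr_eq0 -tensDr addNr tens0r. Qed.
Lemma tens_kinl c (a b : A) : tens (kin A c * a) b = kin env_kalgebra c * tens a b.
Proof. by rewrite tensZl env_scaleE. Qed.
Lemma tens_kinr c (a b : A) : tens a (kin A c * b) = kin env_kalgebra c * tens a b.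
Proof. by rewrite tensZr env_scaleE. Qed.
Lemma mulr_tensl (a b a' : A) : tens a b * tensl a' = tens (a * a') b.
Proof. by rewrite tensM mul1r. Qed.
Lemma mulr_tensr (a b b' : A) : tens a b * tensr b' = tens a (b' * b).
Proof. by rewrite tensM mulr1. Qed.

End EnvAlgebra.

Section Homotopy.
Context (k : fieldType) (V : finType) (lam mu : k) (A : ore_algebra V lam mu).
Local Notation E := (env A).
Local Notation Ek := (env_kalgebra A).
Local Notation u := (up A).
Local Notation d := (down A).
Local Notation z := (zelt lam (up A) (down A)).
Local Notation c_ := (qnum lam mu).
Local Notation alpha := (lam + mu).
Local Notation beta := (- (lam * mu)).
Local Notation pbw_index := (pbw_index V).

Lemma duu : d * u * u = kin A alpha * (u * d * u) + kin A beta * (u * u * d).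
Proof.
have -> : d * u * u = z * u + kin A lam * (u * d * u).
  by rewrite /zelt; nc_ring (oalg A).
by rewrite zed_up /zelt; nc_ring (oalg A).
Qed.

Lemma ddu : d * d * u = kin A alpha * (d * u * d) + kin A beta * (u * d * d).
Proof.
have -> : d * d * u = d * z + kin A lam * (d * u * d).
  by rewrite /zelt; nc_ring (oalg A).
by rewrite down_zed /zelt; nc_ring (oalg A).
Qed.

(** [z] is quadratic in the arrows and counts twice, so this is path length. *)
Definition pbw_len (b : pbw_index) : nat := b.2.1.1 + b.2.1.2.*2 + b.2.2.

Lemma envk_ind (P : E -> Prop) : P 0 ->
  (forall b a s, P s -> P (tens (mon A b) a + s)) -> forall t, P t.
Proof.
move=> P0 PS t; suff : forall s, P s -> P (t + s) by move=> /(_ 0 P0); rewrite addr0.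
elim/env_ind: t => [x a|t t' ih ih'] s Ps; last by rewrite -addrA; apply/ih/ih'.
elim/ore_ind: x => [|c b x ih]; first by rewrite tens0l add0r.
by rewrite tensDl tens_kinl -tens_kinr -addrA; apply: PS.
Qed.

(* An element of filtration degree [m] has left tensor factors of length < m. *)
Inductive lfilt (m : nat) : E -> Prop :=
| lfilt0 : lfilt m 0
| lfiltS b a s : (pbw_len b < m)%N -> lfilt m s -> lfilt m (tens (mon A b) a + s).

Lemma lfiltD m s t : lfilt m s -> lfilt m t -> lfilt m (s + t).
Proof.
move=> hs ht; elim: hs => [|b a s' bm _ ih]; first by rewrite add0r.
by rewrite -addrA; apply: lfiltS.
Qed.

Lemma lfiltT m b a : (pbw_len b < m)%N -> lfilt m (tens (mon A b) a).
Proof. by move=> bm; rewrite -[tens _ _]addr0; apply: lfiltS => //; exact: lfilt0. Qed.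

Lemma lfiltN m s : lfilt m s -> lfilt m (- s).
Proof.
elim=> [|b a s' bm _ ih]; first by rewrite oppr0; exact: lfilt0.
by rewrite opprD -tensNr; apply: lfiltS.
Qed.

Lemma lfilt_leq m n s : (m <= n)%N -> lfilt m s -> lfilt n s.
Proof.
move=> mn; elim=> [|b a s' bm _ ih]; first exact: lfilt0.
by apply: lfiltS => //; exact: leq_trans mn.
Qed.

Lemma lfilt_eq0 s : lfilt 0 s -> s = 0.
Proof. by move=> hs; inversion hs. Qed.

Lemma lfilt_exists s : exists m, lfilt m s.
Proof.
elim/envk_ind: s => [|b a s [m hm]]; first by exists 0; exact: lfilt0.
exists (maxn (pbw_len b).+1 m); apply: lfiltS; first by rewrite leq_maxl.
by apply: lfilt_leq hm; rewrite leq_maxr.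
Qed.

Lemma lfilt_kin m c s : lfilt m s -> lfilt m (kin Ek c * s).
Proof.
elim=> [|b a s' bm _ ih]; first by rewrite mulr0; exact: lfilt0.
by rewrite mulrDr -tens_kinr; apply: lfiltS.
Qed.

Lemma lfilt_tensr m s a : lfilt m s -> lfilt m (s * tensr a).
Proof.
elim=> [|b a' s' bm _ ih]; first by rewrite mul0r; exact: lfilt0.
by rewrite mulrDl mulr_tensr; apply: lfiltS.
Qed.

Lemma lfilt_up m s : lfilt m s -> lfilt m.+1 (s * tensl u).
Proof.
elim=> [|[v [[i j] l]] a s' bm _ ih]; first by rewrite mul0r; exact: lfilt0.
rewrite mulrDl mulr_tensl mon_up tensDl !tens_kinl.
apply/lfiltD/ih; apply: lfiltD; first by apply/lfilt_kin/lfiltT.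
(* For [l = 0] the second monomial of [mon_up] would be longer by two, but its coefficient is 0. For
   positive [l] a [d] is exchanged for a [z], which adds one. *)
case: l bm => [|l] bm /=; first by rewrite rmorph0 mul0r; exact: lfilt0.
by apply/lfilt_kin/lfiltT; move: bm; rewrite /pbw_len /= doubleS !addnS !addSn.
Qed.

Lemma lfilt_down m s : lfilt m s -> lfilt m.+1 (s * tensl d).
Proof.
elim=> [|[v [[i j] l]] a s' bm _ ih]; first by rewrite mul0r; exact: lfilt0.
rewrite mulrDl mulr_tensl mon_down; apply: lfiltS => //.
by move: bm; rewrite /pbw_len /= addnS.
Qed.

Definition oliftA (f : pbw_index -> kmod A) (x : A) : A :=
  @olift k V lam mu A (kmod A) f x.

Lemma oliftA_mon f b : oliftA f (mon A b) = f b.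
Proof. exact: (@olift_mon _ _ _ _ A (kmod A) f b). Qed.
Lemma oliftAD f x y : oliftA f (x + y) = oliftA f x + oliftA f y.
Proof. exact: (@oliftD _ _ _ _ A (kmod A) f x y). Qed.
Lemma oliftAZ f c x : oliftA f (kin A c * x) = kin A c * oliftA f x.
Proof. exact: (@oliftZ _ _ _ _ A (kmod A) f c x). Qed.
Lemma oliftA0 f : oliftA f 0 = 0.
Proof. exact: (@olift0 _ _ _ _ A (kmod A) f). Qed.
Lemma oliftAN f x : oliftA f (- x) = - oliftA f x.
Proof. by apply/eqP; rewrite -addr_eq0 -oliftAD addNr oliftA0. Qed.

Definition lmap (f : pbw_index -> kmod A) : E -> E :=
  env_lift (fun a b => tens (oliftA f a) b).

Fact lmap_bil f : bilinear2 (fun a b : A => tens (oliftA f a) b).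
Proof.
split=> [a a' b|a b b'|c a b|c a b].
- by rewrite oliftAD tensDl.
- by rewrite tensDr.
- by rewrite oliftAZ -tensZl.
- by rewrite tensZr.
Qed.

Lemma lmapT f a b : lmap f (tens a b) = tens (oliftA f a) b.
Proof. exact: env_lift_tens (lmap_bil f) _ _. Qed.

Lemma lmapD f s t : lmap f (s + t) = lmap f s + lmap f t.
Proof. exact: env_liftD (lmap_bil f) _ _. Qed.

Lemma lmap0 f : lmap f 0 = 0.
Proof. by rewrite -(tens0l 0) lmapT oliftA0 tens0l. Qed.

Lemma lmap_lfilt r f m s :
  (forall b, f b = 0 \/ exists c b', f b = kin A c * mon A b' /\
     (pbw_len b' + r <= pbw_len b)%N) ->
  lfilt m s -> lfilt (m - r) (lmap f s).
Proof.
move=> hf; elim=> [|b a s' bm _ ih]; first by rewrite lmap0; exact: lfilt0.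
rewrite lmapD lmapT oliftA_mon; case: (hf b) => [->|[c [b' [-> hb]]]].
  by rewrite tens0l add0r.
rewrite tens_kinl; apply: lfiltD => //; apply/lfilt_kin/lfiltT.
by rewrite ltn_subRL addnC; apply: leq_ltn_trans bm.
Qed.

(* The functions [s0d] to [s2] give a homotopy, acting on the left tensor factor
   only, that contracts the left leading parts of the differentials of the
   bimodule resolution. *)
Definition s0d (b : pbw_index) : kmod A :=
  let: (v, (i, j, l)) := b in
  if l is l'.+1 then mon A (v, (i, j, l'))
  else if j is j'.+1 then kin A (- (lam * mu ^+ j')) * mon A (v, (i.+1, j', 0%N))
  else 0.

Definition s0u (b : pbw_index) : kmod A :=
  let: (v, (i, j, l)) := b in
  if l is l'.+1 then 0
  else if j is j'.+1 then mon A (v, (i, j', 1%N))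
  else if i is i'.+1 then mon A (v, (i', 0%N, 0%N)) else 0.

Definition s1a (b : pbw_index) : kmod A :=
  let: (v, (i, j, l)) := b in
  if l is l'.+1 then 0 else if j is j'.+1 then mon A (v, (i, j', 0%N)) else 0.

Definition s1b (b : pbw_index) : kmod A :=
  let: (v, (i, j, l)) := b in
  if l is l'.+2 then mon A (v, (i, j, l')) else 0.

Definition s2 (b : pbw_index) : kmod A :=
  let: (v, (i, j, l)) := b in
  if l is l'.+1 then mon A (v, (i, j, l')) else 0.

Lemma olin_ext (f g : A -> A) :
  (forall c x y, f (kin A c * x + y) = kin A c * f x + f y) ->
  (forall c x y, g (kin A c * x + y) = kin A c * g x + g y) ->
  (forall b, f (mon A b) = g (mon A b)) -> forall x, f x = g x.
Proof.
move=> fl gl fg; have f0 h : (forall c x y, h (kin A c * x + y) =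
    kin A c * h x + h y) -> h (0 : A) = 0 :> A.
  by move=> /(_ (-1) 0 0); rewrite mulr0 addr0 rmorphN rmorph1 mulN1r addNr.
by elim/ore_ind => [|c b x ih]; rewrite ?f0 // fl gl fg ih.
Qed.

Lemma s0d_down x : oliftA s0d (x * d) = x.
Proof.
move: x; apply: olin_ext => // [c x y|[v [[i j] l]]].
  by rewrite mulrDl -mulrA oliftAD oliftAZ.
by rewrite mon_down oliftA_mon.
Qed.

Lemma s0u_down x : oliftA s0u (x * d) = 0.
Proof.
move: x; apply: olin_ext => [c x y|c _ _|[v [[i j] l]]].
- by rewrite mulrDl -mulrA oliftAD oliftAZ.
- by rewrite mulr0 addr0.
- by rewrite mon_down oliftA_mon.
Qed.

Lemma s1a_down2 x : oliftA s1a (x * (d * d)) = 0.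
Proof.
move: x; apply: olin_ext => [c x y|c _ _|[v [[i j] l]]].
- by rewrite mulrDl -mulrA oliftAD oliftAZ.
- by rewrite mulr0 addr0.
- by rewrite mulrA !mon_down oliftA_mon.
Qed.

Lemma s1b_down2 x : oliftA s1b (x * (d * d)) = x.
Proof.
move: x; apply: olin_ext => // [c x y|[v [[i j] l]]].
  by rewrite mulrDl -mulrA oliftAD oliftAZ.
by rewrite mulrA !mon_down oliftA_mon.
Qed.

Lemma s2_down x : oliftA s2 (x * d) = x.
Proof.
move: x; apply: olin_ext => // [c x y|[v [[i j] l]]].
  by rewrite mulrDl -mulrA oliftAD oliftAZ.
by rewrite mon_down oliftA_mon.
Qed.

(** This and [homotopy1u] are the two components of the homotopy identity in degree one, where a
    pair [(x, y)] is sent to [x * d + y * u]. The homotopy from degree one to degree two is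
    [y -> (s1a y, s1b y)]: it reads the second component only. *)
Lemma homotopy1d x :
  kin A beta * (oliftA s1a x * (u * u)) + kin A alpha * (oliftA s1b x * (d * u))
  + kin A beta * (oliftA s1b x * (u * d)) = oliftA s0d (x * u).
Proof.
move: x; apply: olin_ext => [c x y|c x y|[v [[i j] [|[|l]]]]].
- rewrite !oliftAD !oliftAZ; nc_ring (oalg A).
- by rewrite mulrDl -mulrA oliftAD oliftAZ.
- rewrite mon_up oliftAD !oliftAZ !oliftA_mon; case: j => [|j] /=.
    by rewrite !mul0r !mulr0 rmorph0 mul0r !addr0.
  rewrite (mulrA (mon A _) u u) !mon_up mulrDl -!mulrA !mon_up /=.
  rewrite !expr0 (exprS mu j); set m := mu ^+ j; rewrite !rmorph0.
  set X := mon A (v, (i.+2, _, _)); nc_ring (oalg A).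
- rewrite mon_up oliftAD !oliftAZ !oliftA_mon /=.
  rewrite expr0 expr1; set X := mon A _; set m := mu ^+ j; nc_ring (oalg A).
(* With two trailing letters [d] the relation [ddu] moves [u] to the left of a final [d], which
   [s0d] strips; no q-number has to be expanded. *)
- have -> : mon A (v, (i, j, l.+2)) = mon A (v, (i, j, l)) * (d * d).
    by rewrite mulrA !mon_down.
  set x := mon A _; rewrite s1a_down2 s1b_down2 -mulrA ddu.
  have -> : x * (kin A alpha * (d * u * d) + kin A beta * (u * d * d)) =
    (kin A alpha * (x * (d * u)) + kin A beta * (x * (u * d))) * d by nc_ring (oalg A).
  rewrite s0d_down; nc_ring (oalg A).
Qed.

Lemma mon_lead v i j l : mon A (v, (i, j, l)) * (d * u - kin A alpha * (u * d)) =
  kin A (mu ^+ l) * mon A (v, (i, j.+1, l)) -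
  kin A mu * (kin A (lam ^+ l * mu ^+ j) * mon A (v, (i.+1, j, l.+1)) +
              kin A (c_ l) * mon A (v, (i, j.+1, l.-1.+1))).
Proof.
have -> : d * u - kin A alpha * (u * d) = z - kin A mu * (u * d).
  by rewrite /zelt; nc_ring (oalg A).
by rewrite mulrBr mon_zed kinAC (mulrA (mon A _)) mon_up mulrDl -!mulrA !mon_down.
Qed.

Lemma homotopy1u x :
  oliftA s1a x * (d * u - kin A alpha * (u * d)) + oliftA s1b x * (d * d)
  + oliftA s0u (x * u) = x.
Proof.
move: x; apply: olin_ext => // [c x y|[v [[i j] [|[|l]]]]].
- rewrite mulrDl -mulrA !oliftAD !oliftAZ; nc_ring (oalg A).
- rewrite mon_up oliftAD !oliftAZ !oliftA_mon; case: j => [|j] /=.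
    by rewrite !expr0; set X := mon A _; nc_ring (oalg A).
  rewrite mon_lead !expr0 exprS /=.
  set X := mon A _; set Y := mon A _; set m := mu ^+ j; nc_ring (oalg A).
- rewrite mon_up oliftAD !oliftAZ !oliftA_mon /=; set X := mon A _; nc_ring (oalg A).
- have -> : mon A (v, (i, j, l.+2)) = mon A (v, (i, j, l)) * (d * d).
    by rewrite mulrA !mon_down.
  set x := mon A _; rewrite s1a_down2 s1b_down2 -mulrA ddu.
  have -> : x * (kin A alpha * (d * u * d) + kin A beta * (u * d * d)) =
    (kin A alpha * (x * (d * u)) + kin A beta * (x * (u * d))) * d by nc_ring (oalg A).
  rewrite s0u_down; nc_ring (oalg A).
Qed.

(** This and [homotopy2b] are the components of the homotopy identity in degree two. The leading
    part of the last differential is [c -> (c * d, - beta c * u)], and [s2] recovers [c] from its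
    first component. *)
Lemma homotopy2a x :
  oliftA s2 x * d + oliftA s1a (x * (d * u - kin A alpha * (u * d))) = x.
Proof.
move: x; apply: olin_ext => // [c x y|[v [[i j] l]]].
  rewrite mulrDl -mulrA !oliftAD !oliftAZ; nc_ring (oalg A).
rewrite mon_lead oliftAD oliftAN !oliftAZ oliftAD !oliftAZ !oliftA_mon /=.
case: l => [|l] /=; first by rewrite expr0 rmorph1 mul1r; set X := mon A _; nc_ring (oalg A).
by rewrite mon_down; set X := mon A _; nc_ring (oalg A).
Qed.

Lemma homotopy2b x :
  oliftA s1b (x * (d * u - kin A alpha * (u * d))) = kin A beta * (oliftA s2 x * u).
Proof.
move: x; apply: olin_ext => [c x y|c x y|[v [[i j] [|[|l]]]]].
- rewrite mulrDl -mulrA !oliftAD !oliftAZ; nc_ring (oalg A).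
- rewrite !oliftAD !oliftAZ; nc_ring (oalg A).
- rewrite mon_lead oliftAD oliftAN !oliftAZ oliftAD !oliftAZ !oliftA_mon /=.
  nc_ring (oalg A).
- rewrite mon_lead oliftAD oliftAN !oliftAZ oliftAD !oliftAZ !oliftA_mon /= mon_up /=.
  set X := mon A _; set m := mu ^+ j; rewrite !expr1 expr0; nc_ring (oalg A).
- have -> : mon A (v, (i, j, l.+2)) = mon A (v, (i, j, l)) * (d * d).
    by rewrite mulrA !mon_down.
  set x := mon A _.
  have -> : x * (d * d) * (d * u - kin A alpha * (u * d)) =
    x * d * (d * d * u) - kin A alpha * (x * d * (d * u * d)) by nc_ring (oalg A).
  rewrite ddu.
  have -> : x * d * (kin A alpha * (d * u * d) + kin A beta * (u * d * d)) -
      kin A alpha * (x * d * (d * u * d)) = kin A beta * (x * d * u * (d * d)).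
    by nc_ring (oalg A).
  by rewrite oliftAZ s1b_down2 (mulrA x d d) s2_down.
Qed.

End Homotopy.

(** * Exactness of the bimodule complex *)

Section Exactness.
Context (k : fieldType) (V : finType) (lam mu : k) (A : ore_algebra V lam mu).
Local Notation E := (env A).
Local Notation Ek := (env_kalgebra A).
Local Notation u := (up A).
Local Notation d := (down A).
Local Notation alpha := (lam + mu).
Local Notation beta := (- (lam * mu)).
Local Notation K := (kin Ek).
Implicit Types (x y : E) (a b : A).

Lemma tens_lr a b : tens a b = tensl a * tensr b :> E.
Proof. by rewrite mulr_tensr mulr1. Qed.

Lemma tensl_mul a b : tensl (a * b) = tensl a * tensl b :> E.
Proof. by rewrite mulr_tensl. Qed.

Lemma tensr_mul a b : tensr (a * b) = tensr b * tensr a :> E.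
Proof. by rewrite mulr_tensr. Qed.

(* Entries of the differentials: [m2ad] and [m2au] are the derivatives of the
   relation [duu], [m2bd] and [m2bu] those of [ddu], with respect to [d] and [u];
   [m3a] and [m3b] come from writing the overlap [d * d * u * u] in two ways. *)
Definition m1d : E := tensl d - tensr d.
Definition m1u : E := tensl u - tensr u.
Definition m2ad : E := tens 1 (u * u) - K alpha * tens u u - K beta * tens (u * u) 1.
Definition m2au : E := tens d u + tens (d * u) 1
  - K alpha * (tens 1 (d * u) + tens (u * d) 1) - K beta * (tens 1 (u * d) + tens u d).
Definition m2bd : E := tens 1 (d * u) + tens d u
  - K alpha * (tens 1 (u * d) + tens (d * u) 1) - K beta * (tens u d + tens (u * d) 1).
Definition m2bu : E := tens (d * d) 1 - K alpha * tens d d - K beta * tens 1 (d * d).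
Definition m3a : E := tensl d + K beta * tensr d.
Definition m3b : E := - (K beta * tensl u + tensr u).

Lemma lmap_s0d_down x : lmap (@s0d _ _ _ _ A) (x * tensl d) = x.
Proof.
elim/env_ind: x => [b c|s t ihs iht]; first by rewrite mulr_tensl lmapT s0d_down.
by rewrite mulrDl lmapD ihs iht.
Qed.

Lemma lmap_s0u_down x : lmap (@s0u _ _ _ _ A) (x * tensl d) = 0.
Proof.
elim/env_ind: x => [b c|s t ihs iht]; first by rewrite mulr_tensl lmapT s0u_down tens0l.
by rewrite mulrDl lmapD ihs iht addr0.
Qed.

Lemma lmap_s1a_down2 x : lmap (@s1a _ _ _ _ A) (x * tensl (d * d)) = 0.
Proof.
elim/env_ind: x => [b c|s t ihs iht]; first by rewrite mulr_tensl lmapT s1a_down2 tens0l.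
by rewrite mulrDl lmapD ihs iht addr0.
Qed.

Lemma lmap_s1b_down2 x : lmap (@s1b _ _ _ _ A) (x * tensl (d * d)) = x.
Proof.
elim/env_ind: x => [b c|s t ihs iht]; first by rewrite mulr_tensl lmapT s1b_down2.
by rewrite mulrDl lmapD ihs iht.
Qed.

Lemma lmap_s2_down x : lmap (@s2 _ _ _ _ A) (x * tensl d) = x.
Proof.
elim/env_ind: x => [b c|s t ihs iht]; first by rewrite mulr_tensl lmapT s2_down.
by rewrite mulrDl lmapD ihs iht.
Qed.

Local Notation h0d := (lmap (@s0d _ _ _ _ A)).
Local Notation h0u := (lmap (@s0u _ _ _ _ A)).
Local Notation h1a := (lmap (@s1a _ _ _ _ A)).
Local Notation h1b := (lmap (@s1b _ _ _ _ A)).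
Local Notation h2 := (lmap (@s2 _ _ _ _ A)).

Lemma lmap_s0d_up x : h0d (x * tensl u) =
  K beta * (h1a x * tensl (u * u)) + K alpha * (h1b x * tensl (d * u))
  + K beta * (h1b x * tensl (u * d)).
Proof.
elim/env_ind: x => [b c|s t ihs iht].
  by rewrite mulr_tensl !lmapT -homotopy1d !tensDl !tens_kinl !mulr_tensl.
by rewrite mulrDl !lmapD ihs iht; nc_ring (env_kalgebra A).
Qed.

Lemma lmap_s0u_up x : h0u (x * tensl u) =
  x - h1a x * (tensl (d * u) - K alpha * tensl (u * d)) - h1b x * tensl (d * d).
Proof.
elim/env_ind: x => [b c|s t ihs iht].
  rewrite mulr_tensl !lmapT -{2}[b]homotopy1u !tensDl !mulrBr.
  rewrite kinAC tensDl tensNl tens_kinl (@kinAC _ Ek) !mulr_tensl.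
  by nc_ring (env_kalgebra A).
by rewrite mulrDl !lmapD ihs iht; nc_ring (env_kalgebra A).
Qed.

Lemma lmap_s1a_lead x : h1a (x * (tensl (d * u) - K alpha * tensl (u * d))) =
  x - h2 x * tensl d.
Proof.
elim/env_ind: x => [b c|s t ihs iht].
  rewrite mulrBr (@kinAC _ Ek) !mulr_tensl -tens_kinl -tensNl -tensDl -kinAC -mulrBr.
  by rewrite !lmapT mulr_tensl -{2}[b]homotopy2a tensDl addrAC subrr add0r.
by rewrite mulrDl !lmapD ihs iht; nc_ring (env_kalgebra A).
Qed.

Lemma lmap_s1b_lead x : h1b (x * (tensl (d * u) - K alpha * tensl (u * d))) =
  K beta * (h2 x * tensl u).
Proof.
elim/env_ind: x => [b c|s t ihs iht].
  rewrite mulrBr (@kinAC _ Ek) !mulr_tensl -tens_kinl -tensNl -tensDl -kinAC -mulrBr.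
  by rewrite !lmapT homotopy2b tens_kinl mulr_tensl.
by rewrite mulrDl !lmapD ihs iht; nc_ring (env_kalgebra A).
Qed.

Lemma lfilt_h0d m x : lfilt m x -> lfilt m.-1 (h0d x).
Proof.
rewrite -subn1; apply: lmap_lfilt => -[v [[i [|j]] [|l]]] /=; first by left.
- right; exists 1; exists (v, (i, 0%N, l)); rewrite rmorph1 mul1r; split=> //.
  by rewrite /pbw_len /=; lia.
- right; eexists; eexists; split; first by [].
  by rewrite /pbw_len /=; lia.
- right; exists 1; exists (v, (i, j.+1, l)); rewrite rmorph1 mul1r; split=> //.
  by rewrite /pbw_len /=; lia.
Qed.

Ltac mon_bound := right; exists 1; eexists; rewrite rmorph1 mul1r;
  split; [reflexivity | rewrite /pbw_len /=; lia].

Lemma lfilt_h0u m x : lfilt m x -> lfilt m.-1 (h0u x).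
Proof.
rewrite -subn1; apply: lmap_lfilt => -[v [[i [|j]] [|l]]] /=; try by left.
- by case: i => [|i]; [left|mon_bound].
- by mon_bound.
Qed.

Lemma lfilt_h1a m x : lfilt m x -> lfilt m.-2 (h1a x).
Proof.
rewrite -subn2; apply: lmap_lfilt => -[v [[i [|j]] [|l]]] /=; try by left.
by mon_bound.
Qed.

Lemma lfilt_h1b m x : lfilt m x -> lfilt m.-2 (h1b x).
Proof.
rewrite -subn2; apply: lmap_lfilt => -[v [[i j] [|[|l]]]] /=; try by left.
by mon_bound.
Qed.

Lemma lfilt_h2 m x : lfilt m x -> lfilt m.-1 (h2 x).
Proof.
rewrite -subn1; apply: lmap_lfilt => -[v [[i j] [|l]]] /=; try by left.
by mon_bound.
Qed.

Lemma lfilt_tens1 m x b : lfilt m.-1 x -> lfilt m (x * tens 1 b).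
Proof. by move=> hx; apply/lfilt_tensr/(lfilt_leq (leq_pred m)). Qed.

Lemma lfilt_tens_up m x b : lfilt m.-1 x -> lfilt m (x * tens u b).
Proof.
move=> hx; rewrite tens_lr mulrA; apply: lfilt_tensr.
case: m hx => [/lfilt_eq0->|m]; first by rewrite mul0r; exact: lfilt0.
exact: lfilt_up.
Qed.

Lemma lfilt_tens_down m x b : lfilt m.-1 x -> lfilt m (x * tens d b).
Proof.
move=> hx; rewrite tens_lr mulrA; apply: lfilt_tensr.
case: m hx => [/lfilt_eq0->|m]; first by rewrite mul0r; exact: lfilt0.
exact: lfilt_down.
Qed.

Ltac lfilt_auto := repeat first
  [ assumption | apply: lfiltD | apply: lfiltN | apply: lfilt_kin
  | apply: lfilt_tens1 | apply: lfilt_tens_up | apply: lfilt_tens_down ].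

(** The left part of [m3a] is inverted by [h2], which lowers the filtration by one, while its right
    part does not change the filtration. The equation therefore pushes [x] one step down, and so on
    to 0. *)
Lemma exact3 x : x * m3a = 0 -> x = 0.
Proof.
have [m hm] := lfilt_exists x.
elim: m x hm => [|m ih] x hm xm; first exact: lfilt_eq0.
apply: ih => //; have e : x * tensl d = - (K beta * (x * tensr d)).
  by apply/eqP; rewrite -addr_eq0 -xm /m3a; apply/eqP; nc_ring (env_kalgebra A).
rewrite -(lmap_s2_down x) e; apply: (@lfilt_h2 m.+1).
by apply/lfiltN/lfilt_kin/lfilt_tensr.
Qed.

Lemma kin_mulA c x y : K c * x * y = K c * (x * y).
Proof. by rewrite mulrA. Qed.

Lemma kin_kin c c' x : K c * (K c' * x) = K (c * c') * x.
Proof. by rewrite mulrA -rmorphM. Qed.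

(* The rule [kin_kin] must precede [kinAC], which loops on nested scalars. *)
Ltac tens_expand :=
  rewrite !(mulrDl, mulrDr, mulNr, mulrN, kin_mulA, kin_kin, @kinAC _ Ek);
  rewrite /tensl /tensr !tensM !(mul1r, mulr1) ?mulrA.

Lemma m3_m2_d : m3a * m2ad + m3b * m2bd = 0.
Proof.
rewrite /m3a /m3b /m2ad /m2bd; tens_expand.
rewrite duu ?tensDl ?tensDr ?tens_kinl ?tens_kinr.
nc_ring (env_kalgebra A).
Qed.

Lemma m3_m2_u : m3a * m2au + m3b * m2bu = 0.
Proof.
rewrite /m3a /m3b /m2au /m2bu; tens_expand.
rewrite ddu ?tensDl ?tensDr ?tens_kinl ?tens_kinr.
nc_ring (env_kalgebra A).
Qed.

Lemma m2_m1_a : m2ad * m1d + m2au * m1u = 0.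
Proof.
rewrite /m2ad /m2au /m1d /m1u; tens_expand.
rewrite duu ?tensDl ?tensDr ?tens_kinl ?tens_kinr.
nc_ring (env_kalgebra A).
Qed.

Lemma m2_m1_b : m2bd * m1d + m2bu * m1u = 0.
Proof.
rewrite /m2bd /m2bu /m1d /m1u; tens_expand.
rewrite ddu ?tensDl ?tensDr ?tens_kinl ?tens_kinr.
nc_ring (env_kalgebra A).
Qed.

(** The equation between second components is enough, because the homotopy out of degree one reads
    only that component. Subtracting the boundary of [h2 x] from the pair lowers the filtration. *)
Lemma exact2 x y : x * m2au + y * m2bu = 0 -> exists c, x = c * m3a /\ y = c * m3b.
Proof.
have [m hm] := lfilt_exists x; have [n hn] := lfilt_exists y.
have {hm} : lfilt (maxn m n) x by apply: lfilt_leq hm; rewrite leq_maxl.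
have {hn} : lfilt (maxn m n) y by apply: lfilt_leq hn; rewrite leq_maxr.
elim: (maxn m n) x y => {m n} [|m ih] x y hy hx e.
  by exists 0; rewrite (lfilt_eq0 hx) (lfilt_eq0 hy) !mul0r.
pose c := h2 x; pose w := x * (tensl (d * u) - K alpha * tensl (u * d)) +
  y * tensl (d * d).
have ew : w = x * (- tens d u + K alpha * tens 1 (d * u) + K beta * tens 1 (u * d)
    + K beta * tens u d) + y * (K alpha * tens d d + K beta * tens 1 (d * d)).
  by apply/eqP; rewrite -subr_eq0 -e /w /m2au /m2bu /tensl; apply/eqP;
     nc_ring (env_kalgebra A).
(* By its shape [w] lies only in degree [m.+3]. The equation rewrites it through terms that raise
   the left length by at most one; as [h1a] and [h1b] lower the degree by two, the corrected pair
   lands in degree [m]. *)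
have hw : lfilt m.+2 w.
  rewrite ew !mulrDr mulrN !(@kinAC _ Ek).
  have hx' := hx; have hy' := hy; lfilt_auto.
have hc : lfilt m c by exact: (@lfilt_h2 m.+1).
have ea : h1a w = x - c * tensl d by rewrite lmapD lmap_s1a_lead lmap_s1a_down2 addr0.
have eb : h1b w = K beta * (c * tensl u) + y.
  by rewrite lmapD lmap_s1b_lead lmap_s1b_down2.
have [||| c' [ex ey]] := ih (x - c * m3a) (y - c * m3b).
- have -> : y - c * m3b = h1b w + c * tensr u.
    by rewrite eb /m3b; nc_ring (env_kalgebra A).
  by apply: lfiltD; [exact: (@lfilt_h1b m.+2)|exact: lfilt_tensr].
- have -> : x - c * m3a = h1a w - K beta * (c * tensr d).
    by rewrite ea /m3a; nc_ring (env_kalgebra A).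
  apply: lfiltD; first exact: (@lfilt_h1a m.+2).
  by apply/lfiltN/lfilt_kin/lfilt_tensr.
- have -> : (x - c * m3a) * m2au + (y - c * m3b) * m2bu =
    (x * m2au + y * m2bu) - c * (m3a * m2au + m3b * m2bu) by nc_ring (env_kalgebra A).
  by rewrite e m3_m2_u mulr0 subr0.
exists (c' + c); rewrite !mulrDl -ex -ey !subrK; split=> //.
Qed.

(** The same descent one place lower: the boundary of [(h1a y, h1b y)] is subtracted, and by the
    homotopy identity what remains of the leading part is [h0d w] and [h0u w], where [w] equals a
    sum of terms that leave the left factors alone. *)
Lemma exact1 x y : x * m1d + y * m1u = 0 ->
  exists p q : E, x = p * m2ad + q * m2bd /\ y = p * m2au + q * m2bu.
Proof.
have [m hm] := lfilt_exists x; have [n hn] := lfilt_exists y.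
have {hm} : lfilt (maxn m n) x by apply: lfilt_leq hm; rewrite leq_maxl.
have {hn} : lfilt (maxn m n) y by apply: lfilt_leq hn; rewrite leq_maxr.
elim: (maxn m n) x y => {m n} [|m ih] x y hy hx e.
  exists 0, 0; rewrite (lfilt_eq0 hx) (lfilt_eq0 hy) !mul0r addr0; split=> //.
pose a := h1a y; pose b := h1b y; pose w := x * tensl d + y * tensl u.
have ew : w = x * tensr d + y * tensr u.
  by apply/eqP; rewrite -subr_eq0 -e /w /m1d /m1u; apply/eqP; nc_ring (env_kalgebra A).
have hw : lfilt m.+1 w by rewrite ew; apply: lfiltD; apply: lfilt_tensr.
have ha : lfilt m.-1 a by exact: (@lfilt_h1a m.+1).
have hb : lfilt m.-1 b by exact: (@lfilt_h1b m.+1).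
have ed : h0d w = x + K beta * (a * tensl (u * u)) + K alpha * (b * tensl (d * u))
    + K beta * (b * tensl (u * d)).
  by rewrite lmapD lmap_s0d_down lmap_s0d_up !addrA.
have eu : h0u w = y - a * (tensl (d * u) - K alpha * tensl (u * d)) -
    b * tensl (d * d).
  by rewrite lmapD lmap_s0u_down lmap_s0u_up add0r.
have [||| a' [b' [ex ey]]] := ih (x - (a * m2ad + b * m2bd)) (y - (a * m2au + b * m2bu)).
- have -> : y - (a * m2au + b * m2bu) = h0u w
    - a * tens d u + K alpha * (a * tens 1 (d * u)) + K beta * (a * tens 1 (u * d))
    + K beta * (a * tens u d) + K alpha * (b * tens d d) + K beta * (b * tens 1 (d * d)).
    by rewrite eu /m2au /m2bu /tensl; nc_ring (env_kalgebra A).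
  have h0 : lfilt m (h0u w) by exact: (@lfilt_h0u m.+1).
  lfilt_auto.
- have -> : x - (a * m2ad + b * m2bd) = h0d w
    - a * tens 1 (u * u) + K alpha * (a * tens u u) - b * tens 1 (d * u)
    - b * tens d u + K alpha * (b * tens 1 (u * d)) + K beta * (b * tens u d).
    by rewrite ed /m2ad /m2bd /tensl; nc_ring (env_kalgebra A).
  have h0 : lfilt m (h0d w) by exact: (@lfilt_h0d m.+1).
  lfilt_auto.
- have -> : (x - (a * m2ad + b * m2bd)) * m1d + (y - (a * m2au + b * m2bu)) * m1u =
    (x * m1d + y * m1u) - a * (m2ad * m1d + m2au * m1u) - b * (m2bd * m1d + m2bu * m1u).
    by nc_ring (env_kalgebra A).
  by rewrite e m2_m1_a m2_m1_b !mulr0 !subr0.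
exists (a' + a), (b' + b); rewrite !mulrDl; split.
  by apply/eqP; rewrite addrACA -subr_eq ex.
by apply/eqP; rewrite addrACA -subr_eq ey.
Qed.

End Exactness.

(** * Self-duality of the complex *)

Section Twist.
Context (k : fieldType) (V : finType) (lam mu : k) (A : ore_algebra V lam mu).
Local Notation u := (up A).
Local Notation d := (down A).
Local Notation z := (zelt lam (up A) (down A)).

Lemma ore_gen (Q : A -> Prop) :
  (forall c x y, Q x -> Q y -> Q (kin A c * x + y)) -> (forall x y, Q x -> Q y -> Q (x * y)) ->
  (forall v, Q (vid A v)) -> Q u -> Q d -> Q 0 -> forall x, Q x.
Proof.
move=> QD QM Qe Qu Qd Q0.
have Q1 : Q 1.
  rewrite -(vid_sum A); elim/big_rec: _ => // v x _ Qx.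
  by rewrite -[vid A v]mul1r -(rmorph1 (kin A)); apply: QD.
have QX x n : Q x -> Q (x ^+ n).
  by move=> Qx; elim: n => // n ih; rewrite exprS; apply: QM.
have Qz : Q z.
  have -> : z = kin A (- lam) * (u * d) + d * u by rewrite /zelt; nc_ring (oalg A).
  by apply: QD; apply: QM.
elim/ore_ind => // c [v [[i j] l]] x Qx; apply: QD => //; rewrite monE.
by apply: (QM) => //; apply: (QM); [apply: (QM)|]; apply: QX.
Qed.

Section Def.
Context (s t : k) (sigma : {perm V}).
Hypotheses (sigma_up : forall v, upt A (sigma v) = sigma (upt A v))
           (sigma_down : forall v, downt A (sigma v) = sigma (downt A v)).

(** The automorphism sending [u] to [s u], [d] to [t d] and permuting the idempotents by [sigma],
    given on the basis; [z] is scaled by [s * t]. Multiplicativity is then checked one generator at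
    a time. *)
Definition twist : A -> A := oliftA (fun b =>
  kin A (s ^+ (b.2.1.1 + b.2.1.2)%N * t ^+ (b.2.1.2 + b.2.2)%N) * mon A (sigma b.1, b.2)).

Lemma twist_mon v i j l : twist (mon A (v, (i, j, l))) =
  kin A (s ^+ (i + j)%N * t ^+ (j + l)%N) * mon A (sigma v, (i, j, l)).
Proof. by rewrite /twist oliftA_mon. Qed.
Lemma twistD x y : twist (x + y) = twist x + twist y.
Proof. exact: oliftAD. Qed.
Lemma twistZ c x : twist (kin A c * x) = kin A c * twist x.
Proof. exact: oliftAZ. Qed.
Lemma twist0 : twist 0 = 0.
Proof. exact: oliftA0. Qed.

Lemma twist_sum (I : Type) (r : seq I) F :
  twist (\sum_(i <- r) F i) = \sum_(i <- r) twist (F i).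
Proof.
elim: r => [|i r ih]; first by rewrite !big_nil twist0.
by rewrite !big_cons twistD ih.
Qed.

Lemma mon_up_pred v i j l : mon A (v, (i, j, l)) * u =
  kin A (lam ^+ l * mu ^+ j) * mon A (v, (i.+1, j, l)) +
  (if l is l'.+1 then kin A (qnum lam mu l) * mon A (v, (i, j.+1, l')) else 0).
Proof.
by rewrite mon_up; case: l => [|l] //=; rewrite rmorph0 mul0r.
Qed.

(** Both terms of [mon_up] contain equally many letters [u] and [d], counting [z] as one of each, so
    they are scaled by the same factor. *)
Lemma twist_mulu x : twist (x * u) = twist x * (kin A s * u).
Proof.
move: x; apply: olin_ext => [c x y|c x y|[v [[i j] l]]].
- by rewrite mulrDl -mulrA twistD twistZ.
- by rewrite twistD twistZ mulrDl -!mulrA.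
rewrite twist_mon -mulrA (kinAC _ (mon A _)) !mon_up_pred twistD twistZ.
rewrite twist_mon addSn exprS.
case: l => [|l].
  by rewrite twist0; set a := s ^+ _; set b := t ^+ _; set X := mon A _; nc_ring (oalg A).
rewrite twistZ twist_mon !addnS !addSn !exprS.
set a := s ^+ _; set b := t ^+ _; set X := mon A _; set Y := mon A _.
set p := lam ^+ _; set q := mu ^+ j; set r := qnum _ _ _; nc_ring (oalg A).
Qed.

Lemma twist_muld x : twist (x * d) = twist x * (kin A t * d).
Proof.
move: x; apply: olin_ext => [c x y|c x y|[v [[i j] l]]].
- by rewrite mulrDl -mulrA twistD twistZ.
- by rewrite twistD twistZ mulrDl -!mulrA.
rewrite twist_mon -mulrA (kinAC _ (mon A _)) !mon_down twist_mon addnS exprS.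
set a := s ^+ _; set b := t ^+ _; set X := mon A _; nc_ring (oalg A).
Qed.

Lemma pbw_tgt_twist v b : pbw_tgt A (sigma v, b) = sigma (pbw_tgt A (v, b)).
Proof.
have H f n w : (forall v, f (sigma v) = sigma (f v)) ->
    iter n f (sigma w) = sigma (iter n f w).
  by move=> fs; elim: n => //= n ->.
by rewrite /pbw_tgt /= (H (downt A)) // (H (upt A)).
Qed.

Lemma twist_mule x v : twist (x * vid A v) = twist x * vid A (sigma v).
Proof.
move: x; apply: olin_ext => [c x y|c x y|[w [[i j] l]]].
- by rewrite mulrDl -mulrA twistD twistZ.
- by rewrite twistD twistZ mulrDl -!mulrA.
rewrite mon_vid twist_mon -mulrA mon_vid pbw_tgt_twist (inj_eq perm_inj).
by case: eqP => _; rewrite ?twist_mon // twist0 mulr0.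
Qed.

Lemma vid_mon0 v : vid A v = mon A (v, (0, 0, 0)%N).
Proof. by rewrite monE !expr0 !mulr1. Qed.

Lemma twist_vid v : twist (vid A v) = vid A (sigma v).
Proof. by rewrite !vid_mon0 twist_mon !expr0 mulr1 rmorph1 mul1r. Qed.

Lemma twist1 : twist 1 = 1.
Proof.
rewrite -(vid_sum A) twist_sum [RHS](reindex_inj (@perm_inj _ sigma)) /=.
by apply: eq_bigr => v _; rewrite twist_vid.
Qed.

Lemma twist_up : twist u = kin A s * u.
Proof. by rewrite -[u in LHS]mul1r twist_mulu twist1 mul1r. Qed.
Lemma twist_down : twist d = kin A t * d.
Proof. by rewrite -[d in LHS]mul1r twist_muld twist1 mul1r. Qed.

Lemma twistM x y : twist (x * y) = twist x * twist y.
Proof.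
elim/ore_gen: y x => [c y y' ih ih' x|y y' ih ih' x|v x|x|x|x].
- by rewrite twistD twistZ !mulrDr !kinAC -ih -ih' twistD twistZ.
- by rewrite mulrA ih' ih -mulrA -ih'.
- by rewrite twist_mule twist_vid.
- by rewrite twist_mulu twist_up.
- by rewrite twist_muld twist_down.
- by rewrite mulr0 twist0 mulr0.
Qed.

(** Exchanging the two factors reverses products in the enveloping algebra, and an automorphism
    applied to one factor does not disturb this. *)
Definition theta : env A -> env A := env_lift (fun a b : A => tens (twist b) a).

Fact theta_bil : bilinear2 (fun a b : A => tens (twist b) a).
Proof.
split=> [a a' b|a b b'|c a b|c a b].
- by rewrite tensDr.
- by rewrite twistD tensDl.
- by rewrite tensZr.
- by rewrite twistZ -tensZl.
Qed.

Lemma thetaT a b : theta (tens a b) = tens (twist b) a.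
Proof. exact: env_lift_tens theta_bil _ _. Qed.
Lemma thetaD x y : theta (x + y) = theta x + theta y.
Proof. exact: env_liftD theta_bil _ _. Qed.
Lemma theta0 : theta 0 = 0.
Proof. by rewrite -(tens0l 0) thetaT twist0 tens0l. Qed.
Lemma thetaN x : theta (- x) = - theta x.
Proof. by apply/eqP; rewrite -addr_eq0 -thetaD addNr theta0. Qed.
Lemma thetaZ c x : theta (kin (env_kalgebra A) c * x) = kin (env_kalgebra A) c * theta x.
Proof. by rewrite -!env_scaleE; exact: env_liftZ theta_bil _ _. Qed.

Lemma thetaM x y : theta (x * y) = theta y * theta x.
Proof.
elim/env_ind: x => [a b|x x' ih ih']; last by rewrite mulrDl !thetaD ih ih' mulrDr.
elim/env_ind: y => [a' b'|y y' ih ih']; last by rewrite mulrDr !thetaD ih ih' mulrDl.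
by rewrite tensM !thetaT tensM twistM.
Qed.

End Def.

Lemma twistK s t sigma : s != 0 -> t != 0 ->
  cancel (twist s t sigma) (twist s^-1 t^-1 sigma^-1%g).
Proof.
move=> s0 t0; apply: olin_ext => // [c x y|[v [[i j] l]]].
  by rewrite !(twistD, twistZ).
rewrite twist_mon twistZ twist_mon permK mulrA -rmorphM /= !exprVn mulrACA.
by rewrite !divff ?expf_neq0 // mulr1 rmorph1 mul1r.
Qed.

Lemma theta_bij s t sigma : s != 0 -> t != 0 -> bijective (theta s t sigma).
Proof.
move=> s0 t0; pose f : env A -> env A :=
  env_lift (fun a b : A => tens b (twist s^-1 t^-1 sigma^-1%g a)).
have fB : bilinear2 (fun a b : A => tens b (twist s^-1 t^-1 sigma^-1%g a)).
  split=> [a a' b|a b b'|c a b|c a b].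
  - by rewrite twistD tensDr.
  - by rewrite tensDl.
  - by rewrite twistZ tensZr.
  - by rewrite -tensZl.
have fT a b : f (tens a b) = tens b (twist s^-1 t^-1 sigma^-1%g a).
  exact: env_lift_tens fB _ _.
exists f => x; elim/env_ind: x => [a b|x y ihx ihy].
- by rewrite thetaT fT twistK.
- by rewrite thetaD /f (env_liftD fB) -!/(f _) ihx ihy.
- have := @twistK s^-1 t^-1 sigma^-1%g; rewrite !invr_neq0 // invrK invrK invgK.
  by move=> tw; rewrite fT thetaT tw.
- by rewrite /f (env_liftD fB) -!/(f _) thetaD ihx ihy.
Qed.

End Twist.

Section Duality.
Context (k : fieldType) (V : finType) (lam mu : k) (A : ore_algebra V lam mu).
Hypothesis (q_neq0 : lam * mu != 0).
Local Notation E := (env A).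
Local Notation Ek := (env_kalgebra A).
Local Notation u := (up A).
Local Notation d := (down A).
Local Notation q := (lam * mu).
Local Notation K := (kin Ek).
Implicit Types (x y : E).

(** The passage from source to target of the overlap [dduu], which generates the last term of the
    resolution. *)
Definition nak_perm : {perm V} := (upt A * upt A * (downt A * downt A))%g.

Lemma nak_permE v : nak_perm v = upt A (upt A (downt A (downt A v))).
Proof. by rewrite /nak_perm !permM -!upt_downt. Qed.

Lemma nak_perm_up v : upt A (nak_perm v) = nak_perm (upt A v).
Proof. by rewrite !nak_permE -!upt_downt. Qed.

Lemma nak_perm_down v : downt A (nak_perm v) = nak_perm (downt A v).
Proof. by rewrite !nak_permE -!upt_downt. Qed.

Lemma nak_permV_up v : upt A (nak_perm^-1%g v) = nak_perm^-1%g (upt A v).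
Proof. by apply: (@perm_inj _ nak_perm); rewrite -nak_perm_up !permKV. Qed.

Lemma nak_permV_down v : downt A (nak_perm^-1%g v) = nak_perm^-1%g (downt A v).
Proof. by apply: (@perm_inj _ nak_perm); rewrite -nak_perm_down !permKV. Qed.

(* Inverse of the Nakayama automorphism. *)
Definition nu : A -> A := @twist _ _ _ _ A q q^-1 nak_perm^-1%g.
Definition nuV : A -> A := @twist _ _ _ _ A q^-1 q nak_perm.

Lemma nuM a b : nu (a * b) = nu a * nu b.
Proof. by apply: twistM; [exact: nak_permV_up|exact: nak_permV_down]. Qed.
Lemma nuVM a b : nuV (a * b) = nuV a * nuV b.
Proof. by apply: twistM; [exact: nak_perm_up|exact: nak_perm_down]. Qed.

Lemma nuK : cancel nu nuV.
Proof.
by have := @twistK _ _ _ _ A q q^-1 nak_perm^-1%g; rewrite invgK invrK invr_neq0 //; exact.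
Qed.
Lemma nuVK : cancel nuV nu.
Proof.
by have := @twistK _ _ _ _ A q^-1 q nak_perm; rewrite invrK invr_neq0 //; exact.
Qed.

(* An antiautomorphism that identifies the dual of the resolution of A with the
   resolution itself. *)
Definition th : E -> E := @theta _ _ _ _ A q q^-1 nak_perm^-1%g.

Lemma thM x y : th (x * y) = th y * th x.
Proof. by apply: thetaM; [exact: nak_permV_up|exact: nak_permV_down]. Qed.
Lemma thD x y : th (x + y) = th x + th y.
Proof. exact: thetaD. Qed.
Lemma thN x : th (- x) = - th x.
Proof. exact: thetaN. Qed.
Lemma th0 : th 0 = 0.
Proof. exact: theta0. Qed.
Lemma thZ c x : th (K c * x) = K c * th x.
Proof. exact: thetaZ. Qed.
Lemma thT a b : th (tens a b) = tens (nu b) a.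
Proof. exact: thetaT. Qed.
Lemma th_bij : bijective th.
Proof. by apply: theta_bij; rewrite ?invr_eq0. Qed.
Lemma th_inj : injective th.
Proof. exact: bij_inj th_bij. Qed.
Lemma th_surj y : exists x, y = th x.
Proof. by case: th_bij => f _ fK; exists (f y); rewrite fK. Qed.

Lemma nu_up : nu u = kin A q * u.
Proof. exact: twist_up. Qed.
Lemma nu_down : nu d = kin A q^-1 * d.
Proof. exact: twist_down. Qed.
Lemma nu1 : nu 1 = 1.
Proof. exact: twist1. Qed.
Lemma nu_vid v : nu (vid A v) = vid A (nak_perm^-1%g v).
Proof. exact: twist_vid. Qed.

Let thE := (thD, thN, thZ, thT, nuM, nu_up, nu_down, nu1).

(** This fixes the scalars in [nu]: the right factor [d] of [m1d] must come back on the left with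
    coefficient [q^-1], to be proportional to [m3a], which is [tensl d - q tensr d]. In the same way
    [m1u] forces [u] to be scaled by [q]. *)
Lemma th_m1d : th (m1d A) = K (- q^-1) * m3a A.
Proof.
rewrite /m1d /m3a /tensl /tensr !thE tens_kinl.
have -> : K (- (lam * mu)) = - K q by rewrite rmorphN.
have -> : K (- q^-1) = - K q^-1 by rewrite rmorphN.
rewrite mulrDr !mulNr mulrN opprK (mulrA (K _)) -rmorphM mulVf // rmorph1 mul1r.
by rewrite addrC.
Qed.

Lemma th_m1u : th (m1u A) = - m3b A.
Proof.
rewrite /m1u /m3b /tensl /tensr !thE tens_kinl; nc_ring (env_kalgebra A).
Qed.

Lemma th_m3a : th (m3a A) = - m1d A.
Proof.
rewrite /m1d /m3a /tensl /tensr !thE tens_kinl (mulrA (K _)) -rmorphM mulNr.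
rewrite divff // rmorphN rmorph1; nc_ring (env_kalgebra A).
Qed.

Lemma th_m3b : th (m3b A) = K (- q) * m1u A.
Proof.
rewrite /m1u /m3b /tensl /tensr !thE tens_kinl; nc_ring (env_kalgebra A).
Qed.

Lemma nu_uu : nu (u * u) = kin A (q * q) * (u * u).
Proof. by rewrite nuM nu_up; nc_ring (oalg A). Qed.
Lemma nu_dd : nu (d * d) = kin A (q^-1 * q^-1) * (d * d).
Proof. by rewrite nuM nu_down; set r := q^-1; nc_ring (oalg A). Qed.
Lemma nu_ud : nu (u * d) = u * d.
Proof.
rewrite nuM nu_down nu_up kinAC mulrA (mulrA (kin A _)) -rmorphM mulVf //.
by rewrite rmorph1 mul1r.
Qed.
Lemma nu_du : nu (d * u) = d * u.
Proof.
rewrite nuM nu_down nu_up kinAC mulrA (mulrA (kin A _)) -rmorphM divff //.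
by rewrite rmorph1 mul1r.
Qed.

(** Up to the factors [q] and [q^-1] on the diagonal, [th] transposes the middle matrix: it
    exchanges [m2au] and [m2bd]. *)
Lemma th_m2ad : th (m2ad A) = K q * m2ad A.
Proof.
rewrite /m2ad !(thD, thN, thZ, thT, nu1, nu_uu, nu_up) !tens_kinl.
nc_ring (env_kalgebra A).
Qed.

Lemma th_m2au : th (m2au A) = m2bd A.
Proof.
rewrite /m2au /m2bd !(thD, thN, thZ, thT, nu1, nu_ud, nu_du, nu_up, nu_down) !tens_kinl.
have qV : q^-1 * q = 1 by rewrite mulVf.
have -> : K (- q) * (tens (u * d) 1 + K q^-1 * tens d u) =
    K (- q) * tens (u * d) 1 - tens d u.
  by rewrite mulrDr rmorphN !mulNr mulrA -rmorphM divff // rmorph1 mul1r.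
nc_ring (env_kalgebra A).
Qed.

Lemma th_m2bd : th (m2bd A) = m2au A.
Proof.
rewrite /m2au /m2bd !(thD, thN, thZ, thT, nu1, nu_ud, nu_du, nu_up, nu_down) !tens_kinl.
have -> : K (- q) * (K q^-1 * tens d u + tens 1 (u * d)) =
    K (- q) * tens 1 (u * d) - tens d u.
  by rewrite mulrDr rmorphN !mulNr mulrA -rmorphM divff // rmorph1 mul1r addrC.
nc_ring (env_kalgebra A).
Qed.

Lemma th_m2bu : th (m2bu A) = K q^-1 * m2bu A.
Proof.
rewrite /m2bu !(thD, thN, thZ, thT, nu1, nu_dd, nu_down) !tens_kinl.
have -> : K (- q) * (K (q^-1 * q^-1) * tens (d * d) 1) = - (K q^-1 * tens (d * d) 1).
  by rewrite rmorphN mulNr mulrA -rmorphM mulrA divff // mul1r.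
have -> : K q^-1 * (tens (d * d) 1 - K (lam + mu) * tens d d - K (- q) * tens 1 (d * d))
  = K q^-1 * tens (d * d) 1 - K (lam + mu) * (K q^-1 * tens d d) + tens 1 (d * d).
  have e : tens 1 (d * d) = K (q^-1 * q) * tens 1 (d * d) :> E.
    by rewrite mulVf // rmorph1 mul1r.
  by rewrite [X in _ = _ + X]e; set r := q^-1; nc_ring (env_kalgebra A).
set r := q^-1; nc_ring (env_kalgebra A).
Qed.

Lemma dual_exact0 y : m1d A * y = 0 -> y = 0.
Proof.
move=> /(congr1 th); rewrite thM th_m1d th0 kinAC => /(congr1 (fun x => K (- q) * x)).
rewrite mulrA -rmorphM mulrNN divff // rmorph1 mul1r mulr0 => /exact3 ty0.
by apply: th_inj; rewrite ty0 th0.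
Qed.

(** Being an antiautomorphism, [th] turns this equation on a column into the equation of [exact2] on
    a row. The first entry is scaled by [q] to compensate for the [q^-1] of [th_m2bu]. *)
Lemma dual_exact1 x y : m2bd A * x + m2bu A * y = 0 ->
  exists c, x = m1d A * c /\ y = m1u A * c.
Proof.
move=> /(congr1 th); rewrite thD !thM th_m2bd th_m2bu th0 kinAC => e.
have [|c [ex ey]] := @exact2 _ _ _ _ A (K q * th x) (th y).
  rewrite -mulrA -[th y * _]mul1r -(rmorph1 K) -(divff q_neq0) (rmorphM K q) -[X in _ + X]mulrA.
  by rewrite -mulrDr e mulr0.
have [c' ec] := th_surj c; exists (- c'); split; apply: th_inj.
  rewrite thM th_m1d thN -ec kinAC mulNr -ex rmorphN mulrN mulNr opprK mulrA.
  by rewrite -rmorphM mulVf // rmorph1 mul1r.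
by rewrite thM th_m1u thN -ec mulrNN -ey.
Qed.

Lemma dual_exact2 x y : m3a A * x + m3b A * y = 0 ->
  exists a b : E, x = m2ad A * a + m2au A * b /\ y = m2bd A * a + m2bu A * b.
Proof.
move=> /(congr1 th); rewrite thD !thM th_m3a th_m3b th0 kinAC => e.
have [|a [b [ex ey]]] := @exact1 _ _ _ _ A (- th x) (K (- q) * th y).
  by rewrite mulNr -mulrN -mulrA e.
have [a' ea] := th_surj (- (K q^-1 * a)); have [b' eb] := th_surj (- b).
exists a', b'; split; apply: th_inj; rewrite thD !thM -ea -eb.
  have -> : - (K q^-1 * a) * th (m2ad A) = - (a * m2ad A).
    rewrite th_m2ad mulNr kinAC 2!mulrA -(rmorphM K q) divff //.
    by rewrite rmorph1 mul1r.
  by rewrite th_m2au mulNr -opprD -ex opprK.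
have -> : th y = - (K q^-1 * (K (- q) * th y)).
  by rewrite mulrA -rmorphM mulrN mulVf // rmorphN rmorph1 mulN1r opprK.
by rewrite ey th_m2bd th_m2bu mulrDr opprD !mulNr kinAC !mulrA.
Qed.

(** The left ideal generated by [eps m n] is the sum over [v] of the bimodules [A e_v (x) e_w A],
    with [w] the end of a word with [m] letters [u] and [n] letters [d] that starts at [v]. *)
Definition eps (m n : nat) : E :=
  \sum_v tens (vid A v) (vid A (iter m (upt A) (iter n (downt A) v))).

Lemma eps_idem m n : eps m n * eps m n = eps m n.
Proof.
rewrite /eps mulr_suml; apply: eq_bigr => v _; rewrite mulr_sumr (bigD1 v) //=.
rewrite tensM !vidM !eqxx big1 ?addr0 // => w wv.
by rewrite tensM vidM eq_sym (negPf wv) tens0l.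
Qed.

Lemma eps_ul m n : eps m.+1 n * tensl u = tensl u * eps m n.
Proof.
rewrite /eps mulr_suml mulr_sumr [RHS](reindex_inj (@perm_inj _ (upt A))) /=.
apply: eq_bigr => v _; rewrite mulr_tensl vid_up tensM mulr1.
rewrite (iter_upt_downt A 1 n v) /=. 
by rewrite -iterSr.
Qed.

Lemma eps_ur m n : eps m.+1 n * tensr u = tensr u * eps m n.
Proof.
rewrite /eps mulr_suml mulr_sumr; apply: eq_bigr => v _.
by rewrite mulr_tensr tensM mul1r vid_up iterS.
Qed.

Lemma eps_dl m n : eps m n.+1 * tensl d = tensl d * eps m n.
Proof.
rewrite /eps mulr_suml mulr_sumr [RHS](reindex_inj (@perm_inj _ (downt A))) /=.
apply: eq_bigr => v _; rewrite mulr_tensl vid_down tensM mulr1.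
by rewrite -iterSr.
Qed.

Lemma eps_dr m n : eps m n.+1 * tensr d = tensr d * eps m n.
Proof.
rewrite /eps mulr_suml mulr_sumr; apply: eq_bigr => v _.
by rewrite mulr_tensr tensM mul1r vid_down iterS downt_iter.
Qed.

(** The reason why [nu] permutes the idempotents by the inverse of [nak_perm]: the dual of the last
    term becomes the first term. *)
Lemma th_eps : th (eps 2 2) = eps 0 0.
Proof.
rewrite /eps (big_morph th thD th0).
rewrite [RHS](reindex_inj (@perm_inj _ nak_perm^-1%g)) /=.
rewrite (reindex_inj (@perm_inj _ nak_perm^-1%g)) /=.
apply: eq_bigr => v _; rewrite thT nu_vid; congr (tens (vid A _) _).
by rewrite -nak_permE permKV.
Qed.

End Duality.

(** * Gradings and the resolution *)

Section Augmentation.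
Context (k : fieldType) (V : finType) (lam mu : k) (A : ore_algebra V lam mu).
Local Notation E := (env A).
Local Notation Ek := (env_kalgebra A).
Local Notation u := (up A).
Local Notation d := (down A).
Local Notation eps := (eps A).
Implicit Types (x y : E).

Definition aug (t : E) : A := reg_act t (1 : regbim A).

Lemma augT a b : aug (tens a b) = a * b.
Proof. by rewrite /aug reg_actT mulr1. Qed.
Lemma augD x y : aug (x + y) = aug x + aug y.
Proof. exact: reg_actDl. Qed.
Lemma aug0 : aug 0 = 0.
Proof. by rewrite -(tens0l 0) augT mul0r. Qed.
Lemma augM x y : aug (x * y) = reg_act x (aug y : regbim A).
Proof. by rewrite /aug reg_actA. Qed.
Lemma reg_act0 x : reg_act x (0 : regbim A) = 0.
Proof.
elim/env_ind: x => [a b|s t ihs iht]; first by rewrite reg_actT mulr0 mul0r.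
by rewrite reg_actDl ihs iht addr0.
Qed.

Lemma aug_m1 x y : aug (x * m1d A + y * m1u A) = 0.
Proof.
have e a : aug (tensl a - tensr a) = 0.
  by rewrite augD -tensNl !augT mulN1r mulr1 subrr.
by rewrite augD !augM !e !reg_act0 addr0.
Qed.

Lemma aug_eps x : aug (x * eps 0 0) = aug x.
Proof.
rewrite augM (_ : aug (eps 0 0) = 1) // /eps (big_morph aug augD aug0) -(vid_sum A).
by apply: eq_bigr => v _; rewrite augT vidM eqxx.
Qed.

(** An element of the kernel is a combination of differences [a (x) 1 - 1 (x) a], and a Leibniz rule
    reduces these to generators [a]. For an idempotent the difference is annihilated by [eps 0 0];
    for [u] and [d] it is an entry of the first differential. *)
Lemma exact0 x : x * eps 0 0 = x -> aug x = 0 ->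
  exists p q : E, x = p * m1d A + q * m1u A.
Proof.
pose I y := exists p q : E, y = p * m1d A + q * m1u A.
have IM y z : I z -> I (y * z).
  by case=> p [q ->]; exists (y * p), (y * q); rewrite mulrDr !mulrA.
have ID y z : I y -> I z -> I (y + z).
  move=> [p [q ->]] [p' [q' ->]]; exists (p + p'), (q + q').
  by rewrite !mulrDl addrACA.
have I0 : I 0 by exists 0, 0; rewrite !mul0r addr0.
have key a : I ((tensl a - tensr a) * eps 0 0).
  elim/ore_gen: a => [c a b Ia Ib|a b Ia Ib|v|||].
  - have -> : (tensl (kin A c * a + b) - tensr (kin A c * a + b)) * eps 0 0 =
      kin Ek c * ((tensl a - tensr a) * eps 0 0) + (tensl b - tensr b) * eps 0 0 :> E.
      rewrite /tensl /tensr tensDl tensDr tens_kinl tens_kinr.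
      nc_ring (env_kalgebra A).
    by apply: ID => //; apply: IM.
  - have -> : (tensl (a * b) - tensr (a * b)) * eps 0 0 =
      tensl a * ((tensl b - tensr b) * eps 0 0) +
      tensr b * ((tensl a - tensr a) * eps 0 0) :> E.
      have e : tensl a * tensr b = tensr b * tensl a :> E.
        by rewrite /tensl /tensr !tensM !mulr1 !mul1r.
      rewrite tensl_mul tensr_mul !mulrBl !mulrBr !mulrA e; nc_ring (env_kalgebra A).
    by apply: ID; apply: IM.
  - rewrite (_ : _ * _ = 0) // mulrBl /eps !mulr_sumr -sumrB big1 // => w _ /=.
    rewrite /tensl /tensr !tensM mul1r mulr1 !vidM eq_sym.
    by case: eqP => [->|_]; rewrite ?tens0l ?tens0r ?subrr.
  - exists 0, (eps 1 0); rewrite mul0r add0r mulrBr eps_ul eps_ur -mulrBl //.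
  - exists (eps 0 1), 0; rewrite mul0r addr0 mulrBr eps_dl eps_dr -mulrBl //.
  - by rewrite /tensl /tensr tens0l tens0r subrr mul0r.
move=> xe x0; suff : I ((x - tens 1 (aug x)) * eps 0 0).
  by rewrite x0 tens0r subr0 xe.
elim/env_ind: (x) => [a b|s t Is It].
  rewrite augT (_ : _ * _ = tensr b * ((tensl a - tensr a) * eps 0 0)); first exact: IM.
  by rewrite mulrA mulrBr -tensr_mul /tensl /tensr tensM !mul1r.
have -> : (s + t - tens 1 (aug (s + t))) * eps 0 0 =
  (s - tens 1 (aug s)) * eps 0 0 + (t - tens 1 (aug t)) * eps 0 0.
  by rewrite augD tensDr; nc_ring (env_kalgebra A).
exact: ID.
Qed.

End Augmentation.

(** * Gradings of the algebra and of its enveloping algebra, given by projections *)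

Section Projections.
Context (V : zmodType) (p : int -> V -> V).

(** The last clause is stated for every finite set of degrees beyond some support, so that the
    supports of summands or components can be merged. *)
Definition grading_projections : Prop :=
  [/\ forall i, {morph p i : x y / x + y},
      forall i j x, p i (p j x) = if i == j then p j x else 0 &
      forall x, exists s : seq int, forall s', uniq s' -> {subset s <= s'} ->
        x = \sum_(i <- s') p i x].

Lemma projections_grading :
  grading_projections -> is_grading (fun i x => p i x = x).
Proof.
case=> pD pp pS; have p0 i : p i 0 = 0.
  by apply: (addrI (p i 0)); rewrite -pD !addr0.
have pN i x : p i (- x) = - p i x.
  by apply/eqP; rewrite -addr_eq0 -pD addNr p0.
split=> [i|x|s c us cG cs i si]; first split=> /= [|x y ex ey].
- exact: p0.
- by rewrite pD pN ex ey.
- have [s hs] := pS x; exists (undup s), (p ^~ x); split=> [i /=|].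
    by rewrite pp eqxx.
  by apply: hs => [|i]; rewrite ?undup_uniq // mem_undup.
- have /(congr1 (p i)) := cs; rewrite p0 (big_morph (p i) (pD i) (p0 i)).
  rewrite (bigD1_seq i) //= big1 => [|j ji]; first by rewrite addr0 cG.
  by rewrite -(cG j) pp eq_sym (negPf ji).
Qed.

End Projections.

Section Gradings.
Context (k : fieldType) (V : finType) (lam mu : k) (A : ore_algebra V lam mu).
Local Notation E := (env A).
Local Notation Ek := (env_kalgebra A).
Local Notation u := (up A).
Local Notation d := (down A).
Local Notation z := (zelt lam (up A) (down A)).
Local Notation K := (kin Ek).

Definition oproj (m : int) : A -> A :=
  oliftA (fun b => if (pbw_len b)%:Z == m then mon A b else 0).

Lemma oproj_mon m b : oproj m (mon A b) = if (pbw_len b)%:Z == m then mon A b else 0.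
Proof. exact: oliftA_mon. Qed.
Lemma oprojD m x y : oproj m (x + y) = oproj m x + oproj m y.
Proof. exact: oliftAD. Qed.
Lemma oprojZ m c x : oproj m (kin A c * x) = kin A c * oproj m x.
Proof. exact: oliftAZ. Qed.
Lemma oproj0 m : oproj m 0 = 0.
Proof. exact: oliftA0. Qed.
Lemma oprojN m x : oproj m (- x) = - oproj m x.
Proof. exact: oliftAN. Qed.

Lemma oproj_projections : grading_projections oproj.
Proof.
split=> [i x y|i j|x]; first exact: oprojD.
  apply: olin_ext => [c x y|c x y|b].
  - by rewrite !(oprojD, oprojZ).
  - by case: eqP => _; rewrite ?mulr0 ?addr0 // oprojD oprojZ.
  - rewrite oproj_mon; case: (eqVneq _ j) => [<-|bj]; rewrite ?oproj_mon.
      by rewrite eq_sym.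
    by rewrite oproj0; case: ifP.
elim/ore_ind: x => [|c b x [s hs]].
  by exists [::] => s' _ _; rewrite big1 // => i _; rewrite oproj0.
exists ((pbw_len b)%:Z :: s) => s' us' ss'.
under eq_bigr do rewrite oprojD oprojZ oproj_mon.
rewrite big_split /= -hs // => [|i si]; last by rewrite ss' // inE si orbT.
rewrite (bigD1_seq (pbw_len b)%:Z) ?ss' ?inE ?eqxx //= big1 ?addr0 // => i ib.
by rewrite eq_sym (negPf ib) mulr0.
Qed.

Definition ore_gr (m : int) : set A := fun x => oproj m x = x.

Lemma ore_gr_grading : is_grading ore_gr.
Proof. exact: projections_grading oproj_projections. Qed.

Lemma oproj_up m x : oproj (m + 1) (x * u) = oproj m x * u.
Proof.
move: x; apply: olin_ext => [c x y|c x y|[v [[i j] l]]].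
- by rewrite mulrDl -mulrA oprojD oprojZ.
- by rewrite oprojD oprojZ mulrDl mulrA.
rewrite oproj_mon mon_up_pred oprojD oprojZ oproj_mon /=.
have -> : (pbw_len (v, (i.+1, j, l)))%:Z == m + 1 = ((pbw_len (v, (i, j, l)))%:Z == m).
  by rewrite /pbw_len /=; apply/eqP/eqP; lia.
case: l => [|l].
  by rewrite oproj0; case: eqP => _; rewrite ?mul0r ?mulr0 ?addr0 // mon_up_pred addr0.
rewrite oprojZ oproj_mon.
have -> : (pbw_len (v, (i, j.+1, l)))%:Z == m + 1 = ((pbw_len (v, (i, j, l.+1)))%:Z == m).
  by rewrite /pbw_len /=; apply/eqP/eqP; lia.
by case: eqP => _; rewrite ?mul0r ?mulr0 ?addr0 // mon_up_pred.
Qed.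

Lemma oproj_down m x : oproj (m + 1) (x * d) = oproj m x * d.
Proof.
move: x; apply: olin_ext => [c x y|c x y|[v [[i j] l]]].
- by rewrite mulrDl -mulrA oprojD oprojZ.
- by rewrite oprojD oprojZ mulrDl mulrA.
rewrite oproj_mon mon_down oproj_mon /=.
have -> : (pbw_len (v, (i, j, l.+1)))%:Z == m + 1 = ((pbw_len (v, (i, j, l)))%:Z == m).
  by rewrite /pbw_len /=; apply/eqP/eqP; lia.
by case: eqP => _; rewrite ?mul0r ?mon_down.
Qed.

Lemma oproj_vid m x v : oproj m (x * vid A v) = oproj m x * vid A v.
Proof.
move: x; apply: olin_ext => [c x y|c x y|b].
- by rewrite mulrDl -mulrA oprojD oprojZ.
- by rewrite oprojD oprojZ mulrDl mulrA.
rewrite mon_vid oproj_mon; case: (eqVneq (pbw_tgt A b) v) => [bv|bv];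
  rewrite ?oproj_mon ?oproj0; case: eqP => _; rewrite ?mul0r // mon_vid ?bv ?eqxx //.
by rewrite (negPf bv).
Qed.

Lemma oproj_vidl m x v : oproj m (vid A v * x) = vid A v * oproj m x.
Proof.
move: x; apply: olin_ext => [c x y|c x y|b].
- by rewrite mulrDr kinAC oprojD oprojZ.
- by rewrite oprojD oprojZ mulrDr kinAC.
rewrite vid_mon oproj_mon; case: (eqVneq v b.1) => [bv|bv];
  rewrite ?oproj_mon ?oproj0; case: eqP => _; rewrite ?mulr0 // vid_mon ?bv ?eqxx //.
by rewrite (negPf bv).
Qed.

Lemma oproj_zed m x : oproj (m + 2) (x * z) = oproj m x * z.
Proof.
have -> : m + 2 = m + 1 + 1 by rewrite -addrA.
rewrite /zelt !mulrBr !kinAC oprojD oprojN oprojZ !(mulrA x).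
by rewrite !(oproj_up, oproj_down) !mulrA.
Qed.

Lemma oproj_mulX m (t : nat) (a : A) :
  (forall m x, oproj (m + t%:Z) (x * a) = oproj m x * a) ->
  forall n x, oproj (m + (n * t)%:Z) (x * a ^+ n) = oproj m x * a ^+ n.
Proof.
move=> ha; elim=> [|n ih] x; first by rewrite addr0 !mulr1.
by rewrite exprSr !mulrA -ih -ha -addrA -PoszD -mulSnr.
Qed.

Lemma oproj_mulmon m x b : oproj (m + (pbw_len b)%:Z) (x * mon A b) = oproj m x * mon A b.
Proof.
case: b => v [[i j] l]; rewrite monE !mulrA.
have -> : m + (pbw_len (v, (i, j, l)))%:Z = m + (i * 1)%N%:Z + (j * 2)%N%:Z + (l * 1)%N%:Z.
  by rewrite /pbw_len /=; lia.
rewrite (oproj_mulX _ (t := 1) oproj_down) (oproj_mulX _ (t := 2) oproj_zed).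
by rewrite (oproj_mulX _ (t := 1) oproj_up) oproj_vid.
Qed.

Lemma ore_grM i j a b : ore_gr i a -> ore_gr j b -> ore_gr (i + j) (a * b).
Proof.
rewrite /ore_gr /= => ea <-.
move: b; apply: (@olin_ext _ _ _ _ _ (fun b => oproj (i + j) (a * oproj j b))
                                     (fun b => a * oproj j b)) => [c x y|c x y|b].
- by rewrite oprojD oprojZ mulrDr kinAC oprojD oprojZ.
- by rewrite oprojD oprojZ mulrDr kinAC.
- rewrite oproj_mon; case: eqP => [<-|_]; last by rewrite mulr0 oproj0.
  by rewrite oproj_mulmon ea.
Qed.

Lemma ore_gr0 i : ore_gr i 0.
Proof. by rewrite /ore_gr /= oproj0. Qed.
Lemma ore_grD i a b : ore_gr i a -> ore_gr i b -> ore_gr i (a + b).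
Proof. by rewrite /ore_gr /= oprojD => -> ->. Qed.
Lemma ore_grZ i c a : ore_gr i a -> ore_gr i (kin A c * a).
Proof. by rewrite /ore_gr /= oprojZ => ->. Qed.
Lemma ore_gr_mon b : ore_gr (pbw_len b)%:Z (mon A b).
Proof. by rewrite /ore_gr /= oproj_mon eqxx. Qed.
Lemma ore_gr_vid v : ore_gr 0 (vid A v).
Proof. by rewrite (vid_mon0 A); exact: ore_gr_mon. Qed.
Lemma ore_gr1 : ore_gr 0 1.
Proof.
rewrite -(vid_sum A); elim/big_rec: _ => [|v x _]; first exact: ore_gr0.
exact/ore_grD/ore_gr_vid.
Qed.
Lemma ore_gr_kin c : ore_gr 0 (kin A c).
Proof. by rewrite -[kin A c]mulr1; apply/ore_grZ/ore_gr1. Qed.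
Lemma ore_gr_up : ore_gr 1 u.
Proof. by have := oproj_up 0 1; rewrite ore_gr1 !mul1r. Qed.
Lemma ore_gr_down : ore_gr 1 d.
Proof. by have := oproj_down 0 1; rewrite ore_gr1 !mul1r. Qed.

Lemma ore_graded_algebra : graded_algebra ore_gr.
Proof. by split; [exact: ore_gr_grading|exact: ore_gr_kin|exact: ore_grM]. Qed.

Local Notation env_gr := (env_gr ore_gr).

Lemma env_grT i j a b : ore_gr i a -> ore_gr j b -> env_gr (i + j) (tens a b).
Proof. by move=> ha hb; apply: lspan_gen; exists i, j, a, b. Qed.

Lemma env_gr_lin m c x y : env_gr m x -> env_gr m y -> env_gr m (K c * x + y).
Proof. by rewrite -env_scaleE; exact: (lspan_is_submodule _).2. Qed.
Lemma env_gr0 m : env_gr m 0.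
Proof. exact: (lspan_is_submodule _).1. Qed.
Lemma env_grD m x y : env_gr m x -> env_gr m y -> env_gr m (x + y).
Proof. by rewrite -[x in x + y]mul1r -(rmorph1 K); exact: env_gr_lin. Qed.
Lemma env_grZ m c x : env_gr m x -> env_gr m (K c * x).
Proof. by rewrite -[K c * x]addr0 => hx; apply/env_gr_lin/env_gr0. Qed.
Lemma env_grN m x : env_gr m x -> env_gr m (- x).
Proof. by rewrite -mulN1r -(rmorph1 K) -rmorphN; exact: env_grZ. Qed.

Lemma env_gr_ind m (P : E -> Prop) :
  P 0 -> (forall c x y, P x -> P y -> P (K c * x + y)) ->
  (forall i j a b, ore_gr i a -> ore_gr j b -> i + j = m -> P (tens a b)) ->
  forall x, env_gr m x -> P x.
Proof.
move=> P0 PD PT x; apply: lspan_sub; first by split=> // c s t; rewrite env_scaleE; exact: PD.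
by move=> _ [i [j [a [b [ha hb ij ->]]]]]; exact: PT ij.
Qed.

Lemma env_grM i j x y : env_gr i x -> env_gr j y -> env_gr (i + j) (x * y).
Proof.
move=> hx hy; elim/(@env_gr_ind i): hx => [|c s t hs ht|i1 i2 a b ha hb <-].
- by rewrite mul0r; exact: env_gr0.
- by rewrite mulrDl -mulrA; exact: env_gr_lin.
elim/(@env_gr_ind j): hy => [|c s t hs ht|j1 j2 a' b' ha' hb' <-].
- by rewrite mulr0; exact: env_gr0.
- by rewrite mulrDr (@kinAC _ Ek); exact: env_gr_lin.
- by rewrite tensM addrACA (addrC i2); apply: env_grT; exact: ore_grM.
Qed.

End Gradings.

Section EnvGrading.
Context (k : fieldType) (V : finType) (lam mu : k) (A : ore_algebra V lam mu).
Local Notation E := (env A).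
Local Notation Ek := (env_kalgebra A).
Local Notation K := (kin Ek).
Local Notation env_gr := (env_gr (@ore_gr _ _ _ _ A)).

Definition tproj (i j : int) : E -> E :=
  env_lift (fun a b : A => tens (oproj i a) (oproj j b)).

Fact tproj_bil i j : bilinear2 (fun a b : A => tens (oproj i a) (oproj j b)).
Proof.
split=> [a a' b|a b b'|c a b|c a b].
- by rewrite oprojD tensDl.
- by rewrite oprojD tensDr.
- by rewrite oprojZ tensZl.
- by rewrite oprojZ tensZr.
Qed.

Lemma tprojT i j a b : tproj i j (tens a b) = tens (oproj i a) (oproj j b).
Proof. exact: env_lift_tens (tproj_bil i j) _ _. Qed.
Lemma tprojD i j x y : tproj i j (x + y) = tproj i j x + tproj i j y.
Proof. exact: env_liftD (tproj_bil i j) _ _. Qed.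
Lemma tprojZ i j c x : tproj i j (K c * x) = K c * tproj i j x.
Proof. by rewrite -!env_scaleE; exact: env_liftZ (tproj_bil i j) _ _. Qed.

(** The algebra lives in nonnegative degrees, so only finitely many bidegrees contribute to a given
    total degree, and none to a negative one. *)
Definition eproj (m : int) (x : E) : E :=
  if m is Posz n then \sum_(i < n.+1) tproj i (n - i)%N x else 0.

Lemma eprojD m x y : eproj m (x + y) = eproj m x + eproj m y.
Proof.
case: m => n /=; last by rewrite addr0.
by rewrite -big_split; apply: eq_bigr => i _; rewrite tprojD.
Qed.

Lemma eprojZ m c x : eproj m (K c * x) = K c * eproj m x.
Proof.
case: m => n /=; last by rewrite mulr0.
by rewrite mulr_sumr; apply: eq_bigr => i _; rewrite tprojZ.
Qed.

Lemma eproj0 m : eproj m 0 = 0.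
Proof. by have := eprojZ m 0 0; rewrite rmorph0 !mul0r. Qed.

Lemma eproj_mon m b b' : eproj m (tens (mon A b) (mon A b')) =
  if (pbw_len b + pbw_len b')%N%:Z == m then tens (mon A b) (mon A b') else 0.
Proof.
case: m => n //=.
under eq_bigr do rewrite tprojT !oproj_mon !eqz_nat.
case: (ltnP n (pbw_len b)) => bn.
  rewrite big1 => [|[i ilt] _ /=]; first by case: eqP => // -[bb]; lia.
  by case: eqP => [bi|_]; [lia|rewrite tens0l].
have bn' : (pbw_len b < n.+1)%N by [].
rewrite (bigD1 (Ordinal bn')) //= eqxx big1 ?addr0 => [|i ib]; last first.
  by case: eqP => [bi|_]; [move: ib; rewrite -val_eqE /= -bi eqxx|rewrite tens0l].
rewrite eqz_nat -(eqn_add2l (pbw_len b)) subnKC //.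
by case: eqP; rewrite ?tens0r.
Qed.

Lemma envkk_ind (P : E -> Prop) : P 0 ->
  (forall c b b' s, P s -> P (K c * tens (mon A b) (mon A b') + s)) -> forall t, P t.
Proof.
move=> P0 PS; elim/envk_ind=> // b a s Ps.
elim/ore_ind: a => [|c b' a ih]; first by rewrite tens0r add0r.
by rewrite tensDr tens_kinr -addrA; exact: PS.
Qed.

Lemma eproj_projections : grading_projections eproj.
Proof.
split=> [i x y|i j x|x]; first exact: eprojD.
  elim/envkk_ind: x => [|c b b' s ih].
    by rewrite !eproj0; case: ifP.
  rewrite !(eprojD, eprojZ) ih eproj_mon; case: (eqVneq _ j) => [<-|bj].
    by rewrite eproj_mon eq_sym; case: eqP => _; rewrite ?mulr0 ?addr0.
  by rewrite eproj0 mulr0 !add0r.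
elim/envkk_ind: x => [|c b b' x [s hs]].
  by exists [::] => s' _ _; rewrite big1 // => i _; rewrite eproj0.
exists ((pbw_len b + pbw_len b')%N%:Z :: s) => s' us' ss'.
under eq_bigr do rewrite eprojD eprojZ eproj_mon.
rewrite big_split /= -hs // => [|i si]; last by rewrite ss' // inE si orbT.
rewrite (bigD1_seq (pbw_len b + pbw_len b')%N%:Z) ?ss' ?inE ?eqxx //=.
by rewrite big1 ?addr0 // => i ib; rewrite eq_sym (negPf ib) mulr0.
Qed.

Lemma env_gr_eproj m x : env_gr m (eproj m x).
Proof.
elim/envkk_ind: x => [|c b b' x ih]; first by rewrite eproj0; exact: env_gr0.
rewrite eprojD eprojZ; apply: env_gr_lin => //; rewrite eproj_mon.
case: eqP => [<-|_]; last exact: env_gr0.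
by rewrite PoszD; apply: env_grT; exact: ore_gr_mon.
Qed.

(** Homogeneity is defined through spanning tensors; as the image of a projection it passes to
    direct sums and to ideals generated by idempotents. *)
Lemma env_grP m x : env_gr m x <-> eproj m x = x.
Proof.
split=> [|<-]; last exact: env_gr_eproj.
apply: (@env_gr_ind k V lam mu A m (fun x => eproj m x = x)) => [|c s t hs ht|i j a b].
- exact: eproj0.
- by rewrite eprojD eprojZ hs ht.
rewrite /ore_gr => <- <- <-.
elim/ore_ind: a => [|c p a ih]; first by rewrite oproj0 tens0l eproj0.
rewrite oprojD oprojZ tensDl tens_kinl eprojD eprojZ ih; congr (_ * _ + _).
rewrite oproj_mon; case: eqP => [<-{ih}|_]; last by rewrite tens0l eproj0.
elim/ore_ind: b => [|c' p' b ih]; first by rewrite oproj0 tens0r eproj0.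
rewrite oprojD oprojZ tensDr tens_kinr eprojD eprojZ ih; congr (_ * _ + _).
rewrite oproj_mon; case: eqP => [<-|_]; last by rewrite tens0r eproj0.
by rewrite eproj_mon PoszD eqxx.
Qed.

Lemma eproj_vid m v w x :
  eproj m (x * tens (vid A v) (vid A w)) = eproj m x * tens (vid A v) (vid A w).
Proof.
case: m => n /=; last by rewrite mul0r.
rewrite mulr_suml; apply: eq_bigr => i _.
elim/env_ind: x => [a b|x y ihx ihy]; last by rewrite mulrDl !tprojD ihx ihy mulrDl.
by rewrite tensM !tprojT oproj_vid oproj_vidl tensM.
Qed.

Lemma eproj_eps m i j x : eproj m (x * eps A i j) = eproj m x * eps A i j.
Proof.
rewrite /eps !mulr_sumr (big_morph _ (eprojD m) (eproj0 m)).
by apply: eq_bigr => v _; rewrite eproj_vid.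
Qed.

End EnvGrading.

(** * Projective modules cut out by two idempotents, and maps between them given by matrices *)

Section ProjectivePairs.
Context (R : pzRingType).

Definition pp_pred (e : R * R) : {pred (R^o * R^o)} :=
  [pred x | (x.1 * e.1 == x.1 :> R) && (x.2 * e.2 == x.2 :> R)].

Fact pp_submod e : submod_closed (pp_pred e).
Proof.
split; first by rewrite inE /= !mul0r !eqxx.
move=> c x y; rewrite !inE => /andP[/eqP x1 /eqP x2] /andP[/eqP y1 /eqP y2] /=.
by rewrite !mulrDl -!mulrA x1 x2 y1 y2 !eqxx.
Qed.
HB.instance Definition _ e :=
  GRing.isSubmodClosed.Build R (R^o * R^o)%type (pp_pred e) (pp_submod e).

(* The left module [R e.1 + R e.2], for idempotents [e.1] and [e.2]. *)
Record pp (e : R * R) := PP { pp_val :> R^o * R^o; ppP : pp_val \in pp_pred e }.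
HB.instance Definition _ e := [isSub for @pp_val e].
HB.instance Definition _ e := [Choice of pp e by <:].
HB.instance Definition _ e := [SubChoice_isSubLmodule of pp e by <:].

Lemma pp1 e (x : pp e) : ((pp_val x).1 * e.1 : R) = (pp_val x).1.
Proof. by have := ppP x; rewrite inE => /andP[/eqP]. Qed.
Lemma pp2 e (x : pp e) : ((pp_val x).2 * e.2 : R) = (pp_val x).2.
Proof. by have := ppP x; rewrite inE => /andP[_ /eqP]. Qed.

Lemma pp_eq e (x y : pp e) :
  (pp_val x).1 = (pp_val y).1 -> (pp_val x).2 = (pp_val y).2 -> x = y.
Proof. by move=> e1 e2; apply: val_inj => /=; case: (pp_val x) (pp_val y) e1 e2 => ? ? [? ?] /= -> ->. Qed.

Section Proj.
Context (e : R * R) (e1 : e.1 * e.1 = e.1) (e2 : e.2 * e.2 = e.2).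

Fact pp_pr_subproof (x : R * R) : ((x.1 * e.1, x.2 * e.2) : R^o * R^o) \in pp_pred e.
Proof. by rewrite inE /= -!mulrA e1 e2 !eqxx. Qed.
Definition pp_pr (x : R * R) : pp e := PP (pp_pr_subproof x).

Lemma pp_gen (x : pp e) :
  x = (pp_val x).1 *: pp_pr (1, 0) + (pp_val x).2 *: pp_pr (0, 1).
Proof.
apply: pp_eq => /=.
  by rewrite mul1r mul0r scaler0 addr0 -[RHS]/((pp_val x).1 * e.1 : R) pp1.
by rewrite mul1r mul0r scaler0 add0r -[RHS]/((pp_val x).2 * e.2 : R) pp2.
Qed.

Lemma pp_fin_gen : fin_gen (pp e).
Proof.
exists [:: pp_pr (1, 0); pp_pr (0, 1)] => x; rewrite (pp_gen x).
apply: rpredD; apply: rpredZ; apply: lspan_gen; rewrite /= !inE eqxx ?orbT //.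
Qed.

(** The entries of an element express it through the two generators, by [pp_gen]; lifting the images
    of the generators and extending through the entries gives the lift. *)
Lemma pp_projective : projective (pp e).
Proof.
move=> M N g f gS.
have [m1 hm1] := gS (f (pp_pr (1, 0))); have [m2 hm2] := gS (f (pp_pr (0, 1))).
pose h (x : pp e) : M := (pp_val x).1 *: m1 + (pp_val x).2 *: m2.
have hl : linear h.
  move=> c x y; rewrite /h /= !scalerDl -!scalerA scalerDr !scalerA.
  by rewrite addrACA.
pose hL := GRing.isLinear.Build R (pp e) M _ h hl.
pose hlin : {linear pp e -> M} := HB.pack h hL.
exists hlin => x /=.
by rewrite /h linearD !linearZ /= hm1 hm2 -!linearZ -linearD -pp_gen.
Qed.

End Proj.

Section Mat.
Context (e f : R * R) (a b c d : R).
Hypotheses (ea : e.1 * a = a * f.1) (eb : e.1 * b = b * f.2)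
           (ec : e.2 * c = c * f.1) (ed : e.2 * d = d * f.2).

Fact pp_mx_subproof (x : pp e) :
  (((pp_val x).1 * a + (pp_val x).2 * c, (pp_val x).1 * b + (pp_val x).2 * d)
    : R^o * R^o) \in pp_pred f.
Proof.
rewrite inE /= !mulrDl -!mulrA -ea -eb -ec -ed !mulrA pp1 pp2.
by rewrite !eqxx.
Qed.

Definition pp_mx (x : pp e) : pp f := PP (pp_mx_subproof x).

Fact pp_mx_linear : linear pp_mx.
Proof.
move=> r x y; apply: pp_eq => /=.
  rewrite !mulrDl -!mulrA addrACA; congr (_ + _).
  by rewrite -[RHS]/(r * _) mulrDr.
rewrite !mulrDl -!mulrA addrACA; congr (_ + _).
by rewrite -[RHS]/(r * _) mulrDr.
Qed.
HB.instance Definition _ := GRing.isLinear.Build R (pp e) (pp f) _ pp_mx pp_mx_linear.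

End Mat.

End ProjectivePairs.

Section PairGrading.
Context (k : fieldType) (V : finType) (lam mu : k) (A : ore_algebra V lam mu).
Local Notation E := (env A).
Local Notation env_gr := (env_gr (@ore_gr _ _ _ _ A)).
Context (e : E * E) (s : int * int).
Hypotheses (he1 : forall m x, eproj m (x * e.1) = eproj m x * e.1)
           (he2 : forall m x, eproj m (x * e.2) = eproj m x * e.2).

(** The shifts are the degrees in which the two generators are placed. *)
Definition pp_gr (m : int) : set (pp e) :=
  fun x => env_gr (m - s.1) (pp_val x).1 /\ env_gr (m - s.2) (pp_val x).2.

Fact pp_proj_subproof m (x : pp e) :
  ((eproj (m - s.1) (pp_val x).1, eproj (m - s.2) (pp_val x).2) : E^o * E^o) \in pp_pred e.
Proof. by rewrite inE /= -he1 -he2 pp1 pp2 !eqxx. Qed.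

Definition pp_proj m (x : pp e) : pp e := PP (pp_proj_subproof m x).

Lemma pp_proj_projections : grading_projections pp_proj.
Proof.
have [_ pp_ pS] := @eproj_projections _ _ _ _ A.
split=> [i x y|i j x|x].
- by apply: pp_eq => /=; exact: eprojD.
- apply: pp_eq => /=; rewrite pp_ (can_eq (addrK _)); case: eqP => //=.
have [s1 h1] := pS (pp_val x).1; have [s2 h2] := pS (pp_val x).2.
exists ([seq i + s.1 | i <- s1] ++ [seq i + s.2 | i <- s2]) => r ur sr.
have shift (t : int) (s0 : seq int) (y : E) : (forall s', uniq s' -> {subset s0 <= s'} ->
    y = \sum_(i <- s') eproj i y) -> {subset [seq i + t | i <- s0] <= r} ->
    y = \sum_(i <- r) eproj (i - t) y.
  move=> hy tr; rewrite -(big_map (fun i => i - t) xpredT (fun i => eproj i y)).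
  apply: hy => [|i si]; first by rewrite map_inj_uniq //; exact: addIr.
  apply/mapP; exists (i + t); last by rewrite addrK.
  by apply: tr; apply: map_f.
apply: pp_eq.
  rewrite (big_morph (fun y : pp e => (pp_val y).1 : E) (id1 := 0) (op1 := +%R)) //=.
  by apply: shift h1 _ => i si; apply: sr; rewrite mem_cat si.
rewrite (big_morph (fun y : pp e => (pp_val y).2 : E) (id1 := 0) (op1 := +%R)) //=.
by apply: shift h2 _ => i si; apply: sr; rewrite mem_cat si orbT.
Qed.

Lemma pp_gr_grading : is_grading pp_gr.
Proof.
have -> : pp_gr = fun m x => pp_proj m x = x.
  apply/funext => m; apply/funext => x; apply/propext; rewrite /pp_gr !env_grP.
  split=> [[h1 h2]|h]; first by apply: pp_eq.
  by rewrite -{2}h -{4}h.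
exact: projections_grading pp_proj_projections.
Qed.

Lemma pp_gr_scale i j (r : E) (x : pp e) : env_gr i r -> pp_gr j x -> pp_gr (i + j) (r *: x).
Proof.
by move=> hr [h1 h2]; split; rewrite -addrA /=; apply: env_grM.
Qed.

Definition pp_grmod : grmod env_gr := GrMod pp_gr_grading pp_gr_scale.

End PairGrading.

(** * The graded resolution by projective bimodules *)

Section Resolution.
Context (k : fieldType) (V : finType) (lam mu : k) (A : ore_algebra V lam mu).
Local Notation E := (env A).
Local Notation env_gr := (env_gr (@ore_gr _ _ _ _ A)).
Local Notation eps := (eps A).

(* The components of the resolution in degree i are generated in the bidegrees
   of the vertices (0), the arrows d and u (1), the relations duu and ddu (2)
   and the overlap dduu (3). *)
Definition res_idem (i : nat) : E * E :=
  match i with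
  | 0 => (eps 0 0, 0) | 1 => (eps 0 1, eps 1 0) | 2 => (eps 2 1, eps 1 2)
  | 3 => (eps 2 2, 0) | _ => (0, 0)
  end.

(** Path lengths of the generators: the relations are cubic and the overlap [dduu] has length
    four. *)
Definition res_deg (i : nat) : int * int :=
  match i with
  | 0 => (0, 0) | 1 => (1, 1) | 2 => (3, 3) | _ => (4, 4)
  end.

Definition res_mx (i : nat) : (E * E) * (E * E) :=
  match i with
  | 0 => ((m1d A, 0), (m1u A, 0))
  | 1 => ((m2ad A, m2au A), (m2bd A, m2bu A))
  | 2 => ((m3a A, m3b A), (0, 0))
  | _ => ((0, 0), (0, 0))
  end.

Lemma res_idemP i :
  (res_idem i).1 * (res_idem i).1 = (res_idem i).1 /\
  (res_idem i).2 * (res_idem i).2 = (res_idem i).2.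
Proof. by case: i => [|[|[|[|i]]]] /=; rewrite ?eps_idem ?mul0r. Qed.

Lemma res_idem_eproj i :
  (forall m x, eproj m (x * (res_idem i).1) = eproj m x * (res_idem i).1) /\
  (forall m x, eproj m (x * (res_idem i).2) = eproj m x * (res_idem i).2).
Proof.
by case: i => [|[|[|[|i]]]] /=; split=> m x; rewrite ?eproj_eps // !mulr0 eproj0.
Qed.

Definition res_mod (i : nat) : grmod env_gr :=
  pp_grmod (res_deg i) (res_idem_eproj i).1 (res_idem_eproj i).2.

Lemma eps_tensl m n m' n' m'' n'' a b :
  eps m n * tensl a = tensl a * eps m' n' -> eps m' n' * tensl b = tensl b * eps m'' n'' ->
  eps m n * tensl (a * b) = tensl (a * b) * eps m'' n''.
Proof. by move=> e1 e2; rewrite tensl_mul mulrA e1 -!mulrA e2. Qed.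

Lemma eps_tensr m n m' n' m'' n'' a b :
  eps m n * tensr b = tensr b * eps m' n' -> eps m' n' * tensr a = tensr a * eps m'' n'' ->
  eps m n * tensr (a * b) = tensr (a * b) * eps m'' n''.
Proof. by move=> e1 e2; rewrite tensr_mul mulrA e1 -!mulrA e2. Qed.

Lemma eps_tens m n m' n' m'' n'' a b :
  eps m n * tensl a = tensl a * eps m' n' -> eps m' n' * tensr b = tensr b * eps m'' n'' ->
  eps m n * tens a b = tens a b * eps m'' n''.
Proof. by move=> e1 e2; rewrite tens_lr mulrA e1 -!mulrA e2. Qed.

Lemma commuteD (x y a b : E) : x * a = a * y -> x * b = b * y -> x * (a + b) = (a + b) * y.
Proof. by move=> ea eb; rewrite mulrDr mulrDl ea eb. Qed.
Lemma commuteN (x y a : E) : x * a = a * y -> x * - a = - a * y.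
Proof. by move=> ea; rewrite mulrN mulNr ea. Qed.
Lemma commuteK c (x y a : E) : x * a = a * y ->
  x * (kin (env_kalgebra A) c * a) = kin (env_kalgebra A) c * a * y.
Proof. by move=> ea; rewrite (@kinAC _ (env_kalgebra A)) ea mulrA. Qed.

Ltac eps_auto :=
  repeat first [apply: commuteD | apply: commuteN | apply: commuteK];
  first [ exact: eps_ul | exact: eps_ur | exact: eps_dl | exact: eps_dr
        | apply: eps_tens; [eps_step|eps_step]
        | apply: eps_tensl; [eps_step|eps_step]
        | apply: eps_tensr; [eps_step|eps_step] ]
with eps_step := first [exact: eps_ul | exact: eps_ur | exact: eps_dl | exact: eps_dr].

(** Every entry is homogeneous for the bigrading by the numbers of letters [u] and [d], so all of
    its terms intertwine the same two idempotents. *)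
Lemma res_mx_idem i :
  [/\ (res_idem i.+1).1 * (res_mx i).1.1 = (res_mx i).1.1 * (res_idem i).1,
      (res_idem i.+1).1 * (res_mx i).1.2 = (res_mx i).1.2 * (res_idem i).2,
      (res_idem i.+1).2 * (res_mx i).2.1 = (res_mx i).2.1 * (res_idem i).1 &
      (res_idem i.+1).2 * (res_mx i).2.2 = (res_mx i).2.2 * (res_idem i).2].
Proof.
case: i => [|[|[|i]]] /=; split; rewrite ?mulr0 ?mul0r //.
- rewrite /m1d; eps_auto.
- rewrite /m1u; eps_auto.
- rewrite /m2ad; eps_auto.
- rewrite /m2au; eps_auto.
- rewrite /m2bd; eps_auto.
- rewrite /m2bu; eps_auto.
- rewrite /m3a; eps_auto.
- rewrite /m3b; eps_auto.
Qed.

End Resolution.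

Section Resolution2.
Context (k : fieldType) (V : finType) (lam mu : k) (A : ore_algebra V lam mu).
Local Notation E := (env A).
Local Notation GA := (@ore_gr _ _ _ _ A).
Local Notation env_gr := (env_gr (@ore_gr _ _ _ _ A)).
Local Notation eps := (eps A).
Local Notation res_mx := (res_mx A).
Local Notation res_idem := (res_idem A).

Lemma ore_gr_mul2 a b : GA 1 a -> GA 1 b -> GA 2 (a * b).
Proof. exact: ore_grM. Qed.

Lemma env_gr_tens2 i j m (a b : A) :
  GA i a -> GA j b -> m = i + j -> env_gr m (tens a b).
Proof. by move=> ha hb ->; apply: env_grT. Qed.

Ltac gr_auto :=
  repeat first [apply: env_grD | apply: env_grN | apply: env_grZ];
  (eapply env_gr_tens2; [gr_step|gr_step|reflexivity])
with gr_step := first [ exact: ore_gr_up | exact: ore_gr_down | exact: ore_gr1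
  | apply: ore_gr_mul2; [gr_step|gr_step] ].

Lemma res_mx_gr i :
  [/\ env_gr ((res_deg i.+1).1 - (res_deg i).1) (res_mx i).1.1,
      env_gr ((res_deg i.+1).1 - (res_deg i).2) (res_mx i).1.2,
      env_gr ((res_deg i.+1).2 - (res_deg i).1) (res_mx i).2.1 &
      env_gr ((res_deg i.+1).2 - (res_deg i).2) (res_mx i).2.2].
Proof.
case: i => [|[|[|i]]] /=; split; try exact: env_gr0.
- by rewrite /m1d /tensl /tensr; gr_auto.
- by rewrite /m1u /tensl /tensr; gr_auto.
- by rewrite /m2ad; gr_auto.
- by rewrite /m2au; gr_auto.
- by rewrite /m2bd; gr_auto.
- by rewrite /m2bu; gr_auto.
- by rewrite /m3a /tensl /tensr; gr_auto.
- by rewrite /m3b /tensl /tensr; gr_auto.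
Qed.

Definition res_diff i : {linear pp (res_idem i.+1) -> pp (res_idem i)} :=
  let: And4 ea eb ec ed := res_mx_idem A i in pp_mx ea eb ec ed.

Lemma res_diff1 i x : (pp_val (res_diff i x)).1 =
  (pp_val x).1 * (res_mx i).1.1 + (pp_val x).2 * (res_mx i).2.1.
Proof. by rewrite /res_diff; case: res_mx_idem. Qed.

Lemma res_diff2 i x : (pp_val (res_diff i x)).2 =
  (pp_val x).1 * (res_mx i).1.2 + (pp_val x).2 * (res_mx i).2.2.
Proof. by rewrite /res_diff; case: res_mx_idem. Qed.

Definition res_pr i (x : E * E) : pp (res_idem i) :=
  pp_pr (res_idemP A i).1 (res_idemP A i).2 x.

(** Transfers exactness from arbitrary rows to the projective components: since the matrices
    intertwine the idempotents, a preimage may be projected into its component without changing its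
    image. *)
Lemma res_diff_pr i (x : pp (res_idem i)) (a b : E) :
  (pp_val x).1 = a * (res_mx i).1.1 + b * (res_mx i).2.1 ->
  (pp_val x).2 = a * (res_mx i).1.2 + b * (res_mx i).2.2 ->
  x = res_diff i (res_pr i.+1 (a, b)).
Proof.
move=> h1 h2; have [ea eb ec ed] := res_mx_idem A i.
apply: pp_eq; rewrite ?res_diff1 ?res_diff2 /=.
  by rewrite -!mulrA ea ec !mulrA -mulrDl -h1 pp1.
by rewrite -!mulrA eb ed !mulrA -mulrDl -h2 pp2.
Qed.

Definition res_augm (x : pp (res_idem 0)) : regbim A := aug (pp_val x).1.

Fact res_augm_linear : linear res_augm.
Proof. by move=> c x y; rewrite /res_augm /= augD augM. Qed.
HB.instance Definition _ := GRing.isLinear.Build E (pp (res_idem 0)) (regbim A) _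
  res_augm res_augm_linear.

Lemma res_val2_0 i (x : pp (res_idem i)) : (res_idem i).2 = 0 -> (pp_val x).2 = 0.
Proof. by move=> e; rewrite -pp2 e mulr0. Qed.

Lemma res_val1_0 i (x : pp (res_idem i)) : (res_idem i).1 = 0 -> (pp_val x).1 = 0.
Proof. by move=> e; rewrite -pp1 e mulr0. Qed.

Lemma res_high i (x : pp (res_idem i)) : (3 < i)%N -> x = 0.
Proof.
by case: i x => [|[|[|[|i]]]] // x _; apply: pp_eq => /=;
  [exact: (@res_val1_0 i.+4)|exact: (@res_val2_0 i.+4)].
Qed.

Lemma res_exact_aug (x : pp (res_idem 0)) : res_augm x = 0 <-> exists y, x = res_diff 0 y.
Proof.
split=> [h|[y ->]]; last by rewrite /res_augm res_diff1 /=; exact: aug_m1.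
have [p [q e]] := exact0 (pp1 x) h; exists (res_pr 1 (p, q)); apply: res_diff_pr => //=.
by rewrite !mulr0 addr0; exact: (@res_val2_0 0).
Qed.

Lemma res_mx_mul i (M := res_mx i.+1) (N := res_mx i) :
  [/\ M.1.1 * N.1.1 + M.1.2 * N.2.1 = 0, M.1.1 * N.1.2 + M.1.2 * N.2.2 = 0,
      M.2.1 * N.1.1 + M.2.2 * N.2.1 = 0 & M.2.1 * N.1.2 + M.2.2 * N.2.2 = 0].
Proof.
rewrite /M /N {M N}; case: i => [|[|i]] /=; split; rewrite ?mulr0 ?mul0r ?addr0 //.
- exact: m2_m1_a.
- exact: m2_m1_b.
- exact: m3_m2_d.
- exact: m3_m2_u.
Qed.

Lemma res_diff_diff i x : res_diff i (res_diff i.+1 x) = 0.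
Proof.
have mx_assoc (y z a b c d a' b' : E) : a * a' + b * b' = 0 -> c * a' + d * b' = 0 ->
    (y * a + z * c) * a' + (y * b + z * d) * b' = 0.
  by move=> e1 e2; rewrite !mulrDl -!mulrA addrACA -!mulrDr e1 e2 !mulr0 addr0.
have [e1 e2 e3 e4] := res_mx_mul i.
by apply: pp_eq; rewrite ?(res_diff1, res_diff2) /=; apply: mx_assoc.
Qed.

Lemma res_exact_diff i (x : pp (res_idem i.+1)) :
  res_diff i x = 0 <-> exists y, x = res_diff i.+1 y.
Proof.
split=> [h|[y ->]]; last exact: res_diff_diff.
have := congr1 (fun y => (pp_val y).1) h; have := congr1 (fun y => (pp_val y).2) h.
rewrite res_diff1 res_diff2 /=; case: i x {h} => [|[|[|i]]] x /=.
- move=> _ /exact1[p [q [e1 e2]]].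
  by exists (res_pr 2 (p, q)); exact: (@res_diff_pr 1 x p q).
- move=> /exact2[c [e1 e2]] _.
  by exists (res_pr 3 (c, 0)); apply: (@res_diff_pr 2 x c 0); rewrite /= mul0r addr0.
- rewrite (@res_val2_0 3 x erefl) !mul0r !addr0 => _; move=> /exact3 x0; exists 0.
  rewrite raddf0; apply: pp_eq => //=; exact: (@res_val2_0 3).
- by move=> _ _; exists 0; rewrite raddf0; exact: (@res_high i.+4 x).
Qed.

Lemma res_augm_surj (y : regbim A) : exists x, res_augm x = y.
Proof.
exists (res_pr 0 (tens (y : A) 1, 0)).
by rewrite /res_augm /= aug_eps augT mulr1.
Qed.

Lemma res_diff_gr i m (x : pp (res_idem i.+1)) :
  gr (g := res_mod A i.+1) m x -> gr (g := res_mod A i) m (res_diff i x).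
Proof.
have [g1 g2 g3 g4] := res_mx_gr i; case=> h1 h2.
by split; rewrite ?(res_diff1, res_diff2);
  apply: env_grD; [have := env_grM h1 g1|have := env_grM h2 g3|
                   have := env_grM h1 g2|have := env_grM h2 g4];
  rewrite addrA subrK.
Qed.

Lemma augZ c (x : E) : aug (kin (env_kalgebra A) c * x) = kin A c * aug x.
Proof. by rewrite augM /= env_inE reg_actT mulr1. Qed.

Lemma aug_gr m (x : E) : env_gr m x -> GA m (aug x).
Proof.
apply: (@env_gr_ind k V lam mu A m (fun x => GA m (aug x))) => [|c y z hy hz|i j a b ha hb <-].
- by rewrite aug0; exact: ore_gr0.
- by rewrite augD augZ; apply/ore_grD/hz/ore_grZ.
- by rewrite augT; apply: ore_grM.
Qed.

Lemma res_gr_aug m (x : pp (res_idem 0)) :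
  gr (g := res_mod A 0) m x -> GA m (res_augm x).
Proof. by case=> h _; have := aug_gr h; rewrite subr0. Qed.

Lemma res_mod_projective i : projective (res_mod A i).
Proof. by have [e1 e2] := res_idemP A i; exact: pp_projective e1 e2. Qed.

Lemma res_mod_fin_gen i : fin_gen (res_mod A i).
Proof. by have [e1 e2] := res_idemP A i; exact: pp_fin_gen e1 e2. Qed.

Lemma res_mod_finite :
  exists N, forall i, (N < i)%N -> forall x : res_mod A i, x = 0.
Proof. by exists 3 => i i3 x; exact: res_high. Qed.

Definition ore_resolution : fin_bim_resolution GA :=
  @Build_fin_proj_resolution E env_gr (regbim A) GA (res_mod A) res_diff res_augm
    res_mod_projective res_mod_fin_gen res_mod_finite res_diff_gr res_gr_aug
    res_augm_surj res_exact_aug res_exact_diff.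

End Resolution2.

(** * The Calabi-Yau property *)

Section TwistedModule.
Context (k : fieldType) (A : kalgebra k).

Record twisted_end := TwistedEnd {
  tw_fun :> A -> A;
  tw_D : forall a b, tw_fun (a + b) = tw_fun a + tw_fun b;
  tw_M : forall a b, tw_fun (a * b) = tw_fun a * tw_fun b;
  tw_Z : forall c a, tw_fun (kin A c * a) = kin A c * tw_fun a;
  tw_1 : tw_fun 1 = 1
}.
Context (f : twisted_end).

(** The argument labels the type, so that bimodule structures for different twists can coexist on
    the same carrier. *)
Definition twbim of twisted_end : Type := kring A.
HB.instance Definition _ := GRing.Zmodule.on (twbim f).

Definition tw_act (t : env A) (x : twbim f) : twbim f :=
  env_lift (fun a b => (f a * (x : A) * b : A) : kmod A) t.

Fact tw_act_bil (x : A) : bilinear2 (fun a b => (f a * x * b : A) : kmod A).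
Proof.
split=> [a a' b|a b b'|c a b|c a b].
- by rewrite tw_D !mulrDl.
- by rewrite mulrDr.
- by rewrite tw_Z -!mulrA.
- by rewrite kinAC.
Qed.

Lemma tw_actT a b (x : A) : tw_act (tens a b) x = f a * x * b.
Proof. by rewrite /tw_act env_lift_tens //; exact: tw_act_bil. Qed.
Fact tw_actDl x : {morph tw_act^~ x : s t / s + t}.
Proof. by move=> s t; exact: (env_liftD (tw_act_bil x) s t). Qed.
Fact tw_actDr : right_distributive tw_act +%R.
Proof.
move=> t x y; elim/env_ind: t => [a b|s t ihs iht]; last first.
  by rewrite !tw_actDl ihs iht addrACA.
by rewrite !tw_actT mulrDr mulrDl.
Qed.
Fact tw_actA s t x : tw_act s (tw_act t x) = tw_act (s * t) x.
Proof.
elim/env_ind: s => [a b|s s' ih ih']; last first.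
  by rewrite mulrDl !tw_actDl ih ih'.
elim/env_ind: t => [c d|t t' ih ih'].
  by rewrite tensM !tw_actT tw_M !mulrA.
by rewrite mulrDr !tw_actDl tw_actDr ih ih'.
Qed.
Fact tw_act1 : left_id 1 tw_act.
Proof. by move=> x; rewrite -tens11 tw_actT tw_1 mul1r mulr1. Qed.
HB.instance Definition _ := GRing.Zmodule_isLmodule.Build (env A) (twbim f)
  tw_actA tw_act1 tw_actDr tw_actDl.

Lemma tw_scaleT a b (x : twbim f) : tens a b *: x = f a * (x : A) * b :> A.
Proof. exact: tw_actT. Qed.

End TwistedModule.

Section TwistedTensor.
Context (k : fieldType) (A : kalgebra k) (f g : twisted_end A).
Hypothesis gf : cancel f g.

Definition tw_pair (x : twbim f) (y : twbim g) : regbim A := g (x : A) * (y : A).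

(** A balanced map satisfies [F x y = F 1 (g x * y)], because [x] can be moved across as a right
    multiplier of 1. It is therefore determined by its restriction to the second factor. *)
Lemma tw_tensor_product : is_tensor_product tw_pair.
Proof.
have lE (a : A) (y : twbim g) : lact a y = g a * (y : A) :> A.
  by rewrite /lact tw_scaleT mulr1.
have rE (x : twbim f) (a : A) : ract x a = (x : A) * a :> A.
  by rewrite /ract tw_scaleT tw_1 mul1r.
split.
- split=> [x x' y|x y y'|x a y]; rewrite /tw_pair.
  + by rewrite tw_D mulrDl.
  + by rewrite mulrDr.
  + by rewrite rE lE tw_M mulrA.
- move=> a x y; rewrite /tw_pair /lact tw_scaleT mulr1 tw_M gf.
  by rewrite -[RHS]/(reg_act (tens a 1) (_ : regbim A)) reg_actT mulr1 mulrA.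
- move=> x y a; rewrite /tw_pair /ract tw_scaleT tw_1 mul1r.
  by rewrite -[RHS]/(reg_act (tens 1 a) (_ : regbim A)) reg_actT mul1r mulrA.
move=> W F [FD1 FD2 Fb]; exists (fun z : regbim A => F (1 : A) (z : A)); split.
  split=> [y y'|x y]; first exact: FD2.
  rewrite /tw_pair -[X in F _ X](lE (x : A) y) -Fb; congr (F _ _).
  by rewrite rE mul1r.
move=> h [hD hT]; apply/funext => z.
by rewrite -(hT (1 : A) (z : A)) /tw_pair tw_1 mul1r.
Qed.

End TwistedTensor.

Section GradingShift.
Context (V : zmodType) (G : int -> set V) (t : int).

Lemma grading_shift : is_grading G -> is_grading (fun m => G (m + t)).
Proof.
case=> G0 GS GU; split=> [i|x|s c us cG cs i si]; first exact: G0.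
- have [s [c [cG ->]]] := GS x.
  exists [seq i - t | i <- s], (fun i => c (i + t)); split=> [i|]; first exact: cG.
  by rewrite big_map; apply: eq_bigr => i _; rewrite subrK.
- have := GU [seq i + t | i <- s] (fun i => c (i - t)); rewrite big_map.
  have -> : \sum_(j <- s) c (j + t - t) = 0.
    by under eq_bigr do rewrite addrK.
  move=> /(_ _ _ erefl (i + t)); rewrite addrK; apply.
  + by rewrite map_inj_uniq //; exact: addIr.
  + by move=> j; have := cG (j - t); rewrite subrK.
  + by apply: map_f.
Qed.

End GradingShift.

(** * Ext groups from columns over the enveloping algebra *)

Section ExtGroups.
Context (k : fieldType) (V : finType) (lam mu : k) (A : ore_algebra V lam mu).
Hypothesis q_neq0 : lam * mu != 0.
Local Notation E := (env A).
Local Notation GA := (@ore_gr _ _ _ _ A).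
Local Notation env_gr := (env_gr (@ore_gr _ _ _ _ A)).
Local Notation eps := (eps A).
Local Notation res_mx := (res_mx A).
Local Notation P := (ore_resolution A).
Local Notation cocycles i := (cocycle (@res_d _ _ (regbim A) _ P) i).
Local Notation res_pr := (@res_pr _ _ _ _ A).
Local Notation th := (@th _ _ _ _ A).

(** A homomorphism into the enveloping algebra is the column of its values at the two generators.
    The matrices of the resolution act on such columns from the left. *)
Definition gen1 i (f : cocycles i) : E := cocycle_fun f (res_pr i (1, 0)).
Definition gen2 i (f : cocycles i) : E := cocycle_fun f (res_pr i (0, 1)).

Lemma cocycle_lin i (f : cocycles i) c (x y : P i) :
  cocycle_fun f (c *: x + y) = (c : E) * cocycle_fun f x + cocycle_fun f y :> E.
Proof. by have /asboolP[h _] := cocycleP f; exact: h. Qed.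

Lemma cocycle0 i (f : cocycles i) : cocycle_fun f 0 = 0 :> E.
Proof. by have := cocycle_lin f (-1) 0 0; rewrite scaler0 addr0 mulN1r addNr. Qed.

Lemma cocycleZ i (f : cocycles i) c (x : P i) :
  cocycle_fun f (c *: x) = (c : E) * cocycle_fun f x :> E.
Proof. by have := cocycle_lin f c x 0; rewrite cocycle0 !addr0. Qed.

Lemma cocycle_gen i (f : cocycles i) (x : pp (res_idem A i)) :
  cocycle_fun f x = (pp_val x).1 * gen1 f + (pp_val x).2 * gen2 f :> E.
Proof.
rewrite {1}(pp_gen (res_idemP A i).1 (res_idemP A i).2 x) cocycle_lin cocycleZ.
by [].
Qed.

Lemma gen1_idem i (f : cocycles i) : (res_idem A i).1 * gen1 f = gen1 f.
Proof.
rewrite -cocycleZ; congr (cocycle_fun f _); apply: pp_eq => /=.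
  by rewrite -[LHS]/(_ * _ : E) !mul1r (res_idemP A i).1.
by rewrite mul0r scaler0.
Qed.

Lemma gen2_idem i (f : cocycles i) : (res_idem A i).2 * gen2 f = gen2 f.
Proof.
rewrite -cocycleZ; congr (cocycle_fun f _); apply: pp_eq => /=.
  by rewrite mul0r scaler0.
by rewrite -[LHS]/(_ * _ : E) !mul1r (res_idemP A i).2.
Qed.

Lemma cocycle_mx i (f : cocycles i) :
  (res_mx i).1.1 * gen1 f + (res_mx i).1.2 * gen2 f = 0 /\
  (res_mx i).2.1 * gen1 f + (res_mx i).2.2 * gen2 f = 0.
Proof.
have fd x : cocycle_fun f (res_diff A i x) = 0 :> E.
  by have /asboolP[_ h] := cocycleP f; exact: h.
have [ea eb ec ed] := res_mx_idem A i.
split.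
  have := fd (res_pr i.+1 (1, 0)); rewrite cocycle_gen res_diff1 res_diff2 /=.
  by rewrite !mul1r !mul0r !addr0 ea eb -!mulrA gen1_idem gen2_idem.
have := fd (res_pr i.+1 (0, 1)); rewrite cocycle_gen res_diff1 res_diff2 /=.
by rewrite !mul1r !mul0r !add0r ec ed -!mulrA gen1_idem gen2_idem.
Qed.

Definition colfun i (a b : E) (x : pp (res_idem A i)) : E^o :=
  (pp_val x).1 * a + (pp_val x).2 * b.

Fact colfun_linear i a b : linear (@colfun i a b).
Proof.
move=> c x y; rewrite /colfun /= !mulrDl addrACA; congr (_ + _).
by rewrite -[RHS]/(c * (_ + _) : E) mulrDr !mulrA.
Qed.
HB.instance Definition _ i a b :=
  GRing.isLinear.Build E (pp (res_idem A i)) E^o _ (@colfun i a b) (colfun_linear a b).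

Lemma coboundary_mx j (f : cocycles j.+1) (a b : E) :
  gen1 f = (res_mx j).1.1 * a + (res_mx j).1.2 * b ->
  gen2 f = (res_mx j).2.1 * a + (res_mx j).2.2 * b -> coboundary f.
Proof.
move=> e1 e2; exists (@colfun j a b) => x; rewrite cocycle_gen e1 e2.
rewrite /= /colfun res_diff1 res_diff2 !mulrDl !mulrDr !mulrA.
by rewrite addrACA -!addrA; congr (_ + _); rewrite addrCA.
Qed.

Lemma coboundaryP j (f : cocycles j.+1) : coboundary f ->
  exists a b : E, gen1 f = (res_mx j).1.1 * a + (res_mx j).1.2 * b /\
                  gen2 f = (res_mx j).2.1 * a + (res_mx j).2.2 * b.
Proof.
case=> g fg; pose a : E := g (res_pr j (1, 0)); pose b : E := g (res_pr j (0, 1)).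
have gE (x : pp (res_idem A j)) : g x = (pp_val x).1 * a + (pp_val x).2 * b :> E.
  by rewrite {1}(pp_gen (res_idemP A j).1 (res_idemP A j).2 x) linearP linearZ.
have ea : (res_idem A j).1 * a = a.
  rewrite /a -[LHS](linearZ_LR g); congr (g _); apply: pp_eq => /=.
    by rewrite -[LHS]/(_ * _ : E) !mul1r (res_idemP A j).1.
  by rewrite mul0r scaler0.
have eb : (res_idem A j).2 * b = b.
  rewrite /b -[LHS](linearZ_LR g); congr (g _); apply: pp_eq => /=.
    by rewrite mul0r scaler0.
  by rewrite -[LHS]/(_ * _ : E) !mul1r (res_idemP A j).2.
have [ma mb mc md] := res_mx_idem A j.
exists a, b; rewrite /gen1 /gen2 !fg; split; rewrite gE res_diff1 res_diff2 /=.
  by rewrite !mul1r !mul0r !addr0 ma mb -!mulrA ea eb.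
by rewrite !mul1r !mul0r !add0r mc md -!mulrA ea eb.
Qed.

(** In degrees 0, 1 and 2 this is exactness of the dual complex, transported by [th]; beyond degree
    3 the modules of the resolution vanish. *)
Lemma ext_vanish i : i <> 3 -> forall x : ext P i, x = 0.
Proof.
move=> i3; elim/lquot_ind => f; rewrite -(raddf0 (lquot_pi _)).
apply/lquot_piP; rewrite subr0; apply: lspan_gen; move: f.
have [m1 m2] := (m2_m1_a A, m2_m1_b A).
case: i i3 => [|[|[|[|i]]]] // _ f; have [e1 e2] := cocycle_mx f.
- have g1 : gen1 f = 0 by apply: (dual_exact0 q_neq0); move: e1; rewrite /= mul0r addr0.
  have g2 : gen2 f = 0 by rewrite -gen2_idem /= mul0r.
  apply: val_inj; apply/funext => x /=.
  by rewrite (cocycle_gen f x) g1 g2 !mulr0 addr0.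
- have [c [ea eb]] := dual_exact1 q_neq0 e2.
  by apply: (@coboundary_mx 0 f c 0); rewrite /= mulr0 addr0.
- have [a [b [ea eb]]] := dual_exact2 q_neq0 e1.
  exact: (@coboundary_mx 1 f a b).
- have g0 y : cocycle_fun f y = 0 by rewrite (@res_high _ _ _ _ A i.+4 y) // cocycle0.
  by apply: (@coboundary_mx i.+3 f 0 0); rewrite /gen1 /gen2 g0 !mulr0 addr0.
Qed.

Definition nu_tw : twisted_end A := TwistedEnd
  (@twistD _ _ _ _ A _ _ _) (@nuM _ _ _ _ A) (@twistZ _ _ _ _ A _ _ _) (nu1 A).

End ExtGroups.

Section CalabiYau.
Context (k : fieldType) (V : finType) (lam mu : k) (A : ore_algebra V lam mu).
Hypothesis q_neq0 : lam * mu != 0.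
Local Notation E := (env A).
Local Notation GA := (@ore_gr _ _ _ _ A).
Local Notation env_gr := (env_gr (@ore_gr _ _ _ _ A)).
Local Notation eps := (eps A).
Local Notation P := (ore_resolution A).
Local Notation cocycles i := (cocycle (@res_d _ _ (regbim A) _ P) i).
Local Notation res_pr := (@res_pr _ _ _ _ A).
Local Notation th := (@th _ _ _ _ A).
Local Notation nu := (@nu _ _ _ _ A).
Local Notation nuV := (@nuV _ _ _ _ A).

Lemma nuV1 : nuV 1 = 1.
Proof. exact: twist1. Qed.

Definition nuV_tw : twisted_end A := TwistedEnd
  (@twistD _ _ _ _ A _ _ _) (@nuVM _ _ _ _ A) (@twistZ _ _ _ _ A _ _ _) nuV1.

Lemma twist_gr s t sigma m (x : A) : GA m x -> GA m (twist s t sigma x).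
Proof.
move=> hx; rewrite -hx /ore_gr /=; move: x {hx}.
apply: (@olin_ext _ _ _ _ _ (fun x => oproj m (twist s t sigma (oproj m x)))
  (fun x => twist s t sigma (oproj m x))) => [c x y|c x y|[v [[i j] l]]].
- by rewrite !(oprojD, oprojZ, twistD, twistZ).
- by rewrite !(oprojD, oprojZ, twistD, twistZ).
rewrite oproj_mon; case: eqP => [e|_]; last by rewrite twist0 oproj0.
by rewrite twist_mon oprojZ oproj_mon -e /pbw_len /= eqxx.
Qed.

Section TwGrmod.
Context (f : twisted_end A) (fgr : forall m x, GA m x -> GA m (f x)) (t : int).

Definition tw_gr (m : int) : set (twbim f) := fun x => GA (m + t) (x : A).

Fact tw_gr_grading : is_grading tw_gr.
Proof. exact: grading_shift (ore_gr_grading A). Qed.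

Fact tw_gr_scale i j (r : E) (x : twbim f) :
  env_gr i r -> tw_gr j x -> tw_gr (i + j) (r *: x).
Proof.
move=> hr hx; move: r hr.
apply: (@env_gr_ind k V lam mu A i (fun r => tw_gr (i + j) (r *: x))) => [|c y z hy hz|i1 i2 a b ha hb <-].
- by rewrite scale0r; exact: ore_gr0.
- rewrite scalerDl -scalerA /= env_inE /tw_gr; apply: ore_grD hz.
  rewrite tw_scaleT mulr1 -[kin A c]mulr1 tw_Z tw_1 mulr1; exact: ore_grZ.
- rewrite /tw_gr tw_scaleT.
  have -> : i1 + i2 + j + t = i1 + (j + t) + i2 by rewrite -!addrA (addrC i2) !addrA.
  by apply: ore_grM => //; apply: ore_grM => //; exact: fgr.
Qed.

Definition tw_grmod : grmod env_gr := GrMod tw_gr_grading tw_gr_scale.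

End TwGrmod.

(** The shift by 4 is the degree of the generator of the last term: a class of degree [m] takes
    there a value of degree [m + 4]. *)
Definition nak_bim : grmod env_gr :=
  @tw_grmod (nu_tw A) (fun m => @twist_gr _ _ _ m) 4.
Definition nakV_bim : grmod env_gr :=
  @tw_grmod nuV_tw (fun m => @twist_gr _ _ _ m) (- 4).

Lemma tw_pair_gr (f g : twisted_end A) (t s : int) i j (x y : A) :
  (forall m x, GA m x -> GA m (g x)) -> t + s = 0 ->
  GA (i + t) x -> GA (j + s) y -> GA (i + j) (@tw_pair _ _ f g x y).
Proof.
move=> ggr ts hx hy; have -> : i + j = i + t + (j + s).
  by rewrite addrACA ts addr0.
by apply: ore_grM => //; exact: ggr.
Qed.

Lemma nak_bim_invertible : graded_invertible nak_bim.
Proof.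
exists nakV_bim, (@tw_pair _ _ (nu_tw A) nuV_tw), (@tw_pair _ _ nuV_tw (nu_tw A)); split.
- exact: (@tw_tensor_product _ _ (nu_tw A) nuV_tw (nuK q_neq0)).
- exact: (@tw_tensor_product _ _ nuV_tw (nu_tw A) (nuVK q_neq0)).
- by move=> i j x y hx hy; apply: tw_pair_gr hx hy => // m z; exact: twist_gr.
- by move=> i j x y hx hy; apply: tw_pair_gr hy hx => // m z; exact: twist_gr.
Qed.

(** Through [th] the end of the dual complex becomes the start of the resolution, whose cokernel is
    the algebra by means of [aug]. *)
Definition ext_val (f : cocycles 3) : A := aug (th (gen1 f)).

Lemma ext_valD f g : ext_val (f + g) = ext_val f + ext_val g.
Proof. by rewrite /ext_val -augD -thD. Qed.

Lemma ext_valZ (r : E^c) f : ext_val (r *: f) = reg_act (th r) (ext_val f : regbim A).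
Proof. by rewrite /ext_val -augM -thM. Qed.

Lemma ext_val0 : ext_val 0 = 0.
Proof. by have := ext_valD 0 0; rewrite addr0 => /eqP; rewrite addrC -subr_eq subrr eq_sym => /eqP. Qed.

Lemma ext_valB f g : ext_val (f - g) = ext_val f - ext_val g.
Proof. by apply/eqP; rewrite eq_sym subr_eq -ext_valD subrK. Qed.

Lemma ext_val_cobound (f : cocycles 3) :
  f \in lspan (@coboundary _ _ (@res_d _ _ (regbim A) _ P) 3) <-> ext_val f = 0.
Proof.
split.
  move: f; apply: lspan_sub.
    split=> [|r f g ef eg]; first exact: ext_val0.
    by rewrite ext_valD ext_valZ ef eg reg_act0 addr0.
  move=> f /coboundaryP[a [b [e _]]]; rewrite /ext_val e thD !thM th_m3a // th_m3b.
  rewrite mulrN -mulNr (@kinAC _ (env_kalgebra A)) mulrA; exact: aug_m1.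
move=> f0; apply: lspan_gen.
have [|x [y e]] := @exact0 _ _ _ _ A (th (gen1 f)) _ f0.
  by rewrite -th_eps -thM (gen1_idem f : eps 2 2 * _ = _).
have [a ea] := th_surj q_neq0 (- x).
(* The preimages are chosen to cancel the factors -1 of [th_m3a] and [- q] of [th_m3b]. *)
have [b eb] := th_surj q_neq0 (kin (env_kalgebra A) (- (lam * mu)^-1) * y).
have g2 : gen2 f = 0 by rewrite -gen2_idem /= mul0r.
apply: (@coboundary_mx _ _ _ _ _ 2 f a b); last by rewrite /= !mul0r addr0.
apply: (th_inj q_neq0); rewrite e thD !thM th_m3a // th_m3b -ea -eb mulrNN.
congr (_ + _); rewrite (@kinAC _ (env_kalgebra A)) !mulrA -rmorphM mulrNN divff //.
by rewrite rmorph1 mul1r.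
Qed.

Definition ext_map (x : ext P 3) : nak_bim := ext_val (lquot_repr x).

Lemma ext_mapE f : ext_map (lquot_pi _ f) = ext_val f.
Proof.
apply/eqP; rewrite -subr_eq0; apply/eqP.
have : lquot_repr (lquot_pi (@coboundary _ _ (@res_d _ _ (regbim A) _ P) 3) f) - f \in
    lspan (@coboundary _ _ (@res_d _ _ (regbim A) _ P) 3).
  by apply/lquot_piP; rewrite lquot_reprK.
by move/ext_val_cobound; rewrite ext_valB.
Qed.

Fact res_pr_gr : gr (g := res_mod A 3) 4 (res_pr 3 (1, 0)).
Proof.
split; rewrite subrr /= ?mul0r; last exact: env_gr0.
rewrite mul1r /eps; elim/big_rec: _ => [|v x _ hx]; first exact: env_gr0.
by apply: env_grD => //; apply: (@env_grT _ _ _ _ _ 0 0); exact: ore_gr_vid.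
Qed.

Lemma th_gr m x : env_gr m x -> env_gr m (th x).
Proof.
apply: (@env_gr_ind k V lam mu A m (fun x => env_gr m (th x))) => [|c y z hy hz|i j a b ha hb <-].
- by rewrite th0; exact: env_gr0.
- by rewrite thD thZ; exact: env_gr_lin.
- by rewrite thT addrC; apply: env_grT => //; exact: twist_gr.
Qed.

Lemma nak_right_iso : graded_right_iso P 3 nak_bim.
Proof.
exists ext_map; split.
- case: (th_bij A q_neq0) => thV thK thVK.
  (* The inverse map: [th] carries the value on the generator back to [tens y 1], whose augmentation
     is [y]. The cocycle condition holds because the next module is 0. *)
  pose cf (y : A) (x : P 3) : (E^c)^o := (pp_val (x : pp (res_idem A 3))).1 * thV (tens y 1).
  have cfP y : cf y \in @is_cocycle _ _ (@res_d _ _ (regbim A) _ P) 3.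
    apply/asboolP; split=> [c x x'|x].
      by rewrite /cf /= mulrDl mulrA.
    by rewrite (@res_high _ _ _ _ A 4 x) // raddf0 /cf /= mul0r.
  pose back (y : A) : ext P 3 := lquot_pi _ (Cocycle (cfP y)).
  have backK y : ext_map (back y) = y.
    rewrite ext_mapE /ext_val /gen1 /= /cf /= mul1r thM thVK th_eps.
    by rewrite aug_eps augT mulr1.
  exists back => // x; elim/lquot_ind: x => f; apply/lquot_piP.
  by apply/ext_val_cobound; rewrite ext_valB -!ext_mapE backK subrr.
- by elim/lquot_ind=> f; elim/lquot_ind=> g; rewrite -lquot_piD !ext_mapE ext_valD.
- move=> a b; elim/lquot_ind => f.
  rewrite -[_ *: _]lquot_piZ !ext_mapE ext_valZ thT reg_actT.
  by rewrite tw_scaleT.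
- move=> m _ [f [-> fm]]; rewrite ext_mapE.
  have /th_gr/aug_gr := fm _ _ res_pr_gr; rewrite addrC.
  exact.
Qed.

Theorem ore_CY : twisted_graded_CY GA 3.
Proof.
split; first exact: ore_graded_algebra.
exists P, nak_bim; split; [exact: nak_bim_invertible|exact: nak_right_iso|].
exact: ext_vanish.
Qed.

End CalabiYau.

(** * Leading terms and chain conditions *)

Section Dickson.

Lemma nat_min (P : nat -> Prop) : (exists n, P n) ->
  exists n, P n /\ forall m, P m -> (n <= m)%N.
Proof.
case=> n; elim/ltn_ind: n => n ih Pn.
have [[m [mn Pm]]|h] := pselect (exists m, (m < n)%N /\ P m); first exact: ih mn Pm.
exists n; split=> // m Pm; rewrite leqNgt; apply/negP => mn; apply: h.
by exists m.
Qed.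

(** Each new index is one where [f] is minimal on the remaining tail. *)
Lemma nondecreasing_subseq (f : nat -> nat) : exists g : nat -> nat,
  {homo g : m n / (m < n)%N} /\ {homo (f \o g) : m n / (m <= n)%N}.
Proof.
have hm N : exists m, (N <= m)%N /\ forall j, (N <= j)%N -> (f m <= f j)%N.
  have [|_ [[m [Nm <-]] hm]] := @nat_min (fun y => exists m, (N <= m)%N /\ f m = y).
    by exists (f N), N.
  by exists m; split=> // j Nj; apply: hm; exists j.
have [next hnext] := choice hm.
pose g := fix g n := if n is n'.+1 then next (g n').+1 else next 0%N.
have gS n : (g n < g n.+1)%N by have [] := hnext (g n).+1.
have ginc : {homo g : m n / (m < n)%N} by apply: homo_ltn => //; exact: ltn_trans.
have gmin n j : (g n <= j)%N -> (f (g n) <= f j)%N.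
  have [N gN] : exists N, g n = next N by case: n => [|n]; eexists.
  by rewrite gN => hj; have [h1 h2] := hnext N; apply: h2; exact: leq_trans hj.
exists g; split=> // m n; rewrite leq_eqVlt => /orP[/eqP->//|/ginc/ltnW].
exact: gmin.
Qed.

(** Passing to a subsequence for one more row preserves monotonicity of the earlier rows; the first
    two terms of the final subsequence are compared. *)
Lemma dickson (r : nat) (f : nat -> nat -> nat) :
  exists p q, (p < q)%N /\ forall i, (i < r)%N -> (f i p <= f i q)%N.
Proof.
suff [g [ginc gf]] : exists g : nat -> nat, {homo g : m n / (m < n)%N} /\
    forall i, (i < r)%N -> {homo (f i \o g) : m n / (m <= n)%N}.
  by exists (g 0), (g 1)%N; split=> [|i ir]; [exact: ginc|exact: (gf i ir 0%N 1%N)].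
elim: r => [|r [g [ginc gf]]]; first by exists id; split=> // ? ?.
have [h [hinc hf]] := nondecreasing_subseq (f r \o g).
exists (g \o h); split=> [m n /hinc/ginc//|i].
rewrite ltnS leq_eqVlt => /orP[/eqP-> //|ir] m n.
rewrite leq_eqVlt => /orP[/eqP->//|/hinc/ltnW]; exact: gf.
Qed.

End Dickson.

(** * Supports and leading monomials *)

Section Support.
Context (k : fieldType) (V : finType) (lam mu : k) (A : ore_algebra V lam mu).
Local Notation u := (up A).
Local Notation d := (down A).
Local Notation z := (zelt lam (up A) (down A)).

Definition supp_in (S : pbw_index V -> Prop) (x : A) : Prop :=
  forall b, (ocoord x)@_b != 0 -> S b.

Lemma supp_ind S (Q : A -> Prop) : Q 0 ->
  (forall c b x, S b -> Q x -> Q (kin A c * mon A b + x)) ->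
  forall x, supp_in S x -> Q x.
Proof.
move=> Q0 QS x Sx; rewrite -(ocoordK x) [malg_lift _ _]/malg_lift.
suff gen (s : seq (pbw_index V)) : (forall b, b \in s -> S b) ->
    Q (\sum_(b <- s) (ocoord x)@_b *: (pbw_mon lam (vid A) u d b : kmod A)).
  by apply: gen => b; rewrite -mcoeff_neq0; exact: Sx.
elim: s => [|b s ih] hs; first by rewrite big_nil.
rewrite big_cons; have := QS (ocoord x)@_b b _ (hs b (mem_head _ _)) (ih _).
by rewrite /mon -lock; apply=> b' hb'; apply: hs; rewrite inE hb' orbT.
Qed.

Lemma ocoord0 : ocoord (0 : A) = 0.
Proof. by have := ocoord_lin (-1) (0 : A) 0; rewrite mulr0 addr0 scaleN1r addNr. Qed.
Lemma ocoord_eq0 (x : A) : ocoord x = 0 -> x = 0.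
Proof. by move=> h; rewrite -(ocoordK x) h raddf0. Qed.

Lemma supp0 S : supp_in S 0.
Proof. by move=> b; rewrite ocoord0 mcoeff0 eqxx. Qed.

Lemma supp_lin S c x y : supp_in S x -> supp_in S y -> supp_in S (kin A c * x + y).
Proof.
move=> hx hy b; rewrite ocoord_lin mcoeffD mcoeffZ => h.
have [x0|] := eqVneq (ocoord x)@_b 0; last exact: hx.
by apply: hy; move: h; rewrite x0 mulr0 add0r.
Qed.

Lemma suppD S x y : supp_in S x -> supp_in S y -> supp_in S (x + y).
Proof. by move=> hx hy; rewrite -[x]mul1r -(rmorph1 (kin A)); exact: supp_lin. Qed.
Lemma suppZ S c x : supp_in S x -> supp_in S (kin A c * x).
Proof. by move=> hx; have := @supp_lin S c x 0 hx (@supp0 S); rewrite addr0. Qed.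

Lemma supp_mon S b : S b -> supp_in S (mon A b).
Proof. by move=> Sb b'; rewrite ocoord_monE mcoeffU; case: (eqVneq b b') => [<-//|_]; rewrite mulr0n eqxx. Qed.

Lemma supp_sub S S' x : (forall b, S b -> S' b) -> supp_in S x -> supp_in S' x.
Proof. by move=> SS' hx b /hx/SS'. Qed.

Lemma supp_mulr S S' a : (forall b, S b -> supp_in S' (mon A b * a)) ->
  forall x, supp_in S x -> supp_in S' (x * a).
Proof.
move=> h; apply: supp_ind => [|c b x Sb ih]; first by rewrite mul0r; exact: supp0.
by rewrite mulrDl -mulrA; apply: supp_lin => //; exact: h.
Qed.

(** The rank of the vertex comes last, only to break ties and make the order total. *)
Definition pbw_lt (b b' : pbw_index V) : bool :=
  let: (v, (i, j, l)) := b in let: (v', (i', j', l')) := b' in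
  (i < i')%N || (i == i') && ((j < j')%N || (j == j') && ((l < l')%N ||
    (l == l') && (enum_rank v < enum_rank v')%N)).

Definition pbw_shift (b : pbw_index V) (m : nat * nat * nat) : pbw_index V :=
  (b.1, ((b.2.1.1 + m.1.1)%N, (b.2.1.2 + m.1.2)%N, (b.2.2 + m.2)%N)).

Lemma pbw_lt_total b b' : b != b' -> pbw_lt b b' || pbw_lt b' b.
Proof.
case: b b' => [v [[i j] l]] [v' [[i' j'] l']] h.
have : [|| i != i', j != j', l != l' | enum_rank v != enum_rank v' :> nat].
  apply: contraNT h; rewrite !negb_or !negbK => /and4P[/eqP-> /eqP-> /eqP-> /eqP vv].
  by rewrite (enum_rank_inj (val_inj vv)).
by rewrite /pbw_lt; lia.
Qed.

Lemma pbw_lt_irr b : pbw_lt b b = false.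
Proof. by case: b => [v [[i j] l]]; rewrite /pbw_lt; lia. Qed.

Lemma pbw_lt_trans b1 b2 b3 : pbw_lt b1 b2 -> pbw_lt b2 b3 -> pbw_lt b1 b3.
Proof.
by case: b1 b2 b3 => [v [[i j] l]] [v' [[i' j'] l']] [v2 [[i2 j2] l2]]; rewrite /pbw_lt; lia.
Qed.

Lemma pbw_lt_shift b b' m : pbw_lt b b' -> pbw_lt (pbw_shift b m) (pbw_shift b' m).
Proof.
by case: b b' m => [v [[i j] l]] [v' [[i' j'] l']] [[p q] r]; rewrite /pbw_lt /=; lia.
Qed.

Lemma pbw_lt_shiftr b v m m' : pbw_lt (v, m) (v, m') -> pbw_lt (pbw_shift b m) (pbw_shift b m').
Proof.
by case: b m m' => [w [[i j] l]] [[i' j'] l'] [[p q] r]; rewrite /pbw_lt /=; lia.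
Qed.

(** The well-foundedness needed for the choice of minimal leading terms, obtained by minimising one
    coordinate after the other. *)
Lemma pbw_lt_min (Q : pbw_index V -> Prop) : (exists b, Q b) ->
  exists b, Q b /\ forall b', Q b' -> ~~ pbw_lt b' b.
Proof.
case=> -[v0 [[i0 j0] l0]] Q0.
have [|i [[j1 [l1 [v1 Q1]]] hi]] := @nat_min (fun i => exists j l v, Q (v, (i, j, l))).
  by exists i0, j0, l0, v0.
have [|j [[l2 [v2 Q2]] hj]] := @nat_min (fun j => exists l v, Q (v, (i, j, l))).
  by exists j1, l1, v1.
have [|l [[v3 Q3] hl]] := @nat_min (fun l => exists v, Q (v, (i, j, l))).
  by exists l2, v2.
have [|r [[v [Qv er]] hr]] :=
    @nat_min (fun r => exists v, Q (v, (i, j, l)) /\ enum_rank v = r :> nat).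
  by exists (enum_rank v3), v3.
exists (v, (i, j, l)); split=> // -[v' [[i' j'] l']] Q'; apply/negP => lt.
have ii : (i <= i')%N by apply: hi; exists j', l', v'.
have ei : i' = i by move: lt; rewrite /pbw_lt; lia.
rewrite {}ei {i' ii hi} in Q' lt *.
have jj : (j <= j')%N by apply: hj; exists l', v'.
have ej : j' = j by move: lt; rewrite /pbw_lt; lia.
rewrite {}ej {j' jj hj} in Q' lt *.
have ll : (l <= l')%N by apply: hl; exists v'.
have el : l' = l by move: lt; rewrite /pbw_lt; lia.
rewrite {}el {l' ll hl} in Q' lt *.
have rr : (r <= enum_rank v')%N by apply: hr; exists v'.
by move: lt; rewrite /pbw_lt er; lia.
Qed.

Definition below (b : pbw_index V) : A -> Prop := supp_in (fun b' => pbw_lt b' b).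

Definition has_lead (b : pbw_index V) (x : A) : Prop :=
  exists c y, [/\ c != 0, below b y & x = kin A c * mon A b + y].

Lemma has_lead_neq0 b x : has_lead b x -> x <> 0.
Proof.
case=> c [y [c0 hy ->]] /(congr1 (fun x => (ocoord x)@_b)).
rewrite ocoord_lin ocoord_monE ocoord0 mcoeffD mcoeffZ mcoeffUU mulr1 mcoeff0.
have -> : (ocoord y)@_b = 0 by apply/eqP/negbNE/negP => /hy; rewrite pbw_lt_irr.
by rewrite addr0; apply/eqP.
Qed.

Lemma lead_exists x : x <> 0 -> exists b, has_lead b x.
Proof.
move=> x0; have [s0|] := eqVneq (msupp (ocoord x) : seq _) [::].
  case: x0; apply/ocoord_eq0/malgP => b; rewrite mcoeff0; apply: mcoeff_outdom.
  by rewrite -[_ \in _]/(b \in (msupp (ocoord x) : seq _)) s0.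
have hmax : forall s : seq (pbw_index V), s != [::] ->
    exists2 b, b \in s & forall b', b' \in s -> b' != b -> pbw_lt b' b.
  elim=> // b s ih _; case: (eqVneq s [::]) => [->|/ih[b1 b1s h1]].
    by exists b; rewrite ?inE // => b'; rewrite inE => /eqP->; rewrite eqxx.
  have [e|bb] := eqVneq b b1.
    exists b => [|b']; rewrite inE ?eqxx // => /orP[/eqP->|b's]; first by rewrite eqxx.
    by rewrite e; exact: h1.
  case/orP: (pbw_lt_total bb) => lt.
    exists b1 => [|b']; rewrite inE ?b1s ?orbT // => /orP[/eqP->//|b's]; exact: h1.
  exists b => [|b']; rewrite inE ?eqxx // => /orP[/eqP->|b's]; first by rewrite eqxx.
  have [->//|/(h1 _ b's) lt'] := eqVneq b' b1.
  by move=> _; exact: pbw_lt_trans lt.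
move=> /hmax[b bs hb]; exists b, (ocoord x)@_b, (kin A (- (ocoord x)@_b) * mon A b + x).
split; first by rewrite mcoeff_neq0.
  move=> b'; rewrite ocoord_lin ocoord_monE mcoeffD mcoeffZ mcoeffU.
  have [<-|bb'] := eqVneq b b'; first by rewrite mulr1n mulr1 addNr eqxx.
  by rewrite mulr0n mulr0 add0r mcoeff_neq0 => /hb; apply; rewrite eq_sym.
by rewrite addrA -mulrDl -rmorphD subrr rmorph0 mul0r add0r.
Qed.

Lemma belowW b b' x : pbw_lt b b' -> below b x -> below b' x.
Proof. by move=> lt; apply: supp_sub => b1 /pbw_lt_trans; exact. Qed.

Lemma has_lead_below b b' x : pbw_lt b b' -> has_lead b x -> below b' x.
Proof.
move=> lt [c [y [_ hy ->]]]; apply: supp_lin; first exact: supp_mon.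
exact: belowW lt hy.
Qed.

Section LeadMul.
Hypotheses (lam0 : lam != 0) (mu0 : mu != 0).

(** Words in [u], [z] and [d] keep the initial vertex of every monomial, so their effect on leading
    indices is a shift of exponents. *)
Definition lead_multiplier (a : A) (m : nat * nat * nat) : Prop :=
  forall b, has_lead (pbw_shift b m) (mon A b * a).

Lemma lead_below a m b x : lead_multiplier a m -> below b x -> below (pbw_shift b m) (x * a).
Proof.
move=> ha; apply: supp_mulr => b' lt.
by apply: has_lead_below (ha b'); exact: pbw_lt_shift.
Qed.

Lemma lead_mul a m b x : lead_multiplier a m -> has_lead b x -> has_lead (pbw_shift b m) (x * a).
Proof.
move=> ha [c [y [c0 hy ->]]]; have [c' [y' [c'0 hy' e]]] := ha b.
exists (c * c'), (kin A c * y' + y * a); split; first by rewrite mulf_neq0.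
  by apply: supp_lin => //; exact: lead_below hy.
by rewrite mulrDl -mulrA e mulrDr mulrA -rmorphM addrA.
Qed.

Lemma lead_multiplier1 : lead_multiplier 1 (0, 0, 0)%N.
Proof.
move=> [v [[i j] l]]; exists 1, 0; split; [exact: oner_neq0|exact: supp0|].
by rewrite /pbw_shift /= !addn0 mulr1 rmorph1 mul1r addr0.
Qed.

Lemma lead_multiplierM a m a' m' : lead_multiplier a m -> lead_multiplier a' m' ->
  lead_multiplier (a * a')
    ((m.1.1 + m'.1.1)%N, (m.1.2 + m'.1.2)%N, (m.2 + m'.2)%N).
Proof.
move=> ha ha' b; rewrite mulrA; have := lead_mul ha' (ha b).
by rewrite /pbw_shift /= !addnA.
Qed.

Lemma lead_multiplierX a m n : lead_multiplier a m ->
  lead_multiplier (a ^+ n) ((n * m.1.1)%N, (n * m.1.2)%N, (n * m.2)%N).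
Proof.
move=> ha; elim: n => [|n ih]; first exact: lead_multiplier1.
by rewrite exprS !mulSn; exact: (lead_multiplierM ha ih).
Qed.

(** The other term of [mon_up] has a smaller exponent of [u], hence is lower, and the leading
    coefficient is nonzero because both roots are. *)
Lemma lead_multiplier_up : lead_multiplier u (1, 0, 0)%N.
Proof.
move=> [v [[i j] l]]; rewrite mon_up.
exists (lam ^+ l * mu ^+ j), (kin A (qnum lam mu l) * mon A (v, (i, j.+1, l.-1))); split.
- by rewrite mulf_neq0 ?expf_neq0.
- by apply: suppZ; apply: supp_mon; rewrite /pbw_lt /pbw_shift /=; lia.
- by rewrite /pbw_shift /= addn1 !addn0.
Qed.

Lemma lead_multiplier_zed : lead_multiplier z (0, 1, 0)%N.
Proof.
move=> [v [[i j] l]]; rewrite mon_zed; exists (mu ^+ l), 0; split.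
- by rewrite expf_neq0.
- exact: supp0.
- by rewrite /pbw_shift /= addn1 !addn0 addr0.
Qed.

Lemma lead_multiplier_down : lead_multiplier d (0, 0, 1)%N.
Proof.
move=> [v [[i j] l]]; rewrite mon_down; exists 1, 0; split.
- exact: oner_neq0.
- exact: supp0.
- by rewrite /pbw_shift /= addn1 !addn0 addr0 rmorph1 mul1r.
Qed.

Definition pbw_word (m : nat * nat * nat) : A := u ^+ m.1.1 * z ^+ m.1.2 * d ^+ m.2.

Lemma lead_multiplier_word m : lead_multiplier (pbw_word m) m.
Proof.
have := lead_multiplierM (lead_multiplierM (lead_multiplierX m.1.1 lead_multiplier_up)
  (lead_multiplierX m.1.2 lead_multiplier_zed)) (lead_multiplierX m.2 lead_multiplier_down).
by rewrite /= !muln0 !muln1 !addn0 !add0n; case: m => [[]].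
Qed.

Lemma lead_coord b x : has_lead b x -> (ocoord x)@_b != 0.
Proof.
case=> c [y [c0 hy ->]].
rewrite ocoord_lin ocoord_monE mcoeffD mcoeffZ mcoeffUU mulr1.
have -> : (ocoord y)@_b = 0 by apply/eqP/negbNE/negP => /hy; rewrite pbw_lt_irr.
by rewrite addr0.
Qed.

Lemma has_lead_lin c b x y : c != 0 -> has_lead b x -> below b y ->
  has_lead b (kin A c * x + y).
Proof.
move=> c0 [c' [y' [c'0 hy' ->]]] hy; exists (c * c'), (kin A c * y' + y).
split; [by rewrite mulf_neq0|exact: supp_lin|].
by rewrite mulrDr mulrA -rmorphM addrA.
Qed.

Lemma vid_supp v y : supp_in (fun b => b.1 = v) (vid A v * y).
Proof.
elim/ore_ind: y => [|c b y ih]; first by rewrite mulr0; exact: supp0.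
rewrite mulrDr kinAC; apply: supp_lin => //; rewrite vid_mon.
by case: eqP => [e|_]; [apply: supp_mon|exact: supp0].
Qed.

(** All monomials of [y] start at [w], so each acts on [x] as the bare word in its exponents;
    different words then shift the leading index of [x] by different amounts, and the largest one
    survives. *)
Lemma ore_mul_neq0 w (x y : A) : x * vid A w = x -> vid A w * y = y ->
  x * y = 0 -> x = 0 \/ y = 0.
Proof.
move=> xw wy; apply: contraPP => /not_orP[/lead_exists[b hx] /lead_exists[[w' m] hy]].
have xm b' : x * mon A b' = if w == b'.1 then x * pbw_word b'.2 else 0.
  case: b' => v [[i j] l] /=; rewrite -{1}xw -mulrA vid_mon /=.
  by case: eqP => [e|_]; rewrite ?mulr0 // monE -e mulrA xw.
have ww' : w' = w.
  by have := lead_coord hy; rewrite -wy => /vid_supp.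
rewrite {}ww' in hy; case: hy => c [y' [c0 hy' ->]].
rewrite mulrDr kinAC xm eqxx; apply: (@has_lead_neq0 (pbw_shift b m)).
apply: has_lead_lin => //; first exact: lead_mul (lead_multiplier_word m) hx.
move: y' hy'; apply: supp_ind => [|c' [v' m'] y' lt ih].
  by rewrite mulr0; exact: supp0.
rewrite mulrDr kinAC; apply: supp_lin => //; rewrite xm /=.
case: eqP => [e|_]; last exact: supp0.
apply: has_lead_below (lead_mul (lead_multiplier_word m') hx).
by apply: (@pbw_lt_shiftr b w); rewrite -e in lt.
Qed.

Lemma ore_right_noetherian : right_noetherian A.
Proof.
move=> I hI Iinc; apply: contrapT => /forallNP hN.
have I0 i : I i 0 by have [] := hI i.
have ID i x y : I i x -> I i y -> I i (x + y) by have [_ h _] := hI i; exact: h.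
have IM i x r : I i x -> I i (x * r) by have [_ _ h] := hI i; exact: h.
have IZ i c x : I i x -> I i (kin A c * x) by rewrite kin_central; exact: IM.
have Imono i j x : (i <= j)%N -> I i x -> I j x.
  move=> ij; elim: j ij => [|j ih]; first by rewrite leqn0 => /eqP->.
  by rewrite leq_eqVlt => /orP[/eqP->//|/ih h /h]; exact: Iinc.
(* For each [N] an element of the union outside [I N] with smallest leading index is chosen; a
   reduction of it by an element of the chain will contradict minimality. *)
pose bad N b := exists x n, [/\ has_lead b x, I n x & ~ I N x].
have badN N : exists b, bad N b.
  have /existsNP[i /not_implyP[Ni IiN]] := hN N.
  have [x [Iix INx]] : exists x, I i x /\ ~ I N x.
    apply: contrapT => /forallNP h; apply: IiN; apply/seteqP; split=> x hx.
      by apply: contrapT => hx'; apply: (h x).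
    exact: Imono hx.
  have [b hb] : exists b, has_lead b x by apply: lead_exists => x0; apply: INx; rewrite x0.
  by exists b, x, i.
have /choice[bf hbf] : forall N, exists b, bad N b /\ forall b', bad N b' -> ~~ pbw_lt b' b.
  by move=> N; exact: pbw_lt_min (badN N).
have /choice[xf hxf] : forall N, exists xn : A * nat,
    [/\ has_lead (bf N) xn.1, I xn.2 xn.1 & ~ I N xn.1].
  by move=> N; have [[x [n h]] _] := hbf N; exists (x, n).
(* Each stage passes the level at which the previous element occurs, so that element belongs to all
   later ideals of the subsequence. *)
pose Ns := fix Ns t := if t is t'.+1 then maxn (Ns t') (xf (Ns t')).2 else 0%N.
have Ns_mono s t : (s <= t)%N -> (Ns s <= Ns t)%N.
  elim: t => [|t ih]; first by rewrite leqn0 => /eqP->.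
  by rewrite leq_eqVlt => /orP[/eqP->//|/ih h]; rewrite /= leq_max h.
pose f i t := nth 0%N (let: (v, (i, j, l)) := bf (Ns t) in
  [:: i; j; l; nat_of_ord (enum_rank v); #|V| - enum_rank v]%N) i.
(* The rank of the vertex and its complement are both among the five rows, so domination forces the
   two vertices to be equal. *)
have [p [q [pq hf]]] := dickson 5 f.
have [lp Ip nIp] := hxf (Ns p); have [lq Iq nIq] := hxf (Ns q).
have {Ip} Ip : I (Ns q) (xf (Ns p)).1.
  by apply: Imono Ip; apply: (leq_trans _ (Ns_mono _ _ pq)); rewrite /= leq_maxr.
have [m em] : exists m, bf (Ns q) = pbw_shift (bf (Ns p)) m.
  have := (hf 0 isT, hf 1 isT, hf 2 isT, hf 3 isT, hf 4 isT)%N; rewrite /f /=.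
  case: (bf (Ns p)) (bf (Ns q)) => [v [[i j] l]] [v' [[i' j'] l']] /= [[[[h0 h1] h2] h3] h4].
  exists (i' - i, j' - j, l' - l)%N; rewrite /pbw_shift /= !subnKC //; congr (_, _).
  apply/enum_rank_inj/val_inj => /=; apply/eqP; rewrite eqn_leq h3.
  have bv : (enum_rank v < #|V|)%N := ltn_ord _; have bv' : (enum_rank v' < #|V|)%N := ltn_ord _.
  by rewrite andbT -(leq_sub2lE _ (ltnW bv')).
have [c' [y' [c'0 hy' e']]] := lead_mul (lead_multiplier_word m) lp.
rewrite -em in hy' e'; have [c [y [c0 hy e]]] := lq.
pose x := kin A (- (c / c')) * ((xf (Ns p)).1 * pbw_word m) + (xf (Ns q)).1.
have xE : x = kin A (- (c / c')) * y' + y.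
  rewrite /x e' e mulrDr mulrA -rmorphM mulNr divfK // rmorphN mulNr.
  by rewrite addrACA addNr add0r.
have nIx : ~ I (Ns q) x.
  move=> Ix; apply: nIq.
  have -> : (xf (Ns q)).1 = kin A (c / c') * ((xf (Ns p)).1 * pbw_word m) + x.
    by rewrite /x addrA -mulrDl -rmorphD subrr rmorph0 mul0r add0r.
  by apply: ID => //; apply: IZ; apply: IM.
have [b hb] : exists b, has_lead b x by apply: lead_exists => x0; apply: nIx; rewrite x0.
have lt : pbw_lt b (bf (Ns q)).
  have hx : below (bf (Ns q)) x by rewrite xE; exact: supp_lin.
  exact: hx (lead_coord hb).
have badb : bad (Ns q) b.
  exists x, (maxn (Ns q) (xf (Ns q)).2); split=> //.
  apply: ID; last by apply: Imono Iq; rewrite leq_maxr.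
  by apply: IZ; apply: IM; apply: Imono Ip; rewrite leq_maxl.
by have [_ /(_ b badb)] := hbf (Ns q); rewrite lt.
Qed.

End LeadMul.

(** * The case of a vanishing root *)

Section Degenerate.
Hypothesis mu0 : mu = 0.

Lemma degenerate_not_noetherian (v : V) : ~ right_noetherian A.
Proof.
pose S N (b : pbw_index V) := (b.2.1.1 < N)%N && (0 < b.2.1.2)%N : Prop.
move=> /(_ (fun N => supp_in (S N))) [N|N x|N hN].
- split=> [|x y|r x hx]; [exact: supp0|exact: suppD|].
  move: x r hx => x r; apply: (@ore_rind _ _ _ _ A (supp_in (S N))).
  + exact: supp0.
  + by move=> c y y'; exact: supp_lin.
  + move=> y w; apply: supp_mulr => b Sb; rewrite mon_vid.
    by case: eqP => _; [apply: supp_mon|exact: supp0].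
  + move=> y; apply: supp_mulr => -[w [[i [|j]] l]] /andP[// iN _]; rewrite mon_up.
    (* This removes the only term that would raise the exponent of [u]. *)
    have -> : mu ^+ j.+1 = 0 by apply/eqP; rewrite expf_eq0 /=; apply/eqP.
    rewrite mulr0 rmorph0 mul0r add0r.
    by apply: suppZ; apply: supp_mon; rewrite /S /= iN.
  + move=> y; apply: supp_mulr => -[w [[i j] l]] Sb; rewrite mon_down.
    exact: supp_mon.
- by apply: supp_sub => b /andP[h1 h2]; apply/andP; split=> //; exact: ltnW.
have : supp_in (S N.+1) (mon A (v, (N, 1, 0)%N)) by apply: supp_mon; rewrite /S /= ltnSn.
rewrite (hN N.+1 (leqnSn N)) => /(_ (v, (N, 1, 0)%N)).
by rewrite ocoord_monE mcoeffUU oner_neq0 /S /= ltnn => /(_ isT).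
Qed.

Lemma mon_neq0 b : mon A b <> 0.
Proof.
move=> /(congr1 (fun x => (ocoord x)@_b)); rewrite ocoord_monE mcoeffUU ocoord0 mcoeff0.
by apply/eqP/oner_neq0.
Qed.

(** The product [z * u] vanishes, while its factors, cut by idempotents at consecutive vertices, are
    basis monomials. *)
Lemma degenerate_not_domain (v : V) : ~ piecewise_domain (@vid _ _ _ _ A).
Proof.
case=> _ /(_ v (upt A (downt A v)) (upt A (upt A (downt A v)))
  (vid A v * z) (vid A (upt A (downt A v)) * u)) [||||].
- by exists z; rewrite vid_zed -mulrA vidM eqxx.
- by exists u; rewrite vid_up -mulrA vidM eqxx.
- rewrite vid_zed -mulrA (mulrA (vid _ _) (vid _ _)) vidM eqxx vid_up mulrA.
  by rewrite zed_up (congr1 (kin A) mu0) rmorph0 !mul0r.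
- have -> : vid A v * z = mon A (v, (0, 1, 0)%N) by rewrite monE expr0 mul1r mulr1.
  exact: mon_neq0.
- move=> e; apply: (@mon_neq0 (upt A (downt A v), (1, 0, 0)%N)).
  by rewrite monE !mulr1.
Qed.

End Degenerate.

Lemma ore_piecewise_domain : lam != 0 -> mu != 0 -> piecewise_domain (@vid _ _ _ _ A).
Proof.
move=> lam0 mu0; split; first by split; [exact: vidM|exact: vid_sum].
move=> i j l a b [r ea] [s eb]; apply: (@ore_mul_neq0 lam0 mu0 j).
  by rewrite ea -!mulrA vidM eqxx.
by rewrite eb !mulrA vidM eqxx.
Qed.

End Support.

(** * The opposite algebra and left-handed statements *)

Section Opposite.
Context (k : fieldType).

Section Alg.
Context (A : kalgebra k).
Definition kin_op (c : k) : A^c := kin A c.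
Fact kin_op_zmod : zmod_morphism kin_op.
Proof. by move=> c c'; exact: (rmorphB (kin A)). Qed.
Fact kin_op_monoid : monoid_morphism kin_op.
Proof.
split=> [|c c']; first exact: (rmorph1 (kin A)).
by rewrite /kin_op mulrC; exact: (rmorphM (kin A)).
Qed.
HB.instance Definition _ := GRing.isZmodMorphism.Build k A^c kin_op kin_op_zmod.
HB.instance Definition _ := GRing.isMonoidMorphism.Build k A^c kin_op kin_op_monoid.
Lemma kin_op_central c (x : A^c) : kin_op c * x = x * kin_op c.
Proof. exact: esym (kin_central c (x : A)). Qed.
Definition op_kalgebra : kalgebra k := KAlgebra kin_op_central.
End Alg.

Context (V : finType) (lam mu : k) (A : ore_algebra V lam mu).
Local Notation B := (op_kalgebra A).
Local Notation u := (up A).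
Local Notation d := (down A).

Lemma op_mulE (x y : B) : x * y = (y : A) * (x : A) :> A.
Proof. by []. Qed.

Lemma op_expE (x : B) n : x ^+ n = (x : A) ^+ n :> A.
Proof.
elim: n => // n ih; rewrite exprS exprSr -ih.
by [].
Qed.

(** Reversing products and exchanging the letters cancel, so [z] and both roots are unchanged. *)
Lemma zelt_op : zelt lam (d : B) (u : B) = zelt lam u d :> A.
Proof. by rewrite /zelt (kin_central lam (u * d : A)). Qed.

Fact op_vidM v w : (vid A v : B) * vid A w = if v == w then vid A v else 0.
Proof. by rewrite op_mulE vidM eq_sym; case: eqP => [->|]. Qed.

Fact op_vid_up v : (vid A v : B) * d = (d : B) * vid A ((downt A)^-1%g v).
Proof. by rewrite !op_mulE vid_down permKV. Qed.

Fact op_vid_down v : (vid A v : B) * u = (u : B) * vid A ((upt A)^-1%g v).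
Proof. by rewrite !op_mulE vid_up permKV. Qed.

Fact op_upt_downt v :
  (downt A)^-1%g ((upt A)^-1%g v) = (upt A)^-1%g ((downt A)^-1%g v).
Proof.
apply: (@perm_inj _ (upt A)); apply: (@perm_inj _ (downt A)).
by rewrite permKV -upt_downt permKV permKV permKV.
Qed.

Fact op_zed_up : zelt lam (d : B) (u : B) * d = kin B mu * ((d : B) * zelt lam (d : B) (u : B)).
Proof.
rewrite !op_mulE zelt_op down_zed.
by rewrite [RHS](_ : _ = zelt lam u d * d * kin A mu) // kin_central.
Qed.

Fact op_down_zed : (u : B) * zelt lam (d : B) (u : B) =
  kin B mu * (zelt lam (d : B) (u : B) * (u : B)).
Proof.
rewrite !op_mulE zelt_op zed_up.
by rewrite [RHS](_ : _ = u * zelt lam u d * kin A mu) // kin_central.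
Qed.

(** In the opposite algebra a monomial is read backwards from its target, so the outer exponents
    change places. *)
Definition op_index (b : pbw_index V) : pbw_index V :=
  (pbw_tgt A b, (b.2.2, b.2.1.2, b.2.1.1)).

Lemma mon_op b : pbw_mon lam (vid A : V -> B) (d : B) (u : B) (op_index b) = mon A b.
Proof.
rewrite monP /pbw_mon /=; case: b => v [[i j] l] /=.
rewrite !op_mulE !op_expE; congr (_ * _). 
by rewrite zelt_op mulrA.
Qed.

Lemma op_index_surj b' : exists b, op_index b = b'.
Proof.
case: b' => w [[l j] i].
exists (iter (j + l) (downt A)^-1%g (iter (i + j) (upt A)^-1%g w), (i, j, l)).
rewrite /op_index /pbw_tgt /=; congr (_, _).
have H (s : {perm V}) n x : iter n s (iter n s^-1%g x) = x.
  by elim: n => // n ih; rewrite iterSr iterS permKV.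
by rewrite !H.
Qed.

Definition op_coord (x : B) : {malg k[pbw_index V]} :=
  malg_lift (fun b => << op_index b >>) (ocoord (x : A)).

Fact op_coord_lin c (x y : B) : op_coord (kin B c * x + y) = c *: op_coord x + op_coord y.
Proof.
rewrite /op_coord -linearP -ocoord_lin; congr (malg_lift _ (ocoord (_ + _))).
by rewrite kin_central.
Qed.

Fact op_coord_mon b : op_coord (pbw_mon lam (vid A : V -> B) (d : B) (u : B) b) = << b >>.
Proof.
by have [b' <-] := op_index_surj b; rewrite mon_op /op_coord ocoord_monE malg_liftU.
Qed.

Fact op_coordK (x : B) :
  malg_lift (fun b => pbw_mon lam (vid A : V -> B) (d : B) (u : B) b : kmod B) (op_coord x) = x.
Proof.
elim/(@ore_ind _ _ _ _ A): x => [|c b x ih].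
  by rewrite /op_coord ocoord0 !raddf0.
rewrite kin_central op_coord_lin linearP /= ih; congr (_ + _).
have -> : op_coord (mon A b) = << op_index b >>.
  by rewrite -mon_op op_coord_mon.
rewrite /= malg_liftU mon_op.
by rewrite -[LHS]/(kin B c * (mon A b : B)).
Qed.

Definition op_ore_datum : ore_datum V lam mu :=
  @OreDatum k V lam mu B (vid A) d u (downt A)^-1%g (upt A)^-1%g op_vidM (vid_sum A)
    op_vid_up op_vid_down op_upt_downt op_zed_up op_down_zed.

Definition op_ore_algebra : ore_algebra V lam mu :=
  @OreAlgebra k V lam mu op_ore_datum op_coord op_coord_lin op_coord_mon op_coordK.

End Opposite.

Section LeftNoetherian.
Context (k : fieldType) (V : finType) (lam mu : k) (A : ore_algebra V lam mu).

Lemma ore_left_noetherian : lam != 0 -> mu != 0 -> left_noetherian A.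
Proof. by move=> lam0 mu0; exact: (@ore_right_noetherian _ _ _ _ (op_ore_algebra A)). Qed.

Lemma degenerate_not_left_noetherian (v : V) : mu = 0 -> ~ left_noetherian A.
Proof. by move=> mu0; exact: (@degenerate_not_noetherian _ _ _ _ (op_ore_algebra A)). Qed.

End LeftNoetherian.

(** * Path algebras *)

Section LinearCombinations.
Context (k : fieldType) (W : lmodType k) (X Y Z : W).

(** Collecting coefficients of three fixed vectors reduces identities in a module to three
    identities in [k], which [ring] proves. *)
Definition lc3 (a b c : k) : W := a *: X + b *: Y + c *: Z.

Lemma lc3_12 a b : a *: X + b *: Y = lc3 a b 0.
Proof. by rewrite /lc3 scale0r addr0. Qed.
Lemma lc3_23 b c : b *: Y + c *: Z = lc3 0 b c.
Proof. by rewrite /lc3 scale0r add0r. Qed.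
Lemma lc3_1 a : a *: X = lc3 a 0 0.
Proof. by rewrite /lc3 !scale0r !addr0. Qed.
Lemma lc3_2 b : b *: Y = lc3 0 b 0.
Proof. by rewrite /lc3 !scale0r addr0 add0r. Qed.
Lemma lc3D a b c a' b' c' : lc3 a b c + lc3 a' b' c' = lc3 (a + a') (b + b') (c + c').
Proof. by rewrite /lc3 !scalerDl addrACA; congr (_ + _); rewrite addrACA. Qed.
Lemma lc3Z e a b c : e *: lc3 a b c = lc3 (e * a) (e * b) (e * c).
Proof. by rewrite /lc3 !scalerDr !scalerA. Qed.
Lemma lc3N a b c : - lc3 a b c = lc3 (- a) (- b) (- c).
Proof. by rewrite /lc3 !opprD !scaleNr. Qed.
Lemma lc3_eq0 a b c : a = 0 -> b = 0 -> c = 0 -> lc3 a b c = 0.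
Proof. by move=> -> -> ->; rewrite /lc3 !scale0r !addr0. Qed.

(** [Z'] stands for the vector of index [l.-1.+1] where [Z] has index [l]; they differ only for
    [l = 0], when the coefficient [c_ 0] is 0. *)
Lemma duu_combination (lam mu : k) l j (Z' : W) (c_ := qnum lam mu) :
  c_ l *: Z' = c_ l *: Z ->
  (lam ^+ l.+2 * mu ^+ j) *: ((lam ^+ l.+2 * mu ^+ j) *: X + c_ l.+2 *: Y) +
    c_ l.+2 *: ((lam ^+ l.+1 * mu ^+ j.+1) *: Y + c_ l.+1 *: Z) -
  ((lam + mu) *: ((lam ^+ l.+1 * mu ^+ j) *:
        ((lam ^+ l.+2 * mu ^+ j) *: X + c_ l.+2 *: Y) +
      c_ l.+1 *: ((lam ^+ l.+1 * mu ^+ j.+1) *: Y + c_ l.+1 *: Z)) +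
   - (lam * mu) *: ((lam ^+ l.+1 * mu ^+ j) *:
        ((lam ^+ l.+1 * mu ^+ j) *: X + c_ l.+1 *: Y) +
      c_ l.+1 *: ((lam ^+ l * mu ^+ j.+1) *: Y + c_ l *: Z'))) = 0.
Proof.
move=> ->.
rewrite !(lc3_12, lc3_23, lc3Z, lc3D, lc3N) /c_ /= !exprS.
by apply lc3_eq0; ring.
Qed.

Lemma duu_combination0 (lam mu : k) j (Y' Z' Z2 : W) (c_ := qnum lam mu) :
  (lam ^+ 1 * mu ^+ j) *: ((lam ^+ 1 * mu ^+ j) *: X + c_ 1%N *: Y) +
    c_ 1%N *: ((lam ^+ 0 * mu ^+ j.+1) *: Y + c_ 0%N *: Z) -
  ((lam + mu) *: ((lam ^+ 0 * mu ^+ j) *: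
        ((lam ^+ 1 * mu ^+ j) *: X + c_ 1%N *: Y) + c_ 0%N *: Z') +
   - (lam * mu) *: ((lam ^+ 0 * mu ^+ j) *:
        ((lam ^+ 0 * mu ^+ j) *: X + c_ 0%N *: Y') + c_ 0%N *: Z2)) = 0.
Proof.
rewrite /c_ /= !scale0r !addr0 !(lc3_1, lc3_2, lc3Z, lc3D, lc3N) !exprS expr0.
by apply lc3_eq0; ring.
Qed.

Lemma ddu_combination (lam mu : k) l j (c_ := qnum lam mu) :
  (lam ^+ l.+3 * mu ^+ j) *: X + c_ l.+3 *: Y -
  ((lam + mu) *: ((lam ^+ l.+2 * mu ^+ j) *: X + c_ l.+2 *: Y) +
   - (lam * mu) *: ((lam ^+ l.+1 * mu ^+ j) *: X + c_ l.+1 *: Y)) = 0.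
Proof.
rewrite !(lc3_12, lc3_23, lc3Z, lc3D, lc3N) /c_ /= !exprS.
by apply lc3_eq0; ring.
Qed.

Lemma ddu_combination0 (lam mu : k) j (Y' : W) (c_ := qnum lam mu) :
  (lam ^+ 2 * mu ^+ j) *: X + c_ 2%N *: Y -
  ((lam + mu) *: ((lam ^+ 1 * mu ^+ j) *: X + c_ 1%N *: Y) +
   - (lam * mu) *: ((lam ^+ 0 * mu ^+ j) *: X + c_ 0%N *: Y')) = 0.
Proof.
rewrite /c_ /= !scale0r !addr0 !(lc3_1, lc3_2, lc3Z, lc3D, lc3N) !exprS expr0.
by apply lc3_eq0; ring.
Qed.

End LinearCombinations.

Section CubicRelations.
Context (k : fieldType) (W : lmodType k) (lam mu : k) (U D : W -> W)
  (B : nat * nat * nat -> W).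
Local Notation c_ := (qnum lam mu).
Hypotheses
  (U2 : forall c c' m m', U (c *: m + c' *: m') = c *: U m + c' *: U m')
  (D2 : forall c c' m m', D (c *: m + c' *: m') = c *: D m + c' *: D m')
  (DB : forall i j l, D (B (i, j, l)) = B (i, j, l.+1))
  (UB : forall i j l, U (B (i, j, l)) =
    (lam ^+ l * mu ^+ j) *: B (i.+1, j, l) + c_ l *: B (i, j.+1, l.-1)).

(** The action is a right action, so the operators are applied in the order in which the letters of
    the word are read. *)
Lemma duu_mon i j l : U (U (D (B (i, j, l)))) -
  ((lam + mu) *: U (D (U (B (i, j, l)))) - (lam * mu) *: D (U (U (B (i, j, l))))) = 0.
Proof.
rewrite DB !UB !(U2, D2) !DB !UB !(U2, D2) !DB -scaleNr.
case: l => [|l]; [exact: duu_combination0|apply: duu_combination].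
by case: l => [|l]; rewrite //= !scale0r.
Qed.

Lemma ddu_mon i j l : U (D (D (B (i, j, l)))) -
  ((lam + mu) *: D (U (D (B (i, j, l)))) - (lam * mu) *: D (D (U (B (i, j, l))))) = 0.
Proof.
rewrite !DB !UB !D2 !DB -scaleNr.
case: l => [|l]; [exact: (ddu_combination0 _ _ 0)|exact: (ddu_combination _ _ 0)].
Qed.

End CubicRelations.

Section ZedRelations.
Context (k : fieldType) (A : kalgebra k) (lam mu : k) (u d : A).

Lemma zelt_up : d * u * u -
    (kin A (lam + mu) * (u * d * u) + kin A (- (lam * mu)) * (u * u * d)) = 0 ->
  zelt lam u d * u = kin A mu * (u * zelt lam u d).
Proof. by move=> h; apply: subr0_eq; rewrite -[RHS]h /zelt; nc_ring A. Qed.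

Lemma down_zelt : d * d * u -
    (kin A (lam + mu) * (d * u * d) + kin A (- (lam * mu)) * (u * d * d)) = 0 ->
  d * zelt lam u d = kin A mu * (zelt lam u d * d).
Proof. by move=> h; apply: subr0_eq; rewrite -[RHS]h /zelt; nc_ring A. Qed.

Lemma mul_zelt q : q * zelt lam u d = kin A (- lam) * (q * u * d) + q * d * u.
Proof. rewrite /zelt; nc_ring A. Qed.

End ZedRelations.

Lemma malg_supp_ind (k : fieldType) (K : choiceType) (D : K -> Prop)
    (P : {malg k[K]} -> Prop) : P 0 ->
  (forall c p x, D p -> P x -> P (c *: << p >> + x)) ->
  forall x, (forall p, p \in msupp x -> D p) -> P x.
Proof.
move=> P0 PS x xD; rewrite [x]monalgE big_seq; elim/big_rec: _ => // p y px Py.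
suff -> : << x@_p *g p >> = x@_p *: << p >> by apply: PS => //; exact: xD.
by apply/malgP => q; rewrite mcoeffZ !mcoeffU mulr_natr.
Qed.

(** * The monomial basis of a bound quiver algebra *)

Section QuiverInstance.
Context (k : fieldType) (Q : quiver) (ua da : vertex Q -> arrow Q)
  (tu td : {perm (vertex Q)}) (lam mu : k).
Local Notation V := (vertex Q).
Local Notation kQ := (path_algebra k Q).
Local Notation M := {malg k[pbw_index V]}.
Local Notation c_ := (qnum lam mu).
Hypotheses (ua_src : forall v, asrc (ua v) = v) (da_src : forall v, asrc (da v) = v)
  (ua_tgt : forall v, atgt (ua v) = tu v) (da_tgt : forall v, atgt (da v) = td v)
  (arrowP : forall a, a = ua (asrc a) \/ a = da (asrc a))
  (ua_da : forall v, da v != ua v) (tu_td : forall v, tu (td v) = td (tu v)).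

Lemma pa_ind (P : kQ -> Prop) :
  P 0 -> (forall c p x, P x -> P (c *: pelt p + x)) -> forall x, P x.
Proof.
move=> P0 PS; rewrite pelt.unlock in PS.
exact: (@malg_ind k (qpath Q) P P0 PS).
Qed.

Definition pa_total : (V -> arrow Q) -> kQ := locked (fun f => \sum_v pa_arrow k (f v)).
Definition pa_up : kQ := pa_total ua.
Definition pa_down : kQ := pa_total da.

Lemma pa_idemM v w : pa_idem k v * pa_idem k w = if v == w then pa_idem k v else 0 :> kQ.
Proof.
rewrite peltM /pmul /ptgt /psrc /=; case: eqP => // e; congr pelt.
by apply: val_inj; rewrite pcatE.
Qed.

Lemma pa_idem_arrow v (a : arrow Q) :
  pa_idem k v * pa_arrow k a = if v == asrc a then pa_arrow k a else 0.
Proof.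
rewrite peltM /pmul /ptgt /psrc /=; case: eqP => // e; congr pelt.
by apply: val_inj; rewrite pcatE //=; congr (_, _); exact: e.
Qed.

Lemma pa_arrow_idem v (a : arrow Q) :
  pa_arrow k a * pa_idem k v = if atgt a == v then pa_arrow k a else 0.
Proof.
rewrite peltM /pmul /ptgt /psrc /=; case: eqP => // e; congr pelt.
by apply: val_inj; rewrite pcatE //= cats0.
Qed.

Lemma pa_idem_total f v : (forall w, asrc (f w) = w) ->
  pa_idem k v * pa_total f = pa_arrow k (f v).
Proof.
move=> fE; rewrite /pa_total -lock mulr_sumr (bigD1 v) //= pa_idem_arrow fE eqxx.
by rewrite big1 ?addr0 // => w wv; rewrite pa_idem_arrow fE eq_sym (negPf wv).
Qed.

Lemma pa_total_idem f t v : (forall w, atgt (f w) = t w) -> injective t ->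
  pa_total f * pa_idem k (t v) = pa_arrow k (f v).
Proof.
move=> fE t_inj; rewrite /pa_total -lock mulr_suml (bigD1 v) //= pa_arrow_idem fE eqxx.
by rewrite big1 ?addr0 // => w wv; rewrite pa_arrow_idem fE (inj_eq t_inj) (negPf wv).
Qed.

Lemma pa_idem_up v : pa_idem k v * pa_up = pa_arrow k (ua v).
Proof. exact: pa_idem_total. Qed.

Lemma pa_idem_down v : pa_idem k v * pa_down = pa_arrow k (da v).
Proof. exact: pa_idem_total. Qed.

Lemma pa_up_idem v : pa_up * pa_idem k (tu v) = pa_arrow k (ua v).
Proof. exact/pa_total_idem/perm_inj. Qed.

Lemma pa_down_idem v : pa_down * pa_idem k (td v) = pa_arrow k (da v).
Proof. exact/pa_total_idem/perm_inj. Qed.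

Lemma pa_arrow_total a f : (forall w, asrc (f w) = w) ->
  pa_arrow k a * pa_total f = pa_arrow k a * pa_arrow k (f (atgt a)).
Proof.
move=> fE; rewrite -(pa_idem_total _ fE) mulrA.
by have -> : pa_arrow k a * pa_idem k (atgt a) = pa_arrow k a by rewrite pa_arrow_idem eqxx.
Qed.

Lemma pa_idem_total3 f g h v : (forall w, asrc (f w) = w) ->
  (forall w, asrc (g w) = w) -> (forall w, asrc (h w) = w) ->
  pa_idem k v * (pa_total f * pa_total g * pa_total h) =
  pa_arrow k (f v) * pa_arrow k (g (atgt (f v))) *
  pa_arrow k (h (atgt (g (atgt (f v))))).
Proof.
move=> fE gE hE; rewrite !mulrA (pa_idem_total v fE) (pa_arrow_total (f v) gE).
by rewrite -!mulrA (pa_arrow_total _ hE).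
Qed.

Lemma pa_mul_lin3 (c c' : k) (e x y z x' y' z' : kQ) :
  e * x = x' -> e * y = y' -> e * z = z' ->
  e * (x - (c *: y + c' *: z)) = x' - (c *: y' + c' *: z').
Proof.
move=> <- <- <-; refine (etrans (mulrBr e x _) (congr1 (fun t => e * x - t) _)).
refine (etrans (mulrDr e _ _) (congr2 +%R _ _)); exact: (esym (pa_scaleAr _ e _)).
Qed.

Lemma pelt_prod v s (h : is_walk v s) :
  pelt (@QPath Q (v, s) h) = pa_idem k v * \prod_(a <- s) pa_arrow k a.
Proof.
elim: s v h => [|a s ih] v h.
  by rewrite big_nil mulr1; congr pelt; apply: val_inj.
have /= /andP[/eqP av hs] := h; rewrite big_cons mulrA pa_idem_arrow av eqxx.
have -> : pa_arrow k a = pa_arrow k a * pa_idem k (atgt a) by rewrite pa_arrow_idem eqxx.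
rewrite -mulrA -(ih _ hs) peltM /pmul /ptgt /psrc /= eqxx; congr pelt.
by apply: val_inj; rewrite pcatE //= /psrc /= av.
Qed.

(* The path algebra acts on the free module on the would-be normal forms;
   the coordinates of an element are its value at the sum [bone] of the trivial
   ones. *)
Definition btgt (b : pbw_index V) : V :=
  iter (b.2.1.1 + b.2.1.2) tu (iter (b.2.1.2 + b.2.2) td b.1).

Definition bel : pbw_index V -> M := locked (fun b => << b >>).

Lemma belE b : bel b = << b >>.
Proof. by rewrite /bel -lock. Qed.

Lemma malg_lift_bel (W : lmodType k) (f : pbw_index V -> W) b : malg_lift f (bel b) = f b.
Proof. by rewrite belE malg_liftU. Qed.

Lemma bel_ind (P : M -> Prop) :
  P 0 -> (forall c b m, P m -> P (c *: bel b + m)) -> forall m, P m.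
Proof. by move=> P0 PS; apply: (@malg_ind k (pbw_index V) P P0) => c b m; rewrite -belE; exact: PS. Qed.

(** The formula that [mon_up] forces on right multiplication by [u] once the monomials are normal
    forms. *)
Definition bup : pbw_index V -> M := locked (fun b => let: (v, (i, j, l)) := b in
  (lam ^+ l * mu ^+ j) *: bel (v, (i.+1, j, l)) + c_ l *: bel (v, (i, j.+1, l.-1))).

Definition bdown : pbw_index V -> M := locked (fun b => let: (v, (i, j, l)) := b in
  bel (v, (i, j, l.+1))).

Lemma bupE v i j l : bup (v, (i, j, l)) =
  (lam ^+ l * mu ^+ j) *: bel (v, (i.+1, j, l)) + c_ l *: bel (v, (i, j.+1, l.-1)).
Proof. by rewrite /bup -lock. Qed.

Lemma bdownE v i j l : bdown (v, (i, j, l)) = bel (v, (i, j, l.+1)).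
Proof. by rewrite /bdown -lock. Qed.

Definition bproj (v : V) (b : pbw_index V) : M := if btgt b == v then bel b else 0.

Definition barrow (a : arrow Q) (b : pbw_index V) : M :=
  if btgt b == asrc a then (if a == ua (asrc a) then bup b else bdown b) else 0.

Definition act_path (p : qpath Q) (m : M) : M :=
  foldl (fun m a => malg_lift (barrow a) m) (malg_lift (bproj (psrc p)) m) p.2.

Definition act : kQ -> M -> M := locked (fun x m => malg_lift (fun p => act_path p m) x).

Lemma act0l m : act 0 m = 0. Proof. by rewrite /act -lock raddf0. Qed.
Lemma actDl c x y m : act (c *: x + y) m = c *: act x m + act y m.
Proof. by rewrite /act -lock; exact: linearP. Qed.
Lemma act_pelt p m : act (pelt p) m = act_path p m.
Proof. by rewrite pelt.unlock /act -lock malg_liftU. Qed.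

Fact act_path_linear p : linear (act_path p).
Proof.
move=> c m m'; rewrite /act_path linearP /=; move: (malg_lift _ m) (malg_lift _ m').
by elim: (val p).2 => [|a s ih] n n' //=; rewrite linearP ih.
Qed.

Fact act_linear x : linear (act x).
Proof.
move=> c m m'; rewrite /act -lock /malg_lift scaler_sumr -big_split /=.
by apply: eq_bigr => p _; rewrite act_path_linear scalerDr !scalerA mulrC.
Qed.
Lemma actDr x c m m' : act x (c *: m + m') = c *: act x m + act x m'.
Proof. exact: act_linear. Qed.
HB.instance Definition _ x := GRing.isLinear.Build k M M _ (act x) (act_linear x).

Lemma malg_lift2 (f : pbw_index V -> M) c c' (m m' : M) :
  malg_lift f (c *: m + c' *: m') = c *: malg_lift f m + c' *: malg_lift f m'.
Proof. by rewrite linearP /= malg_liftZ. Qed.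

Lemma bproj_bproj v w m : malg_lift (bproj w) (malg_lift (bproj v) m) =
  if v == w then malg_lift (bproj v) m else 0.
Proof.
have e b : malg_lift (bproj w) (bproj v b) = if v == w then bproj v b else 0.
  rewrite [bproj v b]/bproj; case: (eqVneq (btgt b) v) => [<-|_].
    by rewrite malg_lift_bel /bproj.
  by rewrite raddf0; case: ifP.
elim/bel_ind: m => [|c b m ih]; first by rewrite !raddf0; case: ifP.
by rewrite !linearP /= ih !malg_lift_bel e; case: eqP; rewrite // scaler0 addr0.
Qed.

Lemma btgt_up v i j l : btgt (v, (i.+1, j, l)) = tu (btgt (v, (i, j, l))).
Proof. by []. Qed.

Lemma iter_tu_td m n v : iter m tu (iter n td (td v)) = td (iter m tu (iter n td v)).
Proof.
rewrite -iterSr /=; elim: m => //= m ->; exact: tu_td.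
Qed.

Lemma btgt_down v i j l : btgt (v, (i, j, l.+1)) = td (btgt (v, (i, j, l))).
Proof. by rewrite /btgt /= addnS iterSr iter_tu_td. Qed.

Lemma btgt_zed v i j l : btgt (v, (i, j.+1, l)) = tu (btgt (v, (i, j, l.+1))).
Proof. by rewrite /btgt /= !addnS. Qed.

Lemma bproj_barrow w a m : malg_lift (bproj w) (malg_lift (barrow a) m) =
  if atgt a == w then malg_lift (barrow a) m else 0.
Proof.
elim/bel_ind: m => [|c b m ih]; first by rewrite !raddf0; case: ifP.
rewrite !linearP /= ih !malg_lift_bel.
suff -> : malg_lift (bproj w) (barrow a b) = if atgt a == w then barrow a b else 0.
  by case: eqP => // _; rewrite scaler0 addr0.
rewrite /barrow; case: (eqVneq (btgt b) (asrc a)) => [e|_]; last by rewrite raddf0; case: ifP.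
case: b e => v [[i j] l] e; case: eqP => [ea|/eqP ea].
  rewrite bupE malg_lift2 !malg_lift_bel /bproj btgt_up e ea ua_src ua_tgt.
  case: l e => [|l] e /=; first by rewrite !scale0r !addr0; case: eqP; rewrite ?scaler0.
  rewrite btgt_zed e; case: eqP => //; rewrite !scaler0 addr0 //.
have -> : atgt a = td (asrc a).
  by case: (arrowP a) ea => {1 3}->; rewrite ?eqxx // da_tgt.
by rewrite bdownE malg_lift_bel /bproj btgt_down e.
Qed.

(** Ensures that paths that cannot be concatenated compose to the zero operator. *)
Lemma bproj_act_path p w m : malg_lift (bproj w) (act_path p m) =
  if ptgt p == w then act_path p m else 0.
Proof.
rewrite /act_path /ptgt /walk_end; elim/last_ind: (val p).2 => [|s a _] /=.
  exact: bproj_bproj.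
by rewrite -cats1 foldl_cat /= bproj_barrow map_cat last_cat.
Qed.

Lemma act_path0 (s : seq (arrow Q)) :
  foldl (fun m a => malg_lift (barrow a) m) (0 : M) s = 0.
Proof. by elim: s => //= a s ih; rewrite raddf0. Qed.

Lemma act_mul x y m : act (x * y) m = act y (act x m).
Proof.
elim/pa_ind: x => [|c p x ihx]; first by rewrite mul0r !act0l raddf0.
rewrite mulrDl -pa_scaleAl (actDl c (pelt p * y)) (actDl c (pelt p)) actDr ihx.
suff -> : act (pelt p * y) m = act y (act (pelt p) m) by [].
elim/pa_ind: y {x c ihx} => [|e q y ihy]; first by rewrite mulr0 !act0l.
rewrite mulrDr -pa_scaleAr (actDl e (pelt p * pelt q)) (actDl e (pelt q)) ihy.
suff -> : act (pelt p * pelt q) m = act (pelt q) (act (pelt p) m) by [].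
rewrite peltM /pmul !act_pelt [act_path q _]/act_path bproj_act_path.
case: eqP => [pq|_]; last by rewrite act0l act_path0.
by rewrite act_pelt /act_path (psrc_cat pq) -foldl_cat (pcatE pq).
Qed.

Lemma act_idem v m : act (pa_idem k v) m = malg_lift (bproj v) m.
Proof. by rewrite act_pelt. Qed.

Lemma act_arrow a b : act (pa_arrow k a) (bel b) = barrow a b.
Proof.
rewrite act_pelt /act_path /= malg_lift_bel /bproj /psrc /=.
case: eqP => [e|/eqP ne]; first by rewrite malg_lift_bel.
by rewrite raddf0 /barrow (negPf ne).
Qed.

Lemma act_sum (I : Type) (r : seq I) (F : I -> kQ) m :
  act (\sum_(i <- r) F i) m = \sum_(i <- r) act (F i) m.
Proof.
apply: (big_morph (fun x => act x m)) => [x y|]; last exact: act0l.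
by have := actDl 1 x y m; rewrite !scale1r.
Qed.

Lemma act_up b : act pa_up (bel b) = bup b.
Proof.
rewrite /pa_up /pa_total -lock act_sum (bigD1 (btgt b)) //= act_arrow /barrow ua_src !eqxx.
rewrite big1 ?addr0 // => v vb.
by rewrite act_arrow /barrow ua_src eq_sym (negPf vb).
Qed.

Lemma act_down b : act pa_down (bel b) = bdown b.
Proof.
rewrite /pa_down /pa_total -lock act_sum (bigD1 (btgt b)) //= act_arrow /barrow da_src eqxx (negPf (ua_da _)).
rewrite big1 ?addr0 // => v vb.
by rewrite act_arrow /barrow da_src eq_sym (negPf vb).
Qed.

Definition pa_duu : kQ := pa_down * pa_up * pa_up -
  ((lam + mu) *: (pa_up * pa_down * pa_up) + (- (lam * mu)) *: (pa_up * pa_up * pa_down)).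
Definition pa_ddu : kQ := pa_down * pa_down * pa_up -
  ((lam + mu) *: (pa_down * pa_up * pa_down) + (- (lam * mu)) *: (pa_up * pa_down * pa_down)).

Lemma act0r x : act x 0 = 0. Proof. exact: raddf0. Qed.
Lemma actZ x c m : act (c *: x) m = c *: act x m.
Proof. by rewrite -[c *: x]addr0 (actDl c x 0) act0l addr0. Qed.
Lemma actZr x c m : act x (c *: m) = c *: act x m.
Proof. by rewrite -[c *: m]addr0 actDr act0r addr0. Qed.
Lemma act2 x c c' m m' : act x (c *: m + c' *: m') = c *: act x m + c' *: act x m'.
Proof. by rewrite actDr actZr. Qed.

Lemma actB x y m : act (x - y) m = act x m - act y m.
Proof. by rewrite -[- y]scaleN1r addrC (actDl (-1) y x) scaleN1r addrC. Qed.

Lemma act_cubic (c c' : k) (x1 x2 x3 y1 y2 y3 z1 z2 z3 : kQ) m :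
  act (x1 * x2 * x3 - (c *: (y1 * y2 * y3) + c' *: (z1 * z2 * z3))) m =
  act x3 (act x2 (act x1 m)) - (c *: act y3 (act y2 (act y1 m)) +
                                c' *: act z3 (act z2 (act z1 m))).
Proof.
have e (x y w : kQ) : act (x * y * w) m = act w (act y (act x m)).
  by rewrite (act_mul (x * y) w) (act_mul x y).
by rewrite (actB (x1 * x2 * x3)) (actDl c (y1 * y2 * y3)) (actZ (z1 * z2 * z3)) !e.
Qed.

Lemma act_duu_mon v i j l : act pa_duu (bel (v, (i, j, l))) = 0.
Proof.
rewrite /pa_duu act_cubic scaleNr.
apply: (@duu_mon k M lam mu (act pa_up) (act pa_down) (fun b => bel (v, b))).
- by move=> c c' m m'; rewrite act2.
- by move=> c c' m m'; rewrite act2.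
- by move=> *; rewrite act_down bdownE.
- by move=> *; rewrite act_up bupE.
Qed.

Lemma act_ddu_mon v i j l : act pa_ddu (bel (v, (i, j, l))) = 0.
Proof.
rewrite /pa_ddu act_cubic scaleNr.
apply: (@ddu_mon k M lam mu (act pa_up) (act pa_down) (fun b => bel (v, b))).
- by move=> c c' m m'; rewrite act2.
- by move=> *; rewrite act_down bdownE.
- by move=> *; rewrite act_up bupE.
Qed.

Lemma act_eq0 x : (forall b, act x (bel b) = 0) -> forall m, act x m = 0.
Proof.
by move=> x0; elim/bel_ind => [|c b m ih]; rewrite ?act0r // actDr x0 ih scaler0 addr0.
Qed.


Lemma act_duu m : act pa_duu m = 0.
Proof. by apply: act_eq0 => -[v [[i j] l]]; exact: act_duu_mon. Qed.

Lemma act_ddu m : act pa_ddu m = 0.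
Proof. by apply: act_eq0 => -[v [[i j] l]]; exact: act_ddu_mon. Qed.

Context (rel : set kQ).
Hypothesis relP : forall r, rel r <->
  exists v, r = pa_idem k v * pa_duu \/ r = pa_idem k v * pa_ddu.
Local Notation B := (bqa_kalgebra rel).
Local Notation pi := (@bqa_pi k Q rel : kQ -> B).

Lemma act_ideal x m : x \in lspan (ideal_gens rel) -> act x m = 0.
Proof.
move: x; apply: lspan_sub => [|_ [x [r [y [/relP[v rE] ->]]]]]; first split.
- exact: act0l.
- by move=> c x y x0 y0; rewrite actDl x0 y0 scaler0 addr0.
rewrite act_mul act_mul; case: rE => ->; rewrite act_mul.
  by rewrite act_duu act0r.
by rewrite act_ddu act0r.
Qed.

Lemma pi_mul x y : pi (x * y) = pi x * pi y. Proof. exact: bqa_piM. Qed.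
Lemma pi_scale c x : pi (c *: x) = kin B c * pi x.
Proof.
have -> : kin B c = pi (c *: (1 : kQ)) by exact: bqa_inE.
by rewrite -pi_mul -pa_scaleAl mul1r.
Qed.
Lemma piD x y : pi (x + y) = pi x + pi y. Proof. exact: bqa_piD. Qed.
Lemma piN x : pi (- x) = - pi x.
Proof. by rewrite -scaleN1r pi_scale rmorphN1 mulN1r. Qed.
Lemma pi0 : pi 0 = 0.
Proof. by have := pi_scale 0 0; rewrite scale0r rmorph0 mul0r. Qed.
Lemma pi_sum (I : Type) (r : seq I) F : pi (\sum_(i <- r) F i) = \sum_(i <- r) pi (F i).
Proof. exact: (big_morph _ piD pi0). Qed.
Lemma pi1 : pi 1 = 1. Proof. by []. Qed.

Lemma pi_rel x : (forall v, rel (pa_idem k v * x)) -> pi x = 0.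
Proof.
move=> xr; have -> : x = \sum_v pa_idem k v * x by rewrite -mulr_suml mul1r.
rewrite pi_sum big1 // => v _; rewrite -pi0; apply/lquot_piP; rewrite subr0.
by apply: lspan_gen; exists 1, (pa_idem k v * x), 1; rewrite mul1r mulr1.
Qed.

Lemma pi_duu : pi pa_duu = 0.
Proof. by apply: pi_rel => v; apply/relP; exists v; left. Qed.

Lemma pi_ddu : pi pa_ddu = 0.
Proof. by apply: pi_rel => v; apply/relP; exists v; right. Qed.

Lemma pi_idemM v w : pi (pa_idem k v) * pi (pa_idem k w) = if v == w then pi (pa_idem k v) else 0.
Proof. by rewrite -pi_mul pa_idemM; case: ifP => // _; exact: pi0. Qed.

Lemma pi_idem_sum : \sum_v pi (pa_idem k v) = 1.
Proof. by rewrite -pi_sum. Qed.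

Lemma pi_idem_up v : pi (pa_idem k v) * pi pa_up = pi pa_up * pi (pa_idem k (tu v)).
Proof. by rewrite -!pi_mul pa_idem_up pa_up_idem. Qed.

Lemma pi_idem_down v : pi (pa_idem k v) * pi pa_down = pi pa_down * pi (pa_idem k (td v)).
Proof. by rewrite -!pi_mul pa_idem_down pa_down_idem. Qed.

Lemma pi_cubic (c c' : k) (x1 x2 x3 y1 y2 y3 z1 z2 z3 : kQ) :
  pi (x1 * x2 * x3 - (c *: (y1 * y2 * y3) + c' *: (z1 * z2 * z3))) =
  pi x1 * pi x2 * pi x3 - (kin B c * (pi y1 * pi y2 * pi y3) +
                           kin B c' * (pi z1 * pi z2 * pi z3)).
Proof.
have e (x y w : kQ) : pi (x * y * w) = pi x * pi y * pi w.
  exact: (etrans (pi_mul (x * y) w) (congr1 ( *%R^~ (pi w)) (pi_mul x y))).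
move: (e x1 x2 x3) (e y1 y2 y3) (e z1 z2 z3).
move: (x1 * x2 * x3) (y1 * y2 * y3) (z1 * z2 * z3) => x y z <- <- <-.
refine (etrans (piD x (- (c *: y + c' *: z))) (congr1 (+%R (pi x)) _)).
refine (etrans (piN (c *: y + c' *: z)) (congr1 -%R _)).
exact: (etrans (piD (c *: y) (c' *: z)) (congr2 +%R (pi_scale c y) (pi_scale c' z))).
Qed.

Lemma pi_zed_up : zelt lam (pi pa_up) (pi pa_down) * pi pa_up =
  kin B mu * (pi pa_up * zelt lam (pi pa_up) (pi pa_down)).
Proof. by apply: zelt_up; have := pi_duu; rewrite /pa_duu pi_cubic. Qed.

Lemma pi_down_zed : pi pa_down * zelt lam (pi pa_up) (pi pa_down) =
  kin B mu * (zelt lam (pi pa_up) (pi pa_down) * pi pa_down).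
Proof. by apply: down_zelt; have := pi_ddu; rewrite /pa_ddu pi_cubic. Qed.

Definition quiver_datum : ore_datum V lam mu :=
  OreDatum pi_idemM pi_idem_sum pi_idem_up pi_idem_down tu_td pi_zed_up pi_down_zed.


Local Notation mon := (mon quiver_datum).

Definition bone : M := \sum_v bel (v, (0, 0, 0)%N).

Definition quiver_coord (q : quiver_datum) : M := act (lquot_repr (q : bqa rel)) bone.

Lemma quiver_coord_pi x : quiver_coord (pi x) = act x bone.
Proof.
apply: subr0_eq; rewrite /quiver_coord -(actB (lquot_repr _ : kQ) x).
by apply: act_ideal; apply/lquot_piP; exact: lquot_reprK.
Qed.

Lemma pi_ind (P : quiver_datum -> Prop) : (forall x, P (pi x)) -> forall q, P q.
Proof. exact: bqa_ind. Qed.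

Lemma quiver_coord_lin c x y :
  quiver_coord (kin quiver_datum c * x + y) = c *: quiver_coord x + quiver_coord y.
Proof.
elim/pi_ind: x => x; elim/pi_ind: y => y.
have -> : kin quiver_datum c * pi x + pi y = pi (c *: x + y) by rewrite piD pi_scale.
by rewrite !quiver_coord_pi actDl.
Qed.

Lemma quiver_coord_mul q x : quiver_coord (q * pi x) = act x (quiver_coord q).
Proof. by elim/pi_ind: q => y; rewrite -pi_mul !quiver_coord_pi act_mul. Qed.

Lemma act_idem_bel v b : act (pa_idem k v) (bel b) = if btgt b == v then bel b else 0.
Proof. by rewrite act_idem malg_lift_bel. Qed.

Lemma act1_bel b : act 1 (bel b) = bel b.
Proof.
have -> : (1 : kQ) = \sum_v pa_idem k v by [].
rewrite act_sum (bigD1 (btgt b)) //= act_idem_bel eqxx big1 ?addr0 // => v vb.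
by rewrite act_idem_bel eq_sym (negPf vb).
Qed.

Lemma act1 m : act 1 m = m.
Proof.
by elim/bel_ind: m => [|c b m ih]; rewrite ?act0r // actDr ih act1_bel.
Qed.

Lemma quiver_coord_idem v : quiver_coord (pi (pa_idem k v)) = bel (v, (0, 0, 0)%N).
Proof.
rewrite quiver_coord_pi /bone raddf_sum (bigD1 v) //= act_idem_bel /btgt /= eqxx big1 ?addr0 //.
by move=> w wv; rewrite act_idem_bel /btgt /= (negPf wv).
Qed.

Lemma quiver_coord_up q v i j l : quiver_coord q = bel (v, (i, j, l)) ->
  quiver_coord (q * up quiver_datum) =
  (lam ^+ l * mu ^+ j) *: bel (v, (i.+1, j, l)) + c_ l *: bel (v, (i, j.+1, l.-1)).
Proof. by move=> e; rewrite quiver_coord_mul e act_up bupE. Qed.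

Lemma quiver_coord_down q v i j l : quiver_coord q = bel (v, (i, j, l)) ->
  quiver_coord (q * down quiver_datum) = bel (v, (i, j, l.+1)).
Proof. by move=> e; rewrite quiver_coord_mul e act_down bdownE. Qed.

(** In [q * d * u] and [lam q * u * d] the contributions with one more [u] and one [d] cancel, and
    [c_ 1 = 1] leaves the monomial with one more [z]. *)
Lemma quiver_coord_zed q v i j : quiver_coord q = bel (v, (i, j, 0%N)) ->
  quiver_coord (q * zelt lam (up quiver_datum) (down quiver_datum)) = bel (v, (i, j.+1, 0%N)).
Proof.
move=> e; rewrite mul_zelt.
rewrite quiver_coord_lin (quiver_coord_up (quiver_coord_down e)).
rewrite (quiver_coord_mul _ pa_down) (quiver_coord_up e) act2 !act_down !bdownE.
rewrite /= !(expr0, mul1r, expr1, mulr0, addr0, scale0r, scale1r).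
by rewrite !scalerA mulNr scaleNr addKr.
Qed.

Lemma quiver_coord_mon b : quiver_coord
  (pbw_mon lam (@vid _ _ _ _ quiver_datum) (up quiver_datum) (down quiver_datum) b) = << b >>.
Proof.
case: b => v [[i j] l]; rewrite -belE /pbw_mon /= !mulrA.
elim: l => [|l ih]; last by rewrite exprSr mulrA (quiver_coord_down ih).
rewrite expr0 mulr1; elim: j => [|j ih]; last by rewrite exprSr mulrA (quiver_coord_zed ih).
rewrite expr0 mulr1; elim: i => [|i ih]; first by rewrite expr0 mulr1 quiver_coord_idem.
by rewrite exprSr mulrA (quiver_coord_up ih) !expr0 mul1r scale0r addr0 scale1r.
Qed.

Definition qval (m : M) : quiver_datum :=
  locked (fun m => malg_lift (fun b => mon b : kmod quiver_datum) m) m.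

Lemma qval_lin c m m' : qval (c *: m + m') = kin quiver_datum c * qval m + qval m'.
Proof. by rewrite /qval -lock linearP. Qed.
Lemma qval0 : qval 0 = 0.
Proof. by rewrite /qval -lock raddf0. Qed.
Lemma qvalZ c m : qval (c *: m) = kin quiver_datum c * qval m.
Proof. by rewrite -[c *: m]addr0 qval_lin qval0 addr0. Qed.
Lemma qval_bel b : qval (bel b) = mon b.
Proof. by rewrite /qval -lock belE malg_liftU. Qed.

Lemma qval_act_gen x : (forall b, qval (act x (bel b)) = mon b * pi x) ->
  forall m, qval (act x m) = qval m * pi x.
Proof.
move=> xb; elim/bel_ind => [|c b m ih]; first by rewrite act0r qval0 mul0r.
by rewrite actDr !qval_lin xb ih qval_bel mulrDl !mulrA.
Qed.

Lemma qval_idem v m : qval (act (pa_idem k v) m) = qval m * pi (pa_idem k v).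
Proof.
apply: qval_act_gen => b; rewrite act_idem_bel.
rewrite [RHS](mon_vid quiver_datum b v) -[pbw_tgt _ b]/(btgt b).
by case: ifP; rewrite ?qval0 ?qval_bel.
Qed.

Lemma qval_up m : qval (act pa_up m) = qval m * pi pa_up.
Proof.
apply: qval_act_gen => -[v [[i j] l]]; rewrite act_up bupE qval_lin qvalZ !qval_bel.
by rewrite [RHS](@mon_up _ _ _ _ quiver_datum v i j l).
Qed.

Lemma qval_down m : qval (act pa_down m) = qval m * pi pa_down.
Proof.
apply: qval_act_gen => -[v [[i j] l]]; rewrite act_down bdownE qval_bel.
by rewrite [RHS](@mon_down _ _ _ _ quiver_datum v i j l).
Qed.

Lemma qval_arrow a m : qval (act (pa_arrow k a) m) = qval m * pi (pa_arrow k a).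
Proof.
by case: (arrowP a) => ->; rewrite -?(pa_idem_up, pa_idem_down) act_mul
  ?(qval_up, qval_down) qval_idem pi_mul mulrA.
Qed.

(** Sending basis vectors to monomials intertwines the action with right multiplication. Evaluated
    at [bone], which goes to 1, this yields spanning without any rewriting of paths. *)
Lemma qval_act x m : qval (act x m) = qval m * pi x.
Proof.
elim/pa_ind: x => [|c [[v s] h] x ih]; first by rewrite act0l qval0 pi0 mulr0.
rewrite actDl qval_lin ih piD pi_scale mulrDr kinAC.
suff -> : qval (act (pelt (QPath h)) m) = qval m * pi (pelt (QPath h)) by [].
rewrite pelt_prod act_mul pi_mul mulrA -qval_idem; move: (act _ m) => {ih h}n.
elim: s n => [|a s ih] n; first by rewrite big_nil pi1 mulr1 act1.
by rewrite big_cons act_mul ih qval_arrow pi_mul mulrA.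
Qed.

Lemma quiver_coordK x : malg_lift (fun b => pbw_mon lam (@vid _ _ _ _ quiver_datum)
  (up quiver_datum) (down quiver_datum) b : kmod quiver_datum) (quiver_coord x) = x.
Proof.
elim/pi_ind: x => x; rewrite quiver_coord_pi.
have -> : malg_lift (fun b => pbw_mon lam (@vid _ _ _ _ quiver_datum)
  (up quiver_datum) (down quiver_datum) b : kmod quiver_datum) (act x bone) =
  qval (act x bone).
  rewrite /qval -lock; apply: (congr1 (fun f => malg_lift f (act x bone))).
  by apply/funext => b; rewrite /mon -lock.
suff e : qval bone = 1 by rewrite qval_act e mul1r.
rewrite -(vid_sum quiver_datum) /bone.
have qs (r : seq V) (F : V -> M) : qval (\sum_(i <- r) F i) = \sum_(i <- r) qval (F i).
  apply: (big_morph qval) => [m m'|]; last exact: qval0.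
  by have := qval_lin 1 m m'; rewrite scale1r rmorph1 mul1r.
by rewrite qs; apply: eq_bigr => v _; rewrite qval_bel monE !expr0 !mulr1.
Qed.

Definition quiver_ore : ore_algebra V lam mu :=
  OreAlgebra quiver_coord_lin quiver_coord_mon quiver_coordK.


(** * The grading by path length in terms of monomials *)

Lemma pa_homog_ind e (P : kQ -> Prop) : P 0 ->
  (forall c p x, (plen p)%:Z = e -> P x -> P (c *: pelt p + x)) ->
  forall x, pa_homog e x -> P x.
Proof.
move=> P0 PS; rewrite pelt.unlock in PS; exact: malg_supp_ind.
Qed.

Lemma pa_homog0 e : @pa_homog k Q e (0 : kQ).
Proof. by move=> p; rewrite msupp0. Qed.

Lemma pa_homog_lin e c (x y : kQ) : @pa_homog k Q e x -> @pa_homog k Q e y -> @pa_homog k Q e (c *: x + y).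
Proof.
move=> xe ye p /(fsubsetP (msuppD_le _ _)); rewrite in_fsetU => /orP[|]; last exact: ye.
by move=> /(fsubsetP (msuppZ_le _ _)); exact: xe.
Qed.

Lemma pa_homog_pelt p : @pa_homog k Q (plen p)%:Z (pelt p : kQ).
Proof. by move=> q; rewrite pelt.unlock => /(fsubsetP (msuppU_le)); rewrite inE => /eqP ->. Qed.

Lemma pa_homogM e f (x y : kQ) : @pa_homog k Q e x -> @pa_homog k Q f y -> @pa_homog k Q (e + f) (x * y).
Proof.
move=> xe yf; move: x xe; apply: pa_homog_ind => [|c p x <-{e} xy].
  by rewrite mul0r; exact: pa_homog0.
rewrite mulrDl -pa_scaleAl; apply: pa_homog_lin => //; move: y yf {xy}.
apply: pa_homog_ind => [|c' q y <-{f} py]; first by rewrite mulr0; exact: pa_homog0.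
rewrite mulrDr -pa_scaleAr; apply: pa_homog_lin => //; rewrite peltM /pmul.
case: eqP => [pq|_]; last exact: pa_homog0.
suff -> : (plen p)%:Z + (plen q)%:Z = (plen (pcat p q))%:Z by exact: pa_homog_pelt.
by rewrite -PoszD /plen (pcatE pq) size_cat.
Qed.

Lemma pa_homog_idem v : @pa_homog k Q 0 (pa_idem k v).
Proof. exact (pa_homog_pelt (p := ptriv v)). Qed.

Lemma pa_homog_total f : @pa_homog k Q 1 (pa_total f).
Proof.
rewrite /pa_total -lock; elim/big_rec: _ => [|v x _ x1]; first exact: pa_homog0.
rewrite -[pa_arrow k _]scale1r; apply: pa_homog_lin x1.
exact (pa_homog_pelt (p := parrow _)).
Qed.

Local Notation homog := (@bqa_homog k Q rel : int -> set quiver_datum).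

Lemma homog_lin e c x y : homog e x -> homog e y -> homog e (kin quiver_datum c * x + y).
Proof.
move=> [x' xe <-] [y' ye <-]; exists (c *: x' + y'); first exact: pa_homog_lin.
by rewrite [LHS](piD (c *: x')) (pi_scale c x').
Qed.

Lemma homog0 e : homog e 0.
Proof. by exists 0; [exact: pa_homog0|exact: pi0]. Qed.

Lemma homogM e f x y : homog e x -> homog f y -> homog (e + f) (x * y).
Proof.
move=> [x' xe <-] [y' ye <-]; exists (x' * y'); first exact: pa_homogM.
exact: pi_mul.
Qed.

Lemma homogX e n x : homog e x -> homog (e *+ n) (x ^+ n).
Proof.
move=> xe; elim: n => [|n ih]; last by rewrite exprS mulrS; exact: homogM.
exists 1; last exact: pi1.
have -> : (1 : kQ) = \sum_v pa_idem k v by [].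
elim/big_rec: _ => [|v y _ y0]; first exact: pa_homog0.
by rewrite -[pa_idem k _]scale1r; apply/pa_homog_lin/y0/pa_homog_idem.
Qed.

Lemma homog_up : homog 1 (up quiver_datum).
Proof. by exists pa_up => //; exact: pa_homog_total. Qed.

Lemma homog_down : homog 1 (down quiver_datum).
Proof. by exists pa_down => //; exact: pa_homog_total. Qed.

Lemma homog_zed : homog 2 (zelt lam (up quiver_datum) (down quiver_datum)).
Proof.
rewrite -[zelt _ _ _]mul1r mul_zelt !mul1r -[2]/(1 + 1).
by apply: homog_lin; apply: homogM; (exact: homog_up || exact: homog_down).
Qed.

Lemma homog_mon b : homog (pbw_len b)%:Z (mon b).
Proof.
case: b => v [[i j] l]; rewrite monE /pbw_len /=.
have -> : (i + j.*2 + l)%:Z = 0 + (1 *+ i + 2 *+ j + 1 *+ l) :> int by lia.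
apply: homogM; first by exists (pa_idem k v) => //; exact: pa_homog_idem.
apply/homogM/homogX/homog_down; apply/homogM/homogX/homog_zed.
exact/homogX/homog_up.
Qed.

Lemma ore_gr_pelt p : ore_gr (A := quiver_ore) (plen p)%:Z (pi (pelt p)).
Proof.
case: p => -[v s] h; rewrite pelt_prod pi_mul -[(plen _)%:Z]add0r; apply: ore_grM.
  exact: (ore_gr_vid quiver_ore).
rewrite /plen /= {h}; elim: s => [|a s ih].
  by rewrite big_nil; exact: (ore_gr1 quiver_ore).
rewrite big_cons pi_mul /= -add1n PoszD; apply: ore_grM ih.
case: (arrowP a) => ->; rewrite -?(pa_idem_up, pa_idem_down) pi_mul -[1%:Z]add0r;
  apply: ore_grM; do ?[exact: (ore_gr_vid quiver_ore)|exact: (ore_gr_up quiver_ore)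
                      |exact: (ore_gr_down quiver_ore)].
Qed.

Lemma quiver_grading : homog = @ore_gr _ _ _ _ quiver_ore.
Proof.
apply/funext => e; apply/seteqP; split=> [_ [x xe <-]|x].
  move: x xe; apply: pa_homog_ind => [|c p x <- {e} hx].
    by rewrite [bqa_pi _ _]pi0; exact: ore_gr0.
  rewrite [bqa_pi _ _](piD (c *: pelt p)) (pi_scale c (pelt p)).
  by apply: ore_grD hx; apply: ore_grZ; exact: ore_gr_pelt.
rewrite /ore_gr /= => <-; move: x.
apply: (@ore_ind _ _ _ _ quiver_ore) => [|c b x hx]; first by rewrite oproj0; exact: homog0.
rewrite oprojD oprojZ oproj_mon; apply: homog_lin hx.
by case: eqP => [<-|_]; [exact: homog_mon|exact: homog0].
Qed.

Lemma pa_idem_duu v : pa_idem k v * pa_duu =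
  pa_arrow k (da v) * pa_arrow k (ua (td v)) * pa_arrow k (ua (tu (td v))) -
  ((lam + mu) *: (pa_arrow k (ua v) * pa_arrow k (da (tu v)) * pa_arrow k (ua (td (tu v)))) +
   (- (lam * mu)) *: (pa_arrow k (ua v) * pa_arrow k (ua (tu v)) * pa_arrow k (da (tu (tu v))))).
Proof.
apply: pa_mul_lin3.
- by have := pa_idem_total3 v da_src ua_src ua_src; rewrite !(ua_tgt, da_tgt).
- by have := pa_idem_total3 v ua_src da_src ua_src; rewrite !(ua_tgt, da_tgt).
- by have := pa_idem_total3 v ua_src ua_src da_src; rewrite !(ua_tgt, da_tgt).
Qed.

Lemma pa_idem_ddu v : pa_idem k v * pa_ddu =
  pa_arrow k (da v) * pa_arrow k (da (td v)) * pa_arrow k (ua (td (td v))) -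
  ((lam + mu) *: (pa_arrow k (da v) * pa_arrow k (ua (td v)) * pa_arrow k (da (tu (td v)))) +
   (- (lam * mu)) *: (pa_arrow k (ua v) * pa_arrow k (da (tu v)) * pa_arrow k (da (td (tu v))))).
Proof.
apply: pa_mul_lin3.
- by have := pa_idem_total3 v da_src da_src ua_src; rewrite !(ua_tgt, da_tgt).
- by have := pa_idem_total3 v da_src ua_src da_src; rewrite !(ua_tgt, da_tgt).
- by have := pa_idem_total3 v ua_src da_src da_src; rewrite !(ua_tgt, da_tgt).
Qed.

End QuiverInstance.

(** * The equivalences for a quiver with two arrows leaving each vertex *)

Section QuiverTheorem.
Context (k : fieldType) (Q : quiver) (rel : set (path_algebra k Q)) (lam mu : k).

Definition quiver_conclusion : Prop :=
  [/\ - (lam * mu) != 0 <-> piecewise_domain (bqa_idem rel),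
      - (lam * mu) != 0 <-> right_noetherian (bqa_kalgebra rel),
      - (lam * mu) != 0 <-> left_noetherian (bqa_kalgebra rel) &
      - (lam * mu) != 0 \/ piecewise_domain (bqa_idem rel) \/
        right_noetherian (bqa_kalgebra rel) \/
        left_noetherian (bqa_kalgebra rel) ->
      twisted_graded_CY (A := bqa_kalgebra rel) (@bqa_homog k Q rel) 3].

(** The relations are written arrow by arrow, so that each of the three types is left with a
    comparison of indices. The condition on the roots makes [mu] vanish together with beta. *)
Lemma quiver_theorem (ua da : vertex Q -> arrow Q) (tu td : vertex Q -> vertex Q)
    (v0 : vertex Q) (p := @pa_arrow k Q) : (lam * mu = 0 -> mu = 0) ->
  injective tu -> injective td ->
  (forall v, asrc (ua v) = v) -> (forall v, asrc (da v) = v) ->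
  (forall v, atgt (ua v) = tu v) -> (forall v, atgt (da v) = td v) ->
  (forall a, a = ua (asrc a) \/ a = da (asrc a)) ->
  (forall v, da v != ua v) -> (forall v, tu (td v) = td (tu v)) ->
  (forall r, rel r <-> exists v,
    r = p (da v) * p (ua (td v)) * p (ua (tu (td v))) -
      ((lam + mu) *: (p (ua v) * p (da (tu v)) * p (ua (td (tu v)))) +
       (- (lam * mu)) *: (p (ua v) * p (ua (tu v)) * p (da (tu (tu v))))) \/
    r = p (da v) * p (da (td v)) * p (ua (td (td v))) -
      ((lam + mu) *: (p (da v) * p (ua (td v)) * p (da (tu (td v)))) +
       (- (lam * mu)) *: (p (ua v) * p (da (tu v)) * p (da (td (tu v)))))) ->
  quiver_conclusion.
Proof.
move=> lm tu_inj td_inj us ds ut dt aP ud tt relE.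
have ut' v : atgt (ua v) = perm tu_inj v by rewrite ut permE.
have dt' v : atgt (da v) = perm td_inj v by rewrite dt permE.
have tt' v : perm tu_inj (perm td_inj v) = perm td_inj (perm tu_inj v).
  by rewrite !permE tt.
have relP r : rel r <-> exists v, r = pa_idem k v * @pa_duu k Q ua da lam mu \/
                                 r = pa_idem k v * @pa_ddu k Q ua da lam mu.
  have duuE v := pa_idem_duu lam mu us ds ut' dt' v.
  have dduE v := pa_idem_ddu lam mu us ds ut' dt' v.
  split=> [/relE[v rE]|[v rE]]; last apply/relE; exists v; move: (duuE v) (dduE v);
    rewrite !permE => eu ed; case: rE => rE; [left|right|left|right].
  - exact: (etrans rE (esym eu)).
  - exact: (etrans rE (esym ed)).
  - exact: (etrans rE eu).
  - exact: (etrans rE ed).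
pose A := quiver_ore us ds ut' dt' aP ud tt' relP.
have [mu0|mu0] := eqVneq mu 0.
  have nd : ~ piecewise_domain (bqa_idem rel) := @degenerate_not_domain _ _ _ _ A mu0 v0.
  have nr : ~ right_noetherian (bqa_kalgebra rel) := @degenerate_not_noetherian _ _ _ _ A mu0 v0.
  have nl : ~ left_noetherian (bqa_kalgebra rel) := @degenerate_not_left_noetherian _ _ _ _ A v0 mu0.
  rewrite /quiver_conclusion mu0 mulr0 oppr0 eqxx.
  by split; [split|split|split|case=> [|[|[]]]].
have lm0 : lam * mu != 0 by apply: contra_neq mu0.
have lam0 : lam != 0 by apply: contra_neq lm0 => ->; rewrite mul0r.
have hd : piecewise_domain (bqa_idem rel) := @ore_piecewise_domain _ _ _ _ A lam0 mu0.
have hr : right_noetherian (bqa_kalgebra rel) := @ore_right_noetherian _ _ _ _ A lam0 mu0.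
have hl : left_noetherian (bqa_kalgebra rel) := @ore_left_noetherian _ _ _ _ A lam0 mu0.
rewrite /quiver_conclusion oppr_eq0 lm0; split=> // _.
by have := @ore_CY _ _ _ _ A lm0; rewrite -[ore_gr (A := A)]quiver_grading.
Qed.

End QuiverTheorem.

Lemma quadratic_factors (k : closedFieldType) (alpha beta : k) :
  exists lam mu, [/\ alpha = lam + mu, beta = - (lam * mu) & lam * mu = 0 -> mu = 0].
Proof.
have [->|beta0] := eqVneq beta 0.
  by exists alpha, 0; rewrite addr0 mulr0 oppr0.
(* With these coefficients the root satisfies [x ^+ 2 = beta + alpha * x], so [x] and [alpha - x]
   are the required pair. *)
pose c i : k := if i is 0%N then beta else alpha.
have [x] := @GRing.solve_monicpoly k 2 c isT.
rewrite !big_ord_recr big_ord0 /= add0r expr0 expr1 mulr1 expr2 => xE.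
have e : - (x * (alpha - x)) = beta by rewrite mulrBr xE mulrC; ring.
exists x, (alpha - x); split=> [||m0]; [ring|by []|].
by move: beta0; rewrite -e m0 oppr0 eqxx.
Qed.

Lemma ord_pred_inj n : injective (@ord_pred n).
Proof. exact: can_inj (@ord_predK n). Qed.

Theorem theorem1 (k : closedFieldType) (char0 : [pchar k] =i pred0)
    (n : nat) (alpha beta : k) (T : quiver_type)
    (hn : ((if T is TypeA then 1 else 2) <= n)%N) :
  [/\ beta != 0 <-> piecewise_domain (du_idem n alpha beta T),
      beta != 0 <-> right_noetherian (du_algebra n alpha beta T),
      beta != 0 <-> left_noetherian (du_algebra n alpha beta T) &
      beta != 0 \/ piecewise_domain (du_idem n alpha beta T) \/
        right_noetherian (du_algebra n alpha beta T) \/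
        left_noetherian (du_algebra n alpha beta T) ->
      twisted_graded_CY (du_grading n alpha beta T) 3].
Proof.
have [lam [mu [-> -> lm]]] := quadratic_factors alpha beta.
have n0 : (0 < n)%N by case: T hn => // /ltnW.
pose v0 := Ordinal n0.
suff : quiver_conclusion (@du_rel k n (lam + mu) (- (lam * mu)) T) lam mu by [].
case: T hn => _.
- apply: (@quiver_theorem k (quiverA n) (@relA k n (lam + mu) (- (lam * mu))) lam mu
    (fun v => inl v) (fun v => inr (ord_pred v)) (@ordS n) (@ord_pred n) v0 lm
    (@ordS_inj n) (@ord_pred_inj n)) => /=.
  + by [].
  + by move=> v; rewrite ord_predK.
  + by [].
  + by [].
  + by case=> v; [left|right; rewrite ordSK].
  + by [].
  + by move=> v; rewrite ord_predK ordSK.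
  (* The second relation of [relA] with index [i] begins with the arrow [d_i], hence at the vertex
     [i + 1]; this accounts for the shifted witnesses. *)
  + move=> r; split=> [[i [->|->]]|[v [->|->]]].
    * by exists i; left; rewrite ord_predK !ordSK.
    * by exists (ordS i); right; rewrite !ordSK.
    * by exists v; left; rewrite ord_predK !ordSK.
    * by exists (ord_pred v); right; rewrite ?ordSK !ord_predK ?ordSK.
- apply: (@quiver_theorem k (quiverB n) (@relB k n (lam + mu) (- (lam * mu))) lam mu
    (fun v => inl v) (fun v => inr v) (@ordS n) (fun v => v) v0 lm
    (@ordS_inj n) (fun v w e => e)) => //=.
  by case=> v; [left|right].
apply: (@quiver_theorem k (quiverC n) (@relC k n (lam + mu) (- (lam * mu))) lam mu
    (fun v => inl v) (fun v => inr v) (@ordS n) (@ordS n) v0 lm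
    (@ordS_inj n) (@ordS_inj n)) => //=.
by case=> v; [left|right].
Qed.
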